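(* The system of variational inequalities with inter-connected obstacles: for all $i\in\mathcal I$, $$\min\Big\{v_i(t,x)-\max_{j\in\mathcal I^{-i}}\big(-g_{ij}(t,x)+v_j(t,x)\big),\ -\partial_tv_i(t,x)-\mathcal Av_i(t,x)-\psi_i(t,x)\Big\}=0,\quad (t,x)\in[0,T]\times\mathbb R^k,\qquad v_i(T,x)=0,$$ has at most one viscosity solution $(v_1,\dots,v_m)$ in the space $$\mathcal C=\{\varphi:[0,T]\times\mathbb R^k\to\mathbb R \text{ continuous}: |\varphi(t,x)|\le C(1+|x|^{p})\ \forall (t,x)\ \text{for some constants } C,p\}$$ (i.e. with each $v_i\in\mathcal C$).
   Context: $T>0$; $b:[0,T]\times\mathbb R^k\to\mathbb R^k$, $\sigma:[0,T]\times\mathbb R^k\to\mathbb R^{k\times d}$ are continuous with $|\sigma(t,x)|+|b(t,x)|\le C(1+|x|)$ and $|\sigma(t,x)-\sigma(t,x')|+|b(t,x)-b(t,x')|\le C|x-x'|$. $\mathcal A=\frac12\sum_{i,j=1}^k(\sigma\sigma^* )_{ij}(t,x)\partial^2_{x_ix_j}+\sum_{i=1}^kb_i(t,x)\partial_{x_i}$. $\mathcal I=\{1,\dots,m\}$, $\mathcal I^{-i}=\mathcal I\setminus\{i\}$. $\psi_i,g_{ij}:[0,T]\times\mathbb R^k\to\mathbb R$ are continuous with $|\psi_i(t,x)|+|g_{ij}(t,x)|\le C(1+|x|^\gamma)$; the switching costs may be negative but satisfy $g_{ii}=0$, $g_{ij}+g_{ji}>0$ for $i\ne j$, and for every $(t,x)$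 and every loop of indices $i_1,\dots,i_k$ with $i_1=i_k$, $g_{i_1i_2}(t,x)+\dots+g_{i_{k-1}i_k}(t,x)+g_{i_ki_1}(t,x)>0$. Viscosity solutions: an $m$-tuple $(v_1,\dots,v_m)$ of continuous real functions on $[0,T]\times\mathbb R^k$ with $v_i(T,\cdot)=0$ is a viscosity supersolution (resp. subsolution) if for each $i$, each $(t_0,x_0)$ and each $\varphi\in C^{1,2}([0,T]\times\mathbb R^k)$ with $\varphi(t_0,x_0)=v_i(t_0,x_0)$ such that $(t_0,x_0)$ is a local maximum (resp. minimum) of $\varphi-v_i$, $$\min\Big\{v_i(t_0,x_0)-\max_{j\in\mathcal I^{-i}}\big(-g_{ij}(t_0,x_0)+v_j(t_0,x_0)\big),\ -\partial_t\varphi(t_0,x_0)-\mathcal A\varphi(t_0,x_0)-\psi_i(t_0,x_0)\Big\}\ge0\ (\text{resp.}\le0);$$ it is a viscosity solution if it is both. *)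

(* Defs.v *)
From HB Require Import structures.
From mathcomp Require Import all_boot all_order all_algebra.
From mathcomp Require Import all_classical all_reals all_analysis.
Set Implicit Arguments. Unset Strict Implicit. Unset Printing Implicit Defensive.
Import Order.TTheory GRing.Theory Num.Theory.
Import numFieldNormedType.Exports.
Local Open Scope classical_set_scope.
Local Open Scope ring_scope.

Section Defs.
Variables (R : realType) (k : nat).

Definition enorm (x : 'rV[R]_k) : R := Num.sqrt (\sum_(i < k) x ord0 i ^+ 2).
Definition fnorm (d : nat) (M : 'M[R]_(k, d)) : R :=
  Num.sqrt (\sum_(i < k) \sum_(j < d) M i j ^+ 2).

Definition evec (i : 'I_k) : 'rV[R]_k := delta_mx ord0 i.

Definition dt (f : R -> 'rV[R]_k -> R) (t : R) (x : 'rV[R]_k) : R :=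
  derive1 (fun s => f s x) t.
Definition dx (i : 'I_k) (f : R -> 'rV[R]_k -> R) (t : R) (x : 'rV[R]_k) : R :=
  derive1 (fun s => f t (x + s *: evec i)) 0.
Definition dxx (i j : 'I_k) (f : R -> 'rV[R]_k -> R) : R -> 'rV[R]_k -> R :=
  dx i (dx j f).

Definition jcont (f : R -> 'rV[R]_k -> R) : Prop :=
  continuous (fun p : R * 'rV[R]_k => f p.1 p.2).

Definition C12 (f : R -> 'rV[R]_k -> R) : Prop :=
  [/\ forall t x, derivable (fun s : R => f s x) t 1,
      forall i t x, derivable (fun s : R => f t (x + s *: evec i)) 0 1,
      forall i j t x, derivable (fun s : R => dx j f t (x + s *: evec i)) 0 1,
      jcont f /\ jcont (dt f)
      & (forall i, jcont (dx i f)) /\ (forall i j, jcont (dxx i j f))].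

Definition dom (T : R) : set (R * 'rV[R]_k) := [set p | 0 <= p.1 <= T].

Definition contOn (T : R) (f : R -> 'rV[R]_k -> R) : Prop :=
  {within dom T, continuous (fun p : R * 'rV[R]_k => f p.1 p.2)}.

Definition polyGrowth (T : R) (f : R -> 'rV[R]_k -> R) : Prop :=
  contOn T f /\
  exists C p : R, forall t x, 0 <= t <= T -> `|f t x| <= C * (1 + enorm x `^ p).

Definition genA (d : nat) (b : R -> 'rV[R]_k -> 'rV[R]_k)
  (sigma : R -> 'rV[R]_k -> 'M[R]_(k, d))
  (f : R -> 'rV[R]_k -> R) (t : R) (x : 'rV[R]_k) : R :=
  2^-1 * (\sum_(i < k) \sum_(j < k)
            (sigma t x *m (sigma t x)^T) i j * dxx i j f t x)
  + \sum_(i < k) b t x ord0 i * dx i f t x.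

Definition locmax (T : R) (f : R -> 'rV[R]_k -> R) (t0 : R) (x0 : 'rV[R]_k) :=
  exists2 e : R, 0 < e & forall t x, 0 <= t <= T -> `|t - t0| < e ->
    enorm (x - x0) < e -> f t x <= f t0 x0.

Local Open Scope ereal_scope.

(* v_i(t,x) - max_{j in I^{-i}} (-g_ij(t,x) + v_j(t,x)), in \bar R
   (the max over the empty set is -oo). *)
Definition obst (m : nat) (g : 'I_m -> 'I_m -> R -> 'rV[R]_k -> R)
  (v : 'I_m -> R -> 'rV[R]_k -> R) (i : 'I_m) (t : R) (x : 'rV[R]_k) : \bar R :=
  (v i t x)%:E - \big[maxe/-oo]_(j < m | j != i) ((- g i j t x + v j t x)%R)%:E.

Definition hjb (m d : nat) (b : R -> 'rV[R]_k -> 'rV[R]_k)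
  (sigma : R -> 'rV[R]_k -> 'M[R]_(k, d))
  (psi : 'I_m -> R -> 'rV[R]_k -> R) (g : 'I_m -> 'I_m -> R -> 'rV[R]_k -> R)
  (v : 'I_m -> R -> 'rV[R]_k -> R) (i : 'I_m) (phi : R -> 'rV[R]_k -> R)
  (t : R) (x : 'rV[R]_k) : \bar R :=
  mine (obst g v i t x) ((- dt phi t x - genA b sigma phi t x - psi i t x)%R)%:E.

Local Close Scope ereal_scope.

Definition visc_super (T : R) (m d : nat) b sigma psi g
  (v : 'I_m -> R -> 'rV[R]_k -> R) : Prop :=
  (forall i, contOn T (v i)) /\ (forall i x, v i T x = 0) /\
  forall i t0 x0 (phi : R -> 'rV[R]_k -> R), 0 <= t0 < T -> C12 phi ->
    phi t0 x0 = v i t0 x0 -> locmax T (fun t x => phi t x - v i t x) t0 x0 ->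
    (0 <= @hjb m d b sigma psi g v i phi t0 x0)%E.

Definition visc_sub (T : R) (m d : nat) b sigma psi g
  (v : 'I_m -> R -> 'rV[R]_k -> R) : Prop :=
  (forall i, contOn T (v i)) /\ (forall i x, v i T x = 0) /\
  forall i t0 x0 (phi : R -> 'rV[R]_k -> R), 0 <= t0 < T -> C12 phi ->
    phi t0 x0 = v i t0 x0 -> locmax T (fun t x => v i t x - phi t x) t0 x0 ->
    (@hjb m d b sigma psi g v i phi t0 x0 <= 0)%E.

Definition visc_sol (T : R) (m d : nat) b sigma psi g v : Prop :=
  @visc_super T m d b sigma psi g v /\ @visc_sub T m d b sigma psi g v.

End Defs.

(* Main.v *)
Require Import Defs.
From HB Require Import structures.
From mathcomp Require Import all_boot all_order all_algebra.
From mathcomp Require Import all_classical all_reals all_analysis.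
From mathcomp Require Import zify ring lra.
Import Order.TTheory GRing.Theory Num.Theory.
Import numFieldNormedType.Exports.
Local Open Scope classical_set_scope.
Local Open Scope ring_scope.

(** The max-comparison argument reduces, by penalizing at infinity, to a maximum
point of [w_i - v_i - th * Psi].  Following the indices at which the obstacle of
[w] is attained would close a loop of zero total cost, so [i] can be chosen with
[w_i] strictly above its obstacle; near that point [w := w_i] and a strict
perturbation [z] of [v_i] are a subsolution and a strict supersolution of one
and the same linear equation, [w <= z] with equality at the centre, and
[w <= z - gap] on the boundary of a small box.

The theorem on sums is not used at this point.  Put [f = (w + z) / 2] on the box,
extend [f] and the coefficients by projecting onto the box, and consider
[N (u - f) - dt u - A u = psi] on the whole space, with [N] large.  Then [w] is a
subsolution and [z - kap / N] a supersolution of this equation, while its solution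
is close to [f] on the boundary, hence well between [w] and [z].  So it suffices to
find smooth approximate super- and subsolutions that are arbitrarily close to each
other.  They come from Krylov's shaking of the coefficients: solve the
discrete scheme whose coefficients may be evaluated at any point within [eps].
Each translate by less than [eps] of the discrete supersolution is a supersolution
of the unshaken scheme, and since the scheme is linear so are averages of translates,
which are smooth.  The distance between the shaken super- and subsolution is bounded
by running the two random walks with the same noise, for which the squared
distance grows at most linearly in [h] because the coefficients are Lipschitz in [x]. *)

Set Implicit Arguments.
Unset Strict Implicit.
Unset Printing Implicit Defensive.

(** A solution of the discrete scheme is only uniformly continuous, and mollifying it does not
    commute with variable coefficients; shaking pays in advance for the displacement that the
    mollifier causes. The mollifier is an iterated average over short segments, so only
    one-dimensional integrals and difference quotients occur. The term [N (u - f)] has three uses: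
    it makes the scheme a contraction on bounded functions, it keeps the solution near [f], which
    replaces boundary data for the box, and it beats the rate at which the squared distance of the
    coupled walks grows. Each constant may depend on those before it: [N] (on the gap at the
    boundary of the box, the strictness, the Lipschitz constant and the modulus of [f]), the
    accuracy [eta], the shaking radius [eps], the averaging length [delta] proportional to [eps],
    the step [r], whose consistency error is [r] times powers of [1 / delta], and the number [n] of
    iterations. A finite iterate is enough, so no fixed point is constructed. *)

Lemma ex_pos_fin (R : realType) (I : finType) (P : I -> R -> Prop) :
  (forall i, exists2 rho : R, 0 < rho & P i rho) ->
  (forall i (rho rho' : R), rho' <= rho -> P i rho -> P i rho') ->
  exists2 rho : R, 0 < rho & forall i, P i rho.
Proof.
move=> Pex Pmono.
have /choice[f fP] : forall i, exists rho : R, 0 < rho /\ P i rho.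
  by move=> i; have [rho ? ?] := Pex i; exists rho.
exists (\big[Num.min/1]_i f i).
  by apply: lt_bigmin => // i _; have [] := fP i.
move=> i; apply: (Pmono i (f i)); last by have [] := fP i.
exact: bigmin_le_cond.
Qed.

(** * Mean value inequality and integrals over the unit interval *)

Section Integral.
Variable R : realType.
Implicit Types f g : R -> R.

Lemma increment_le f df (a b B : R) : a <= b ->
  (forall s, a <= s <= b -> is_derive s 1 f (df s)) ->
  (forall s, a <= s <= b -> df s <= B) -> f b - f a <= B * (b - a).
Proof.
move=> ab fd dB.
have cf : {within `[a, b], continuous f}.
  apply: derivable_within_continuous => s; rewrite in_itv /= => /fd [].
  by [].
have [|c cab ->] := @MVT_segment R f df a b ab _ cf.
  by move=> s; rewrite in_itv /= => /andP[/ltW h1 /ltW h2]; apply: fd; rewrite h1 h2.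
apply: ler_wpM2r; first by rewrite subr_ge0.
by apply: dB; move: cab; rewrite in_itv.
Qed.

Lemma increment_abs_le f df (a b B : R) : a <= b ->
  (forall s, a <= s <= b -> is_derive s 1 f (df s)) ->
  (forall s, a <= s <= b -> `|df s| <= B) -> `|f b - f a| <= B * (b - a).
Proof.
move=> ab fd dB; rewrite ler_norml; apply/andP; split; last first.
  apply: (increment_le ab fd) => s /dB; rewrite ler_norml => /andP[]//.
rewrite lerNl.
have : (- f) b - (- f) a <= B * (b - a).
  apply: (@increment_le (- f) (fun s => - df s)) => //.
    by move=> s /fd h; apply: is_deriveN.
  by move=> s /dB; rewrite ler_norml lerNl => /andP[].
by rewrite /= !fctE opprK opprB addrC.
Qed.

Lemma antiderivative_exists f : continuous f ->
  exists F : R -> R, forall s : R, -2 < s < 3 -> is_derive s 1 F (f s).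
Proof.
move=> cf.
exists (fun x => \int[lebesgue_measure]_(t in [set` Interval (BLeft (-3)) (BRight x)]) f t)%R.
move=> s /andP[s2 s3].
have int : lebesgue_measure.-integrable [set` Interval (BLeft (-3)) (BRight 4)] (EFin \o f).
  apply: continuous_compact_integrable; first exact: segment_compact.
  by apply: continuous_subspaceT.
have [||d e] := @continuous_FTC1 R f (BLeft (-3)) s 4 _ int _ (cf s).
- by lra.
- by rewrite /= lte_fin; lra.
by apply: DeriveDef; [exact: d|rewrite -derive1E; exact: e].
Qed.

(* Defined through an antiderivative, so that uniqueness, linearity and change of
   variable are instances of the mean value inequality; [-2 < s < 3] leaves room to
   translate the unit interval by less than one. *)
Definition int01 f : R :=
  let F := xget (fun _ => 0)
    [set F : R -> R | forall s : R, -2 < s < 3 -> is_derive s 1 F (f s)] in F 1 - F 0.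

Lemma int01E f F : continuous f ->
  (forall s : R, 0 <= s <= 1 -> is_derive s 1 F (f s)) -> int01 f = F 1 - F 0.
Proof.
move=> cf Ff; rewrite /int01.
case: xgetP => [G _ /= GP|]; last first.
  by have [G GP] := antiderivative_exists cf => /(_ G).
have : `|(G - F) 1 - (G - F) 0| <= 0 * (1 - 0).
  apply: (@increment_abs_le (G - F) (fun s => f s - f s)) => //.
    move=> s s01; apply: is_deriveB; first by apply: GP; move: s01; lra.
    exact: Ff.
  by move=> s _; rewrite subrr normr0.
rewrite mul0r normr_le0 !fctE subr_eq0 => /eqP; lra.
Qed.

Lemma int01_lin (a : R) f g : continuous f -> continuous g ->
  int01 (fun s => a * f s + g s) = a * int01 f + int01 g.
Proof.
move=> cf cg.
have [F Fd] := antiderivative_exists cf; have [G Gd] := antiderivative_exists cg.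
have Fd' (s : R) : 0 <= s <= 1 -> is_derive s 1 F (f s) by move=> h; apply: Fd; move: h; lra.
have Gd' (s : R) : 0 <= s <= 1 -> is_derive s 1 G (g s) by move=> h; apply: Gd; move: h; lra.
rewrite (int01E cf Fd') (int01E cg Gd').
have -> : int01 (fun s => a * f s + g s) = (a \*: F + G) 1 - (a \*: F + G) 0.
  apply: int01E.
    by move=> s; apply: cvgD; [apply: cvgM; [exact: cvg_cst|exact: cf]|exact: cg].
  move=> s h; apply: is_deriveD; last exact: Gd'.
  by apply: is_deriveZ; exact: Fd'.
change (a * F 1 + G 1 - (a * F 0 + G 0) = a * (F 1 - F 0) + (G 1 - G 0)); ring.
Qed.

Lemma int01_cst (a : R) : int01 (fun _ => a) = a.
Proof.
have -> : int01 (fun _ => a) = (fun s : R => a * s) 1 - (fun s : R => a * s) 0.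
  apply: int01E; first by move=> s; exact: cvg_cst.
  move=> s _; apply: is_derive_eq; rewrite /GRing.scale /=; ring.
by rewrite /=; ring.
Qed.

Lemma int01_le f g : continuous f -> continuous g ->
  (forall s : R, 0 <= s <= 1 -> f s <= g s) -> int01 f <= int01 g.
Proof.
move=> cf cg fg.
have [F Fd] := antiderivative_exists cf; have [G Gd] := antiderivative_exists cg.
have Fd' (s : R) : 0 <= s <= 1 -> is_derive s 1 F (f s) by move=> h; apply: Fd; move: h; lra.
have Gd' (s : R) : 0 <= s <= 1 -> is_derive s 1 G (g s) by move=> h; apply: Gd; move: h; lra.
rewrite (int01E cf Fd') (int01E cg Gd').
have : (F - G) 1 - (F - G) 0 <= 0 * (1 - 0).
  apply: (@increment_le (F - G) (fun s => f s - g s)) => //.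
    by move=> s h; apply: is_deriveB; [exact: Fd'|exact: Gd'].
  by move=> s h; rewrite subr_le0 fg.
rewrite !fctE; lra.
Qed.
End Integral.

(** * Averages along segments and uniform directional derivatives *)

Section Smoothing.
Variables (R : realType) (V : normedModType R).
Implicit Types (F G : V -> R) (p q v e : V).

(** The final bound is non-strict so that it survives integrals and suprema. *)
Definition ucont F := forall eta : R, 0 < eta ->
  exists2 rho : R, 0 < rho & forall p q, `|p - q| < rho -> `|F p - F q| <= eta.

Lemma ucont_continuous F : ucont F -> continuous F.
Proof.
move=> uF p; apply/cvgrPdist_le => eta /uF[rho rho0 FF].
near=> q; apply: FF; near: q.
by apply/nbhs_normP; exists rho.
Unshelve. all: by end_near. Qed.

Lemma ucont_line F p v : ucont F -> continuous (fun s : R => F (p + s *: v)).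
Proof.
move=> uF s; apply: continuous_comp; last exact: ucont_continuous.
apply: cvgD; first exact: cvg_cst.
by apply: cvgZr_tmp; exact: cvg_id.
Qed.

Lemma ucont_lin (a : R) F G : ucont F -> ucont G -> ucont (fun p => a * F p + G p).
Proof.
move=> uF uG eta eta0.
have a0 : 0 < 2 * (`|a| + 1) by have := normr_ge0 a; lra.
have [r1 r10 F1] := uF (eta / (2 * (`|a| + 1))) (divr_gt0 eta0 a0).
have [|r2 r20 G1] := uG (eta / 2); first by lra.
exists (Num.min r1 r2); first by rewrite lt_min r10.
move=> p q; rewrite lt_min => /andP[/F1 h1 /G1 h2].
have -> : a * F p + G p - (a * F q + G q) = a * (F p - F q) + (G p - G q) by ring.
apply: (le_trans (ler_normD _ _)); rewrite normrM.
have : `|a| * `|F p - F q| <= eta / 2.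
  rewrite ler_pdivlMr // in h1.
  have := normr_ge0 (F p - F q); have := normr_ge0 a; nra.
by lra.
Qed.

Lemma ucont_cst (a : R) : ucont (fun _ => a).
Proof. by move=> eta eta0; exists 1 => // p q _; rewrite subrr normr0 ltW. Qed.

Lemma ucont_shift F v : ucont F -> ucont (fun p => F (p + v)).
Proof.
move=> uF eta /uF[rho rho0 FF]; exists rho => // p q pq; apply: FF.
by rewrite opprD addrACA subrr addr0.
Qed.

(** A one-dimensional mollifier: it gains one derivative, in the direction [v] only. *)
Definition avg v F p : R := int01 (fun s => F (p + s *: v)).

Lemma avg_lin v a F G p : ucont F -> ucont G ->
  avg v (fun p => a * F p + G p) p = a * avg v F p + avg v G p.
Proof. by move=> uF uG; apply: int01_lin; exact: ucont_line. Qed.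

Lemma avg_cst v (a : R) p : avg v (fun _ => a) p = a.
Proof. exact: int01_cst. Qed.

Lemma avg_le v F G p q : ucont F -> ucont G ->
  (forall s : R, 0 <= s <= 1 -> F (p + s *: v) <= G (q + s *: v)) -> avg v F p <= avg v G q.
Proof. by move=> uF uG FG; apply: int01_le => //; exact: ucont_line. Qed.

Lemma avg_shift v e F p : avg v (fun q => F (q + e)) p = avg v F (p + e).
Proof. by congr int01; apply/funext => s; rewrite addrAC. Qed.

Lemma avg_abs_le v F p (c : R) : ucont F ->
  (forall s : R, 0 <= s <= 1 -> `|F (p + s *: v)| <= c) -> `|avg v F p| <= c.
Proof.
move=> uF Fc; rewrite ler_norml; apply/andP; split.
  rewrite -(avg_cst v (- c) p); apply: avg_le => //; first exact: ucont_cst.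
  by move=> s /Fc; rewrite ler_norml => /andP[].
rewrite -(avg_cst v c p); apply: avg_le => //; first exact: ucont_cst.
by move=> s /Fc; rewrite ler_norml => /andP[].
Qed.

Lemma avg_sub v F p q : ucont F ->
  avg v F p - avg v F q = avg v (fun z => F (z + (p - q)) - F z) q.
Proof.
move=> uF.
transitivity (avg v (fun z => -1 * F z + F (z + (p - q))) q); last first.
  by congr (avg v _ q); apply/funext => z; rewrite mulN1r addrC.
rewrite avg_lin ?avg_shift //; last exact: ucont_shift.
by rewrite addrC mulN1r (addrC q) subrK.
Qed.

Lemma ucont_avg v F : ucont F -> ucont (avg v F).
Proof.
move=> uF eta /uF[rho rho0 FF]; exists rho => // p q pq.
rewrite avg_sub //; apply: avg_abs_le.
  have := ucont_lin (-1) uF (ucont_shift (p - q) uF).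
  by congr ucont; apply/funext => z; rewrite mulN1r addrC.
by move=> s _; apply: FF; rewrite addrC addrA addNr add0r.
Qed.

(** [G] is the derivative of [F] along [v] with a remainder uniform in the base point. Uniformity
    lets the estimate pass through averages in other directions without differentiating under an
    integral. *)
Definition udird v F G := forall eta : R, 0 < eta -> exists2 rho : R, 0 < rho &
  forall p (h : R), `|h| < rho -> `|F (p + h *: v) - F p - h * G p| <= eta * `|h|.

Lemma udird_avg x v F G : ucont F -> ucont G -> udird v F G ->
  udird v (avg x F) (avg x G).
Proof.
move=> uF uG FG eta /FG[rho rho0 H]; exists rho => // p h hr.
have -> : avg x F (p + h *: v) - avg x F p - h * avg x G p =
    avg x (fun z => - h * G z + (-1 * F z + F (z + h *: v))) p.
  rewrite avg_lin // ?avg_lin ?avg_shift //.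
  - by ring.
  - exact: ucont_shift.
  - by apply: ucont_lin => //; exact: ucont_shift.
apply: avg_abs_le.
  by do 2 apply: ucont_lin => //; exact: ucont_shift.
move=> s _; have := H (p + s *: x) h hr.
by congr (`| _ | <= _); ring.
Qed.

(** By the fundamental theorem of calculus, sliding a segment along itself changes the average only
    at its two ends. This is the step at which a merely uniformly continuous function gains a
    derivative. *)
Lemma udird_avg_self v F : ucont F -> udird v (avg v F) (fun p => F (p + v) - F p).
Proof.
move=> uF eta eta0.
have [|rho rho0 H] := uF (eta / 2); first by lra.
have v0 : 0 < `|v| + 1 by have := normr_ge0 v; lra.
exists (Num.min 1 (rho / (`|v| + 1))); first by rewrite lt_min ltr01 divr_gt0.
move=> p h; rewrite lt_min => /andP[h1]; rewrite ltr_pdivlMr // => h2.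
pose f := fun s : R => F (p + s *: v).
have cf : continuous f by exact: ucont_line.
have [Phi Phid] := antiderivative_exists cf.
have E0 : avg v F p = Phi 1 - Phi 0.
  by apply: int01E => // s hs; apply: Phid; lra.
have hb : -1 < h < 1 by move: h1; rewrite ltr_norml.
have Eh : avg v F (p + h *: v) = Phi (1 + h) - Phi (0 + h).
  apply: (@int01E _ _ (fun s => Phi (s + h))); first exact: ucont_line.
  move=> s hs.
  have -> : p + h *: v + s *: v = p + (s + h) *: v.
    by rewrite scalerDl -addrA (addrC (h *: v)).
  have d1 : is_derive (s + h) 1 Phi (f (s + h)) by apply: Phid; lra.
  have d2 : is_derive s 1 (fun x : R => x + h) 1.
    by apply: is_derive_eq; rewrite addr0.
  apply: (is_derive_eq (@is_derive1_comp _ Phi (fun x : R => x + h) s _ _ d1 d2)).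
  by rewrite mulr1.
(* Used at the two ends [a = 0] and [a = 1] of the segment, each with half of [eta]. *)
have key (a : R) : 0 <= a <= 1 -> `|Phi (a + h) - Phi a - h * f a| <= eta / 2 * `|h|.
  move=> a01.
  have d (s : R) : -2 < s < 3 -> is_derive s 1 (fun s => Phi s - s * f a) (f s - f a).
    move=> hs; have := Phid s hs => d1; apply: is_derive_eq.
    change (f s - (s * 0 + f a * 1) = f s - f a); ring.
  have b (s : R) : `|s - a| <= `|h| -> `|f s - f a| <= eta / 2.
    move=> sa; apply: H; rewrite opprD addrACA subrr add0r -scalerBl normrZ.
    have := normr_ge0 v; have := normr_ge0 (s - a); move: sa h2.
    set x := `|v|; set y := `|s - a|; set z := `|h|; nra.
  have [h0|h0] := leP 0 h.
    have : `|(Phi (a + h) - (a + h) * f a) - (Phi a - a * f a)| <= eta / 2 * ((a + h) - a).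
      apply: (increment_abs_le (f := fun s => Phi s - s * f a) (df := fun s => f s - f a)); first lra.
        by move=> s hs; apply: d; lra.
      by move=> s hs; apply: b; rewrite !ger0_norm; lra.
    rewrite (ger0_norm h0); congr (`| _ | <= _ * _); ring.
  have : `|(Phi a - a * f a) - (Phi (a + h) - (a + h) * f a)| <= eta / 2 * (a - (a + h)).
    apply: (increment_abs_le (f := fun s => Phi s - s * f a) (df := fun s => f s - f a)); first lra.
      by move=> s hs; apply: d; lra.
    move=> s hs; apply: b; rewrite !ler0_norm; lra.
  rewrite (ltr0_norm h0) -normrN; congr (`| _ | <= _ * _); ring.
have k1 := key 1; have k0 := key 0.
rewrite E0 Eh.
have -> : F (p + v) = f 1 by rewrite /f scale1r.
have -> : F p = f 0 by rewrite /f scale0r addr0.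
have -> : Phi (1 + h) - Phi (0 + h) - (Phi 1 - Phi 0) - h * (f 1 - f 0) =
  (Phi (1 + h) - Phi 1 - h * f 1) - (Phi (0 + h) - Phi 0 - h * f 0) by ring.
apply: (le_trans (ler_normB _ _)).
have := k1 ltac:(lra); have := k0 ltac:(lra); lra.
Qed.

Definition diffv v F p : R := F (p + v) - F p.
Definition avgs (ws : seq V) F := foldr avg F ws.

Lemma ucont_diffv v F : ucont F -> ucont (diffv v F).
Proof.
move=> uF; have := ucont_lin (-1) uF (ucont_shift v uF).
by congr ucont; apply/funext => z; rewrite mulN1r addrC.
Qed.

Lemma avg_diffv x v F : ucont F -> avg x (diffv v F) = diffv v (avg x F).
Proof.
move=> uF; apply/funext => p; rewrite /diffv avg_sub //.
by rewrite [_ + v]addrC addrK.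
Qed.

Lemma ucont_avgs ws F : ucont F -> ucont (avgs ws F).
Proof. by move=> uF; elim: ws => //= w ws IH; exact: ucont_avg. Qed.

Lemma avgs_lin ws a F G p : ucont F -> ucont G ->
  avgs ws (fun p => a * F p + G p) p = a * avgs ws F p + avgs ws G p.
Proof.
move=> uF uG; elim: ws p => //= w ws IH p.
transitivity (avg w (fun p => a * avgs ws F p + avgs ws G p) p).
  by congr (avg w _ p); apply/funext.
by rewrite avg_lin //; exact: ucont_avgs.
Qed.

Lemma avgs_cst ws (a : R) p : avgs ws (fun _ => a) p = a.
Proof.
elim: ws p => //= w ws IH p.
by transitivity (avg w (fun _ => a) p); [congr (avg w _ p); exact/funext|exact: avg_cst].
Qed.

Lemma avgs_shift ws e F p : avgs ws (fun q => F (q + e)) p = avgs ws F (p + e).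
Proof.
elim: ws p => //= w ws IH p; rewrite -avg_shift.
by congr (avg w _ p); exact/funext.
Qed.

Lemma avgs_le ws F G p q : ucont F -> ucont G ->
  (forall e, `|e| <= \sum_(w <- ws) `|w| -> F (p + e) <= G (q + e)) ->
  avgs ws F p <= avgs ws G q.
Proof.
move=> uF uG; elim: ws p q => [|w ws IH] p q /= FG.
  by rewrite -[p]addr0 -[q]addr0; apply: FG; rewrite big_nil normr0.
apply: avg_le; try exact: ucont_avgs.
move=> s s01; apply: IH => e he; rewrite -!addrA; apply: FG.
rewrite big_cons; apply: (le_trans (ler_normD _ _)); apply: lerD => //.
rewrite normrZ ger0_norm; last by lra.
by have := normr_ge0 w; nra.
Qed.

Lemma avgs_abs_le ws F p (c : R) : ucont F -> (forall q, `|F q| <= c) ->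
  `|avgs ws F p| <= c.
Proof.
move=> uF Fc; rewrite ler_norml; apply/andP; split.
  rewrite -(avgs_cst ws (- c) p); apply: avgs_le => //; first exact: ucont_cst.
  by move=> e _; have := Fc (p + e); rewrite ler_norml => /andP[].
rewrite -(avgs_cst ws c p); apply: avgs_le => //; first exact: ucont_cst.
by move=> e _; have := Fc (p + e); rewrite ler_norml => /andP[].
Qed.

Lemma avgs_diffv ws v F : ucont F -> avgs ws (diffv v F) = diffv v (avgs ws F).
Proof.
by move=> uF; elim: ws => //= w ws ->; rewrite avg_diffv //; exact: ucont_avgs.
Qed.

(** Averages preserve uniform derivatives and commute with differences, so an occurrence of [v]
    anywhere in [ws] can be spent on one derivative along [v]; what remains is a difference of [F]
    under the other averages. *)
Lemma udird_avgs ws v F : ucont F -> v \in ws ->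
  udird v (avgs ws F) (avgs (rem v ws) (diffv v F)).
Proof.
move=> uF; elim: ws => //= w ws IH; rewrite inE.
have [-> _|vw /= vws] := eqVneq v w.
  rewrite avgs_diffv //; apply: udird_avg_self; exact: ucont_avgs.
apply: udird_avg.
- exact: ucont_avgs.
- by apply: ucont_avgs; exact: ucont_diffv.
- exact: IH.
Qed.

Lemma udird0 F : udird 0 F (fun _ => 0).
Proof.
move=> eta eta0; exists 1 => // p h _.
by rewrite scaler0 addr0 subrr mulr0 subr0 normr0 mulr_ge0 // ltW.
Qed.

(** The increment is made in two legs. The second one starts at [p + h *: v], and the uniform
    continuity of [H] brings its derivative back to [p]. *)
Lemma udird_lin v w (c : R) F G H : ucont H -> udird v F G -> udird w F H ->
  udird (v + c *: w) F (fun p => G p + c * H p).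
Proof.
move=> uH FG FH eta eta0.
have c0 := normr_ge0 c.
have cp : 0 < `|c| + 1 by lra.
have v0 := normr_ge0 v.
have vp : 0 < `|v| + 1 by lra.
have e1 : 0 < eta / 3 by lra.
have e2 : 0 < eta / 3 / (`|c| + 1) by rewrite divr_gt0.
have [r1 r10 h1] := FG _ e1.
have [r2 r20 h2] := FH _ e2.
have [r3 r30 h3] := uH _ e2.
exists (Num.min r1 (Num.min (r2 / (`|c| + 1)) (r3 / (`|v| + 1)))).
  by rewrite !lt_min r10 !divr_gt0.
move=> p h; rewrite !lt_min !ltr_pdivlMr // => /and3P[k1 k2 k3].
have n0 := normr_ge0 h.
have := h1 p h k1.
have hc : `|h * c| < r2 by rewrite normrM; nra.
have := h2 (p + h *: v) (h * c) hc; rewrite normrM.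
have : `|(p + h *: v) - p| < r3 by rewrite addrC addrA addNr add0r normrZ; nra.
move=> /h3; rewrite -(scalerA h c) (_ : p + h *: (v + c *: w) = p + h *: v + h *: (c *: w)); last first.
  by rewrite scalerDr addrA.
set a1 := F _; set a2 := F (p + h *: v); set a3 := F p; set b1 := H _; set b2 := H _.
set g := G p; set N := `|h| in n0 *; set C := `|c| in c0 cp e2 *.
move=> t3 t2 t1.
have -> : a1 - a3 - h * (g + c * b2) = (a1 - a2 - h * c * b1) + (h * c * (b1 - b2) + (a2 - a3 - h * g)) by ring.
apply: (le_trans (ler_normD _ _)); have := ler_normD (h * c * (b1 - b2)) (a2 - a3 - h * g).
rewrite !normrM -/N -/C.
have ec : eta / 3 / (C + 1) * C <= eta / 3.
  by rewrite -mulrA ler_piMr ?(ltW e1) // mulrC ler_pdivrMr // mul1r; lra.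
move: t1 t2 t3 ec; set u := eta / 3 / (C + 1).
set x1 := `|a1 - _ - _|; set x2 := `|b1 - b2|; set x3 := `|a2 - _ - _| => t1 t2 t3 ec t4.
have : N * C * x2 <= N * C * u by apply: ler_wpM2l => //; exact: mulr_ge0.
have : N * (u * C) <= N * (eta / 3) by apply: ler_wpM2l.
lra.
Qed.

Lemma udird_sum (I : Type) (r : seq I) (c : I -> R) (v : I -> V) F (G : I -> V -> R) :
  (forall i, ucont (G i)) -> (forall i, udird (v i) F (G i)) ->
  udird (\sum_(i <- r) c i *: v i) F (fun p => \sum_(i <- r) c i * G i p).
Proof.
move=> uG FG; elim: r => [|i r IH].
  rewrite big_nil; have := @udird0 F; congr udird.
  by apply/funext => p; rewrite big_nil.
rewrite big_cons addrC; have := udird_lin (c i) (uG i) IH (FG i).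
by congr udird; apply/funext => p; rewrite big_cons addrC.
Qed.

Lemma ucont_sum (I : Type) (r : seq I) (c : I -> R) (G : I -> V -> R) :
  (forall i, ucont (G i)) -> ucont (fun p => \sum_(i <- r) c i * G i p).
Proof.
move=> uG; elim: r => [|i r IH].
  have := ucont_cst 0; congr ucont.
  by apply/funext => p; rewrite big_nil.
have := ucont_lin (c i) (uG i) IH.
by congr ucont; apply/funext => p; rewrite big_cons.
Qed.

Lemma udird_scale (c : R) v F G : ucont G -> udird v F G ->
  udird (c *: v) F (fun p => c * G p).
Proof.
move=> uG FG; have := udird_lin c uG (@udird0 F) FG.
by rewrite add0r; congr udird; apply/funext => p; rewrite add0r.
Qed.

Lemma udird_lincomb v a F F' G G' : udird v F F' -> udird v G G' ->
  udird v (fun p => a * F p + G p) (fun p => a * F' p + G' p).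
Proof.
move=> hF hG eta eta0.
have a0 := normr_ge0 a.
have ap : 0 < 2 * (`|a| + 1) by lra.
have [|r1 r10 F1] := hF (eta / (2 * (`|a| + 1))); first exact: divr_gt0.
have [|r2 r20 G1] := hG (eta / 2); first by lra.
exists (Num.min r1 r2); first by rewrite lt_min r10.
move=> p h; rewrite lt_min => /andP[/(F1 p) h1 /(G1 p) h2].
have -> : a * F (p + h *: v) + G (p + h *: v) - (a * F p + G p) - h * (a * F' p + G' p) =
  a * (F (p + h *: v) - F p - h * F' p) + (G (p + h *: v) - G p - h * G' p) by ring.
apply: (le_trans (ler_normD _ _)); rewrite normrM.
move: h1; rewrite mulrAC ler_pdivlMr //; have := normr_ge0 (F (p + h *: v) - F p - h * F' p).
nra.
Qed.

Lemma udird_is_derive v F G p (s : R) : udird v F G ->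
  is_derive s 1 (fun s : R => F (p + s *: v)) (G (p + s *: v)).
Proof.
move=> FG.
have H : (h^-1 *: ((fun s : R => F (p + s *: v)) (h *: (1 : R) + s) - F (p + s *: v)))
    @[h --> 0^'] --> G (p + s *: v).
  apply/cvgrPdist_le => eta eta0.
  have [rho rho0 h1] := FG eta eta0.
  have : \forall h \near (0 : R)^', `|h| < rho by exact: dnbhs0_lt.
  apply: filter_app; near=> h => hr.
  have h0 : h != 0 by near: h; exact: nbhs_dnbhs_neq.
  have := h1 (p + s *: v) h hr.
  have -> : h *: (1 : R) + s = h + s by rewrite /GRing.scale /= mulr1.
  have -> : p + (h + s) *: v = p + s *: v + h *: v by rewrite (addrC h) scalerDl addrA.
  set a := F _; set b := F _; set c := G _.
  have -> : c - h^-1 *: (a - b) = - (h^-1 * (a - b - h * c)).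
    change (c - h^-1 * (a - b) = - (h^-1 * (a - b - h * c))); by field.
  by rewrite normrN normrM normfV ler_pdivrMl ?normr_gt0 // (mulrC _ eta).
apply: DeriveDef; first by apply/cvg_ex; exists (G (p + s *: v)).
exact/cvg_lim.
Unshelve. all: by end_near. Qed.

Lemma taylor1 y F F1 F2 p (B : R) : udird y F F1 -> udird y F1 F2 ->
  (forall q, `|F2 q| <= B) -> `|F (p + y) - F p - F1 p| <= B.
Proof.
move=> d1 d2 b2.
have B0 : 0 <= B by apply: le_trans (b2 0).
pose g (s : R) := F (p + s *: y) - s * F1 p.
have -> : F (p + y) - F p - F1 p = g 1 - g 0 by rewrite /g scale1r scale0r addr0; ring.
rewrite -[B]mulr1 -[X in B * X](subr0 1).
apply: (increment_abs_le (df := fun s => F1 (p + s *: y) - F1 p)) => // s hs.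
  have e1 := udird_is_derive p s d1; apply: is_derive_eq.
  change (F1 (p + s *: y) - (s * 0 + F1 p * 1) = F1 (p + s *: y) - F1 p); ring.
have -> : F1 p = F1 (p + 0 *: y) by rewrite scale0r addr0.
apply: (@le_trans _ _ (B * (s - 0))); last by nra.
apply: (increment_abs_le (f := fun s => F1 (p + s *: y)) (df := fun s => F2 (p + s *: y))) => //.
  by lra.
by move=> r _; exact: udird_is_derive.
Qed.

(** The odd terms cancel in the symmetric difference, so the remainder is of third order. The
    derivatives are taken along [y] itself, hence the cube of the length of [y] is hidden in [B]. *)
Lemma taylor2 y F F1 F2 F3 p (B : R) :
  udird y F F1 -> udird y F1 F2 -> udird y F2 F3 ->
  (forall q, `|F3 q| <= B) -> `|F (p + y) + F (p - y) - 2 * F p - F2 p| <= 2 * B.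
Proof.
move=> d1 d2 d3 b3.
have B0 : 0 <= B by apply: le_trans (b3 0).
have dd (A A' : V -> R) (s : R) : udird y A A' ->
    is_derive s 1 (fun s : R => A (p + (- s) *: y)) (- A' (p + (- s) *: y)).
  move=> dA; have e1 := udird_is_derive p (- s) dA.
  have e2 : is_derive s 1 (fun s : R => - s) (-1) by apply: is_derive_eq.
  apply: (is_derive_eq (@is_derive1_comp _ _ (fun s : R => - s) s _ _ e1 e2)).
  by rewrite mulrN1.
have dif (s : R) : 0 <= s <= 1 ->
    `|F2 (p + s *: y) + F2 (p + (- s) *: y) - 2 * F2 p| <= 2 * B.
  move=> hs.
  have -> : F2 (p + s *: y) + F2 (p + - s *: y) - 2 * F2 p =
     (F2 (p + s *: y) - F2 (p + 0 *: y)) - (F2 (p + 0 *: y) - F2 (p + (- s) *: y)).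
    by rewrite scale0r addr0; ring.
  apply: (le_trans (ler_normB _ _)).
  have : `|F2 (p + s *: y) - F2 (p + 0 *: y)| <= B * (s - 0).
    apply: (increment_abs_le (f := fun s => F2 (p + s *: y)) (df := fun s => F3 (p + s *: y))) => //.
      by lra.
    by move=> r _; exact: udird_is_derive.
  have : `|F2 (p + 0 *: y) - F2 (p + (- s) *: y)| <= B * (0 - - s).
    apply: (increment_abs_le (f := fun s => F2 (p + s *: y)) (df := fun s => F3 (p + s *: y))) => //.
      by lra.
    by move=> r _; exact: udird_is_derive.
  nra.
pose g1 (s : R) := F1 (p + s *: y) - F1 (p + (- s) *: y) - 2 * (s * F2 p).
have g1b (s : R) : 0 <= s <= 1 -> `|g1 s| <= 2 * B.
  move=> hs.
  have -> : g1 s = g1 s - g1 0 by rewrite /g1 oppr0 scale0r addr0; ring.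
  apply: (@le_trans _ _ (2 * B * (s - 0))); last by nra.
  apply: (increment_abs_le (df := fun s => F2 (p + s *: y) + F2 (p + (- s) *: y) - 2 * F2 p)); first by lra.
    move=> r hr; have e1 := udird_is_derive p r d2; have e2 := dd _ _ r d2.
    apply: is_derive_eq.
    change (F2 (p + r *: y) - - F2 (p + - r *: y) - (2 * (r * 0 + F2 p * 1)) =
      F2 (p + r *: y) + F2 (p + - r *: y) - 2 * F2 p); ring.
  by move=> r hr; apply: dif; lra.
pose g0 (s : R) := F (p + s *: y) + F (p + (- s) *: y) - s * s * F2 p.
have -> : F (p + y) + F (p - y) - 2 * F p - F2 p = g0 1 - g0 0.
  by rewrite /g0 oppr0 scale0r scale1r scaleN1r addr0; ring.
rewrite -[2 * B]mulr1 -[X in _ * X](subr0 1).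
apply: (increment_abs_le (df := g1)) => //.
move=> r hr; have e1 := udird_is_derive p r d1; have e2 := dd _ _ r d1.
apply: is_derive_eq; rewrite /g1.
change (F1 (p + r *: y) + - F1 (p + - r *: y) - (r * r * 0 + F2 p * (r * 1 + r * 1)) =
  F1 (p + r *: y) - F1 (p + - r *: y) - 2 * (r * F2 p)); ring.
Qed.
End Smoothing.

(** * The shaken discrete scheme *)

Section Scheme.
Variables (R : realType) (V : normedModType R) (I : finType).
Variables (pr : I -> R) (y : I -> V -> V) (G : V -> R) (N h eps c : R).
Hypotheses (pr0 : forall i, 0 <= pr i) (N0 : 0 < N) (h0 : 0 < h) (eps0 : 0 < eps).
Hypothesis Gc : forall p, `|G p| <= N * c.
Implicit Types (u : V -> R) (p q : V).

Let W := \sum_i pr i.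
(** The discretization of [N u - L u = G], where [L u] is the sum of [pr i * (u (p + y i q) - u p)]
    divided by [h], solved for the value at [p]. The coefficients are read at [q], independently of
    the base point [p] from which the moves start. *)
Definition disc_step u q p : R := (N * h + W)^-1 * (\sum_i pr i * u (p + y i q) + h * G q).
Definition disc_sup u p : R := sup [set disc_step u q p | q in [set q | `|q - p| <= eps]].
Definition disc_sol n := iter n disc_sup (fun _ => c).

Let W0 : 0 <= W. Proof. by apply: sumr_ge0. Qed.
Let NW : 0 < N * h + W. Proof. by have := mulr_gt0 N0 h0; have := W0; lra. Qed.
Let c0 : 0 <= c.
Proof. by have := le_trans (normr_ge0 _) (Gc 0); rewrite pmulr_rge0. Qed.

Lemma disc_step_mono u v q p : (forall z, u z <= v z) -> disc_step u q p <= disc_step v q p.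
Proof.
move=> uv; rewrite /disc_step ler_pM2l ?invr_gt0 // lerD2r.
by apply: ler_sum => i _; apply: ler_wpM2l.
Qed.

Lemma disc_step_le_cst u q p : (forall z, u z <= c) -> disc_step u q p <= c.
Proof.
move=> uc; rewrite /disc_step ler_pdivrMl //.
have : \sum_i pr i * u (p + y i q) <= W * c.
  by rewrite /W mulr_suml; apply: ler_sum => i _; exact: ler_wpM2l.
have := Gc q; rewrite ler_norml => /andP[_ g1].
have : h * G q <= h * (N * c) by rewrite ler_pM2l.
lra.
Qed.

Lemma disc_step_ge_cst u q p : (forall z, - c <= u z) -> - c <= disc_step u q p.
Proof.
move=> uc; rewrite /disc_step ler_pdivlMl //.
have : W * (- c) <= \sum_i pr i * u (p + y i q).
  by rewrite /W mulr_suml; apply: ler_sum => i _; exact: ler_wpM2l.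
have := Gc q; rewrite ler_norml => /andP[g1 _].
have : h * - (N * c) <= h * G q by rewrite ler_pM2l.
lra.
Qed.

Lemma disc_sup_ub u q p : (forall z, u z <= c) -> `|q - p| <= eps ->
  disc_step u q p <= disc_sup u p.
Proof.
move=> uc qp; apply: ub_le_sup; last by exists q.
by exists c => _ [z _ <-]; exact: disc_step_le_cst.
Qed.

Lemma disc_sup_le u p (x : R) :
  (forall q, `|q - p| <= eps -> disc_step u q p <= x) -> disc_sup u p <= x.
Proof.
move=> H; apply: ge_sup; last by move=> _ [z /H hz <-].
by exists (disc_step u p p), p => //=; rewrite subrr normr0 ltW.
Qed.

Lemma disc_sol_abs_le n p : `|disc_sol n p| <= c.
Proof.
elim: n p => [|n IH] p /=; first by rewrite ger0_norm.
have l z : disc_sol n z <= c by have := IH z; rewrite ler_norml => /andP[].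
rewrite ler_norml; apply/andP; split.
  apply: le_trans (disc_sup_ub l (q := p) _); last by rewrite subrr normr0 ltW.
  by apply: disc_step_ge_cst => z; have := IH z; rewrite ler_norml => /andP[].
by apply: disc_sup_le => q _; exact: disc_step_le_cst.
Qed.

Let sol_le n p : disc_sol n p <= c.
Proof. by have := disc_sol_abs_le n p; rewrite ler_norml => /andP[]. Qed.

(* The iteration starts from the constant supersolution [c], so every iterate is
   already an exact supersolution of the scheme. *)
Lemma disc_sol_decr n p : disc_sol n.+1 p <= disc_sol n p.
Proof.
elim: n p => [|n IH] p; first exact: sol_le.
apply: disc_sup_le => q qp.
by apply: le_trans (disc_sup_ub (sol_le n) qp); exact: disc_step_mono.
Qed.

Lemma disc_sol_super n p q : `|q - p| <= eps -> disc_step (disc_sol n) q p <= disc_sol n p.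
Proof.
case: n => [|n] qp; first by apply: disc_step_le_cst => z; exact: sol_le.
apply: le_trans (disc_sup_ub (sol_le n) qp).
by apply: disc_step_mono => z; exact: disc_sol_decr.
Qed.

(** Discrete comparison with a subsolution: the iteration starts above [B], the step is monotone,
    and the supremum includes the unshaken choice [q = p]. *)
Lemma disc_sol_ge_barrier (B : V -> R) n :
  (forall p, B p <= c) -> (forall p, B p <= disc_step B p p) ->
  forall p, B p <= disc_sol n p.
Proof.
move=> Bc BB; elim: n => [|n IH] p; first exact: Bc.
apply: le_trans (BB p) _; apply: le_trans (disc_step_mono _ _ IH) _.
by apply: disc_sup_ub; [exact: sol_le|rewrite subrr normr0 ltW].
Qed.

Hypothesis yu : forall i (eta : R), 0 < eta -> exists2 rho : R, 0 < rho &
  forall p q, `|p - q| < rho -> `|y i p - y i q| <= eta.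
Hypothesis Gu : ucont G.

Lemma disc_sup_ucont u : ucont u -> (forall p, u p <= c) -> ucont (disc_sup u).
Proof.
move=> uu uc eta eta0.
have W1 : 0 < W + 1 by have := W0; lra.
have e1 : 0 < (N * h + W) * (eta / 2) / (W + 1).
  by rewrite divr_gt0 // mulr_gt0 //; lra.
have e2 : 0 < (N * h + W) * (eta / 2) / h by rewrite divr_gt0 // mulr_gt0 //; lra.
have [r1 r10 u1] := uu _ e1.
have [r2 r20 G1] := Gu e2.
have [r3 r30 y1] : exists2 rho : R, 0 < rho & forall i p q, `|p - q| < rho ->
    `|y i p - y i q| <= r1 / 4.
  have r14 : 0 < r1 / 4 by lra.
  apply: ex_pos_fin => [i|i rho rho' rr H p q pq]; first exact: yu.
  by apply: H; exact: lt_le_trans pq rr.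
exists (Num.min (r1 / 4) (Num.min r2 r3)); first by rewrite !lt_min r20 r30 divr_gt0.
have key p p' : `|p - p'| < Num.min (r1 / 4) (Num.min r2 r3) ->
    disc_sup u p <= disc_sup u p' + eta.
  rewrite !lt_min => /and3P[l1 l2 l3].
  apply: disc_sup_le => q qp.
  (* The shaken point is translated together with the base point, which keeps it within [eps]. *)
  have E : (q + (p' - p)) - p' = q - p by rewrite addrA addrAC addrK.
  apply: (@le_trans _ _ (disc_step u (q + (p' - p)) p' + eta)); last first.
    by rewrite lerD2r; apply: disc_sup_ub; rewrite ?E.
  have qq : q - (q + (p' - p)) = p - p' by rewrite opprD addrA subrr add0r opprB.
  rewrite /disc_step -lerBlDl -mulrBr ler_pdivrMl //.
  have g1 : G q - G (q + (p' - p)) <= (N * h + W) * (eta / 2) / h.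
    apply: le_trans (ler_norm _) _; apply: G1; by rewrite qq.
  have : h * (G q - G (q + (p' - p))) <= (N * h + W) * (eta / 2).
    by rewrite -ler_pdivlMl // mulrC.
  have : \sum_i pr i * u (p + y i q) - \sum_i pr i * u (p' + y i (q + (p' - p))) <=
      (N * h + W) * (eta / 2).
    rewrite -sumrB.
    apply: (@le_trans _ _ (\sum_i pr i * ((N * h + W) * (eta / 2) / (W + 1)))).
      apply: ler_sum => i _; rewrite -mulrBr; apply: ler_wpM2l => //.
      apply: le_trans (ler_norm _) _; apply: u1.
      rewrite opprD addrACA; apply: (le_lt_trans (ler_normD _ _)).
      have := y1 i q (q + (p' - p)); rewrite qq => /(_ l3); lra.
    rewrite -mulr_suml -/W mulrA ler_pdivrMr // mulrC; apply: ler_wpM2l; last by lra.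
    by rewrite mulr_ge0 ?(ltW NW) //; lra.
  lra.
move=> p p' pp'; rewrite ler_norml; have := key p p' pp'.
by have := key p' p; rewrite distrC => /(_ pp'); lra.
Qed.

Lemma disc_sol_ucont n : ucont (disc_sol n).
Proof.
elim: n => [|n IH]; first exact: ucont_cst.
by apply: disc_sup_ucont => // p; exact: sol_le.
Qed.

Lemma avgs_sum (ws : seq V) (F : I -> V -> R) (a : R) p : (forall i, ucont (F i)) ->
  avgs ws (fun z => \sum_i pr i * F i z + a) p = \sum_i pr i * avgs ws (F i) p + a.
Proof.
move=> uF; elim: (index_enum I) => [|i r IH].
  rewrite big_nil -[in RHS](avgs_cst ws a p) add0r.
  by congr (avgs ws _ p); apply/funext => z; rewrite big_nil add0r.
rewrite big_cons -addrA -IH -avgs_lin //.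
  by congr (avgs ws _ p); apply/funext => z; rewrite big_cons addrA.
have := ucont_lin 1 (ucont_sum r pr uF) (ucont_cst V a).
by congr ucont; apply/funext => z; rewrite mul1r.
Qed.

(* Shifting the base point of the scheme by [e] and its shaken point by [- e]
   leaves the shaken point, hence all the coefficients, unchanged. *)
Lemma avgs_disc_sol_super (ws : seq V) n p : \sum_(w <- ws) `|w| <= eps ->
  \sum_i pr i * avgs ws (disc_sol n) (p + y i p) + h * G p <=
    (N * h + W) * avgs ws (disc_sol n) p.
Proof.
move=> wse; set U := avgs ws (disc_sol n).
have us i : ucont (fun z => disc_sol n (z + y i p)).
  by apply: ucont_shift; exact: disc_sol_ucont.
have -> : \sum_i pr i * U (p + y i p) = \sum_i pr i * avgs ws (fun z => disc_sol n (z + y i p)) p.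
  by apply: eq_bigr => i _; rewrite avgs_shift.
rewrite -avgs_sum //.
have -> : (N * h + W) * U p = avgs ws (fun z => (N * h + W) * disc_sol n z + 0) p.
  by rewrite avgs_lin ?avgs_cst ?addr0 //; [exact: disc_sol_ucont|exact: ucont_cst].
apply: avgs_le.
- have := ucont_lin 1 (ucont_sum (index_enum I) pr us) (ucont_cst V (h * G p)).
  by congr ucont; apply/funext => z; rewrite mul1r.
- by apply: ucont_lin; [exact: disc_sol_ucont|exact: ucont_cst].
move=> e he; rewrite addr0 -ler_pdivrMl //.
apply: (@disc_sol_super n (p + e) p).
by rewrite opprD addrA subrr add0r normrN (le_trans he).
Qed.
End Scheme.

(** The iterate for [- G] is minus the scheme shaken by an infimum, so the sum is the gap between
    the upper and the lower shaken solution. Both walks take the same branch [i]; [Phi] is a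
    supersolution of the coupled scheme, and the initial gap [2 * c] shrinks by a fixed factor at
    each step. The relation [rel], kept by common moves, will be equality of times, since the
    coefficients are Lipschitz in space only. *)
Lemma disc_sol_coupling (R : realType) (V : normedModType R) (I : finType)
    (pr : I -> R) (y : I -> V -> V) (G : V -> R) (N h eps c : R)
    (rel : V -> V -> Prop) (Phi : V -> V -> R) :
  (forall i, 0 <= pr i) -> 0 < N -> 0 < h -> 0 < eps -> (forall p, `|G p| <= N * c) ->
  (forall p p' i q q', rel p p' -> rel (p + y i q) (p' + y i q')) ->
  (forall p p', 0 <= Phi p p') ->
  (forall p p' q q', rel p p' -> `|q - p| <= eps -> `|q' - p'| <= eps ->
     \sum_i pr i * Phi (p + y i q) (p' + y i q') + h * (G q - G q')
       <= (N * h + \sum_i pr i) * Phi p p') ->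
  forall n p p', rel p p' ->
  disc_sol pr y G N h eps c n p + disc_sol pr y (fun z => - G z) N h eps c n p'
    <= Phi p p' + 2 * c * ((\sum_i pr i) / (N * h + \sum_i pr i)) ^+ n.
Proof.
move=> pr0 N0 h0 eps0 Gc rely Phi0 PhiP.
have Gc' p : `|- G p| <= N * c by rewrite normrN.
set W := \sum_i pr i.
have W0 : 0 <= W by apply: sumr_ge0.
have NW : 0 < N * h + W by have := mulr_gt0 N0 h0; lra.
elim=> [|n IH] p p' pp'; first by rewrite /= expr0; have := Phi0 p p'; lra.
set X := _ + _ * _ ^+ n.+1.
rewrite -lerBrDr; apply: disc_sup_le => // q qp.
rewrite lerBrDr addrC -lerBrDr; apply: disc_sup_le => // q' qp'.
rewrite lerBrDr /disc_step -/W -mulrDr ler_pdivrMl //.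
set f := W / (N * h + W) in IH X *.
have -> : (N * h + W) * X = (N * h + W) * Phi p p' + W * (2 * c * f ^+ n).
  rewrite /X exprS /f; move: ((W / _) ^+ n) => z; field.
  by apply/eqP; lra.
have := PhiP p p' q q' pp' qp qp'.
have : \sum_i pr i * disc_sol pr y G N h eps c n (p + y i q) +
   \sum_i pr i * disc_sol pr y (fun z => - G z) N h eps c n (p' + y i q') <=
   \sum_i pr i * Phi (p + y i q) (p' + y i q') + W * (2 * c * f ^+ n).
  rewrite /W mulr_suml -!big_split /=; apply: ler_sum => i _; rewrite -!mulrDr.
  by apply: ler_wpM2l => //; apply: IH; exact: rely.
rewrite -/W addrC; lra.
Qed.

(** * Derivatives of the averaged function and their Taylor expansions *)

Section Consistency.
Variables (R : realType) (k : nat).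
Local Notation V := (R * 'rV[R]_k)%type.
Implicit Types (F G : V -> R) (p q : V) (o : option 'I_k).

Definition ebase o : V := if o is Some i then (0, evec R i) else (1, 0).

Lemma udird_fsum (W : normedModType R) (I : Type) (r : seq I) (c : I -> R) (v : W)
    (F G : I -> W -> R) : (forall i, udird v (F i) (G i)) ->
  udird v (fun z => \sum_(i <- r) c i * F i z) (fun z => \sum_(i <- r) c i * G i z).
Proof.
move=> FG; elim: r => [|i r IH].
  move=> eta eta0; exists 1 => // z h _.
  by rewrite !big_nil mulr0 !subr0 normr0 mulr_ge0 // ltW.
have := udird_lincomb (c i) (FG i) IH.
by congr udird; apply/funext => p; rewrite big_cons.
Qed.

Lemma norm_evec (i : 'I_k) : `|evec R i| <= 1.
Proof.
rewrite [`|_|]mx_normrE; apply: bigmax_le => // -[a b] _ /=.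
by rewrite mxE; case: (_ && _); rewrite ?normr1 ?normr0.
Qed.

Lemma norm_ebase o : `|ebase o| <= 1.
Proof.
rewrite prod_normE ge_max; case: o => [i|] /=.
  by rewrite normr0 ler01 norm_evec.
by rewrite normr1 lexx normr0 ler01.
Qed.

Lemma row_ebase (z : 'rV[R]_k) : (0, z) = \sum_i z ord0 i *: ebase (Some i) :> V.
Proof.
have -> : \sum_i z ord0 i *: ebase (Some i) =
    (\sum_(i < k) (z ord0 i *: ebase (Some i)).1, \sum_(i < k) (z ord0 i *: ebase (Some i)).2).
  elim/big_rec3: _ => // i a b1 b2 _ ->.
  by [].
congr pair.
  by rewrite big1 // => i _ /=; rewrite scaler0.
rewrite [LHS]row_sum_delta; apply: eq_bigr => i _ /=.
by [].
Qed.

Lemma abs_coord_le (z : 'rV[R]_k) i : `|z ord0 i| <= `|z|.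
Proof.
rewrite [leRHS]mx_normrE; exact: (le_bigmax _ (fun ij => `|z ij.1 ij.2|) (ord0, i)).
Qed.

Lemma udird_dt F F' : udird (ebase None) F F' ->
  (forall t x, derivable (fun s => F (s, x)) t 1) /\ dt (fun t x => F (t, x)) = fun t x => F' (t, x).
Proof.
move=> FF.
have d (t : R) x : is_derive t 1 (fun s => F (s, x)) (F' (t, x)).
  have E (s : R) : (0, x) + s *: ebase None = (s, x).
    by congr pair; rewrite /= ?scaler0 ?addr0 // add0r [LHS]mulr1.
  have := udird_is_derive (0, x) t FF; rewrite E.
  by congr is_derive; apply/funext => s; rewrite E.
split=> [t x|]; first exact: ex_derive.
by apply/funext => t; apply/funext => x; rewrite /dt derive1E; apply: derive_val.
Qed.

Lemma udird_dx i F F' : udird (ebase (Some i)) F F' ->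
  (forall t x, derivable (fun s : R => F (t, x + s *: evec R i)) 0 1) /\
  dx i (fun t x => F (t, x)) = fun t x => F' (t, x).
Proof.
move=> FF.
have d (t : R) x : is_derive (0 : R) 1 (fun s : R => F (t, x + s *: evec R i)) (F' (t, x)).
  have E (s : R) : (t, x) + s *: ebase (Some i) = (t, x + s *: evec R i).
    by congr pair; rewrite /= scaler0 addr0.
  have := udird_is_derive (t, x) 0 FF; rewrite E scale0r addr0.
  by congr is_derive; apply/funext => s; rewrite E.
split=> [t x|]; first exact: ex_derive.
by apply/funext => t; apply/funext => x; rewrite /dx derive1E; apply: derive_val.
Qed.

Variables (delta : R) (F : V -> R) (c : R).
Hypotheses (delta0 : 0 < delta) (uF : ucont F) (Fc : forall p, `|F p| <= c).

(** Each basis direction occurs three times: two derivatives for [C12] and a third for the remainder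
    of the symmetric second difference. The step [delta] makes the total displacement proportional
    to [delta], hence absorbable by the shaking. *)
Definition sdirs : seq V := let l := [seq delta *: ebase o | o <- enum {: option 'I_k}] in
  l ++ l ++ l.

Lemma sum_norm_sdirs : \sum_(w <- sdirs) `|w| <= 3 * k.+1%:R * delta.
Proof.
rewrite /sdirs !big_cat /= big_map.
suff : \sum_(o <- enum {: option 'I_k}) `|delta *: ebase o| <= k.+1%:R * delta by lra.
rewrite big_enum /=.
apply: (@le_trans _ _ (\sum_(o : option 'I_k) delta)).
  apply: ler_sum => o _; rewrite normrZ gtr0_norm // ler_piMr ?(ltW delta0) //.
  exact: norm_ebase.
by rewrite sumr_const card_option card_ord mulr_natl.
Qed.

Let w o : V := delta *: ebase o.
Definition sdiff (os : seq (option 'I_k)) : V -> R :=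
  foldr (fun o G => diffv (w o) G) F os.
(** The derivative of the averaged function along the directions [os]: each derivative consumes one
    average and leaves a difference quotient of step [delta]. The case [[::]] is the averaged
    function itself. *)
Definition sder (os : seq (option 'I_k)) p : R :=
  delta^-1 ^+ size os *
    avgs (foldr (fun o l => rem (w o) l) sdirs os) (sdiff os) p.

Lemma ucont_sdiff os : ucont (sdiff os).
Proof. by elim: os => //= o os; exact: ucont_diffv. Qed.

Lemma ucont_sder os : ucont (sder os).
Proof.
have u := ucont_avgs (foldr (fun o l => rem (w o) l) sdirs os) (ucont_sdiff os).
have := ucont_lin (delta^-1 ^+ size os) u (ucont_cst _ 0).
by congr ucont; apply/funext => p; rewrite addr0.
Qed.

Lemma sdiff_abs_le os p : `|sdiff os p| <= 2 ^+ size os * c.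
Proof.
elim: os p => [|o os IH] p /=; first by rewrite expr0 mul1r.
rewrite exprS -mulrA mulr_natl mulr2n; apply: (le_trans (ler_normB _ _)).
exact: lerD.
Qed.

Lemma sder_abs_le os p : `|sder os p| <= (2 / delta) ^+ size os * c.
Proof.
have d0 : 0 <= delta^-1 ^+ size os by rewrite exprn_ge0 // invr_ge0 ltW.
rewrite /sder normrM (ger0_norm d0) exprMn (mulrC (2 ^+ _)) -mulrA ler_wpM2l //.
by apply: avgs_abs_le => [|q]; [exact: ucont_sdiff|exact: sdiff_abs_le].
Qed.

Lemma sdirs_mem o os : (size os < 3)%N ->
  w o \in foldr (fun o l => rem (w o) l) sdirs os.
Proof.
move=> os3; rewrite -has_pred1 has_count.
have c3 : (3 <= count_mem (w o) sdirs)%N.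
  have c1 : (1 <= count_mem (w o) [seq delta *: ebase o | o <- enum {: option 'I_k}])%N.
    by rewrite -has_count has_pred1; apply: map_f; rewrite mem_enum.
  by rewrite /sdirs !count_cat; lia.
have : (3 - size os <= count_mem (w o) (foldr (fun o l => rem (w o) l) sdirs os))%N.
  elim: os {os3} => [|o' os IH] /=; first by rewrite subn0.
  rewrite count_rem; case: (_ && _); move: (count_mem _ _) IH => n; rewrite ?subn1 ?subn0; lia.
by move: os3; lia.
Qed.

Lemma udird_sder o os : (size os < 3)%N -> udird (ebase o) (sder os) (sder (o :: os)).
Proof.
move=> os3.
have := udird_avgs (ucont_sdiff os) (sdirs_mem o os3).
set A := avgs _ _; set B := avgs _ _ => AB.
have uB : ucont B by apply: ucont_avgs; exact: (ucont_sdiff (o :: os)).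
have := udird_scale delta^-1 uB AB.
rewrite /w scalerA mulVf ?gt_eqF // scale1r => AB'.
have z0 : udird (ebase o) (fun _ => 0) (fun _ : V => 0 : R).
  by move=> eta eta0; exists 1 => // p h _; rewrite mulr0 !subr0 normr0 mulr_ge0 // ltW.
have := udird_lincomb (delta^-1 ^+ size os) AB' z0.
congr udird; apply/funext => p; rewrite addr0 //.
by rewrite /sder /= exprSr mulrA.
Qed.

Lemma C12_sder : C12 (fun t x => sder [::] (t, x)).
Proof.
have jc os : jcont (fun t x => sder os (t, x)).
  have E : (fun p : V => sder os (p.1, p.2)) = sder os by apply/funext => -[].
  by rewrite /jcont E; apply: ucont_continuous; exact: ucont_sder.
have [dt1 dt2] := udird_dt (udird_sder None (os := [::]) isT).
have dx1 i := udird_dx (udird_sder (Some i) (os := [::]) isT).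
have dx2 i j := udird_dx (udird_sder (Some i) (os := [:: Some j]) isT).
split.
- exact: dt1.
- by move=> i t x; apply: (dx1 i).1.
- by move=> i j t x; rewrite (dx1 j).2; exact: (dx2 i j).1.
- by split; [exact: jc|rewrite dt2; exact: jc].
- split=> [i|i j]; first by rewrite (dx1 i).2; exact: jc.
  by rewrite /dxx (dx1 j).2 (dx2 i j).2; exact: jc.
Qed.

Let D1 (z : 'rV[R]_k) os p : R := \sum_i z ord0 i * sder (Some i :: os) p.
Lemma udird_row z os : (size os < 3)%N -> udird (0, z) (sder os) (D1 z os).
Proof.
move=> os3; rewrite row_ebase; apply: udird_sum => i; first exact: ucont_sder.
exact: udird_sder.
Qed.

Lemma sum_coord_le (z : 'rV[R]_k) (X : 'I_k -> R) (B : R) :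
  (forall i, `|X i| <= B) -> `|\sum_i z ord0 i * X i| <= k%:R * `|z| * B.
Proof.
move=> XB; apply: (le_trans (ler_norm_sum _ _ _)).
apply: (@le_trans _ _ (\sum_(i < k) `|z| * B)).
  apply: ler_sum => i _; rewrite normrM; apply: ler_pM => //.
  exact: abs_coord_le.
by rewrite sumr_const card_ord -mulrA mulr_natl.
Qed.

Lemma sder_taylor_t (h : R) p :
  `|sder [::] (p + (h, 0)) - sder [::] p - h * sder [:: None] p| <= h ^+ 2 * ((2 / delta) ^+ 2 * c).
Proof.
have -> : (h, 0) = h *: ebase None :> V by congr pair; rewrite /= ?scaler0 // [RHS]mulr1.
have d1 := udird_scale h (ucont_sder [:: None]) (udird_sder None (os := [::]) isT).
have d2' := udird_scale h (ucont_sder [:: None; None]) (udird_sder None (os := [:: None]) isT).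
have z0 : udird (h *: ebase None) (fun _ => 0) (fun _ : V => 0 : R).
  by move=> eta eta0; exists 1 => // q a _; rewrite mulr0 !subr0 normr0 mulr_ge0 // ltW.
have d2 := udird_lincomb h d2' z0.
have -> : h * sder [:: None] p = h * sder [:: None] p + 0 by rewrite addr0.
apply: (taylor1 (F1 := fun p => h * sder [:: None] p + 0) (F2 := fun p => h * (h * sder [:: None; None] p) + 0)) => //.
  by move: d1; congr udird; apply/funext => q; rewrite addr0.
move=> q; rewrite addr0 mulrA normrM -expr2 normrX real_normK ?num_real //.
by rewrite ler_wpM2l ?sqr_ge0 //; exact: sder_abs_le.
Qed.

Lemma sder_taylor_row1 (z : 'rV[R]_k) p :
  `|sder [::] (p + (0, z)) - sder [::] p - \sum_i z ord0 i * sder [:: Some i] p| <=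
    (k%:R * `|z|) ^+ 2 * ((2 / delta) ^+ 2 * c).
Proof.
apply: (taylor1 (F1 := D1 z [::])
  (F2 := fun p => \sum_i z ord0 i * D1 z [:: Some i] p)) => //.
- exact: udird_row.
- by apply: udird_fsum => i; exact: udird_row.
move=> q; rewrite expr2 -mulrA; apply: sum_coord_le => i; apply: sum_coord_le => j.
exact: sder_abs_le.
Qed.

Lemma sder_taylor_row2 (z : 'rV[R]_k) p :
  `|sder [::] (p + (0, z)) + sder [::] (p - (0, z)) - 2 * sder [::] p -
    \sum_i z ord0 i * \sum_j z ord0 j * sder [:: Some j; Some i] p| <=
    2 * ((k%:R * `|z|) ^+ 3 * ((2 / delta) ^+ 3 * c)).
Proof.
apply: (taylor2 (F1 := D1 z [::])
  (F2 := fun p => \sum_i z ord0 i * D1 z [:: Some i] p)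
  (F3 := fun p => \sum_i z ord0 i * \sum_j z ord0 j * D1 z [:: Some j; Some i] p)) => //.
- exact: udird_row.
- by apply: udird_fsum => i; exact: udird_row.
- by apply: udird_fsum => i; apply: udird_fsum => j; exact: udird_row.
move=> q; rewrite (_ : _ ^+ 3 * _ = k%:R * `|z| * (k%:R * `|z| *
  (k%:R * `|z| * ((2 / delta) ^+ 3 * c)))); last by ring.
by do 3 apply: sum_coord_le => ?; exact: sder_abs_le.
Qed.

End Consistency.

(** * The random walk scheme and its consistency with the equation *)

Section Approximation.
Variables (R : realType) (k d : nat).
Local Notation V := (R * 'rV[R]_k)%type.
Variables (beta : V -> 'rV[R]_k) (sig : V -> 'M[R]_(k, d)).
Implicit Types (F G : V -> R) (p q : V) (x : 'rV[R]_k).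

Definition scol (j : 'I_d) p : 'rV[R]_k := \row_i sig p i j.

(* The branches of the random walk: a step in time, a step along the drift, and
   a symmetric step along each column of the diffusion matrix. *)
Definition branch := (bool + 'I_d * bool)%type.
Definition branch_weight (i : branch) : R := if i is inl _ then 1 else 2^-1.
(** Parabolic scaling: [r] is the square root of the step [h] of the scheme, so time and drift move
    by [r ^+ 2] and diffusion by [r] in either sign. *)
Definition branch_move (r : R) (i : branch) p : V :=
  match i with
  | inl true => (r ^+ 2, 0)
  | inl false => (0, r ^+ 2 *: beta p)
  | inr (j, s) => (0, (if s then r else - r) *: scol j p)
  end.

Lemma branch_weight_ge0 i : 0 <= branch_weight i.
Proof. by case: i => //= _; rewrite invr_ge0. Qed.

Lemma sum_branch (F : branch -> R) : \sum_i F i =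
  F (inl true) + F (inl false) + \sum_j (F (inr (j, true)) + F (inr (j, false))).
Proof.
rewrite big_sumType big_bool /=; congr (_ + _).
rewrite (eq_bigr (fun u : 'I_d * bool => F (inr (u.1, u.2)))); last by move=> -[].
by rewrite -(pair_bigA _ (fun j s => F (inr (j, s)))) /=; apply: eq_bigr => j _; rewrite big_bool.
Qed.

Lemma sum_branch_weight : \sum_i branch_weight i = 2 + d%:R.
Proof.
rewrite sum_branch /= (eq_bigr (fun _ => 1)); last by move=> j _; lra.
by rewrite sumr_const card_ord.
Qed.

Variable M : R.
Hypotheses (betaM : forall p, `|beta p| <= M) (sigM : forall j p, `|scol j p| <= M).

Section Consistency.
Variables (delta eps c N r : R) (G : V -> R) (n : nat).
Hypotheses (delta0 : 0 < delta) (eps0 : 0 < eps) (N0 : 0 < N) (r0 : 0 < r) (r1 : r <= 1).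
Hypothesis deltaeps : 3 * k.+1%:R * delta <= eps.
Hypothesis Gc : forall p, `|G p| <= N * c.
Hypothesis bu : forall i (eta : R), 0 < eta -> exists2 rho : R, 0 < rho &
  forall p q, `|p - q| < rho -> `|branch_move r i p - branch_move r i q| <= eta.
Hypothesis Gu : ucont G.

Let F := disc_sol branch_weight (branch_move r) G N (r ^+ 2) eps c n.
Let U := sder delta F.
Let B2 := (2 / delta) ^+ 2 * c.
Let B3 := (2 / delta) ^+ 3 * c.
(** The Taylor remainders of the time step, of the drift step and of the [d] symmetric diffusion
    steps. They involve powers of [1 / delta] through [B2] and [B3], but not [r]. *)
Definition consistency_cst : R :=
  B2 + (k%:R * M) ^+ 2 * B2 + d%:R * ((k%:R * M) ^+ 3 * B3).

Let rr0 : 0 < r ^+ 2. Proof. exact: exprn_gt0. Qed.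
Let Fu : ucont F. Proof. exact (disc_sol_ucont branch_weight_ge0 N0 rr0 eps0 Gc bu Gu n). Qed.
Let Fc p : `|F p| <= c. Proof. exact (disc_sol_abs_le (branch_move r) branch_weight_ge0 N0 rr0 eps0 Gc n p). Qed.

(** The averages of the shaken iterate satisfy the unshaken scheme with all coefficients taken at
    [p], and a Taylor expansion of each branch turns it into the equation. Diffusion leaves a
    remainder cubic in [r], the other branches a quartic one; division by the step [r ^+ 2] leaves
    an error of order [r]. *)
Lemma sder_disc_sol p :
  G p - consistency_cst * r <= N * U [::] p - U [:: None] p
    - \sum_i beta p ord0 i * U [:: Some i] p
    - 2^-1 * \sum_j \sum_i scol j p ord0 i *
       \sum_l scol j p ord0 l * U [:: Some l; Some i] p.
Proof.
pose D o := U [:: o] p.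
rewrite -/(D None) (_ : \sum_i beta p ord0 i * U [:: Some i] p = \sum_i beta p ord0 i * D (Some i)) //.
have UE q : U [::] q = avgs (sdirs k delta) F q by rewrite /U /sder expr0 mul1r.
have := avgs_disc_sol_super branch_weight_ge0 N0 rr0 eps0 Gc bu Gu n p
  (le_trans (sum_norm_sdirs k delta0) deltaeps).
rewrite -/F -!UE.
have -> : \sum_i branch_weight i * avgs (sdirs k delta) F (p + branch_move r i p) =
  \sum_i branch_weight i * U [::] (p + branch_move r i p).
  by apply: eq_bigr => i _; rewrite UE.
rewrite sum_branch_weight sum_branch /= !mul1r.
have k0 : 0 <= k%:R :> R by [].
have c0 : 0 <= c by apply: le_trans (Fc 0).
have B20 : 0 <= B2 by rewrite mulr_ge0 // sqr_ge0.
have B30 : 0 <= B3 by rewrite mulr_ge0 // exprn_ge0 // divr_ge0 // ltW.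
have M0 : 0 <= M by apply: le_trans (betaM 0).
have t1 := sder_taylor_t delta0 Fu Fc (r ^+ 2) p.
have t2 := sder_taylor_row1 delta0 Fu Fc (r ^+ 2 *: beta p) p.
rewrite -/U -/B2 -/(D None) in t1 t2.
have t2' : `|U [::] (p + (0, r ^+ 2 *: beta p)) - U [::] p -
    r ^+ 2 * \sum_i beta p ord0 i * D (Some i)| <= r ^+ 2 * (r ^+ 2 * ((k%:R * M) ^+ 2 * B2)).
  have -> : r ^+ 2 * \sum_i beta p ord0 i * D (Some i) =
      \sum_i (r ^+ 2 *: beta p) ord0 i * U [:: Some i] p.
    by rewrite mulr_sumr; apply: eq_bigr => i _; rewrite mxE mulrA.
  apply: (le_trans t2).
  have -> : r ^+ 2 * (r ^+ 2 * ((k%:R * M) ^+ 2 * B2)) = (k%:R * (r ^+ 2 * M)) ^+ 2 * B2 by ring.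
  have le0 : k%:R * `|r ^+ 2 *: beta p| <= k%:R * (r ^+ 2 * M).
    by apply: ler_wpM2l => //; rewrite normrZ gtr0_norm // ler_pM2l.
  by apply: ler_wpM2r => //; apply: lerXn2r; rewrite ?nnegrE // (le_trans _ le0) // mulr_ge0.
have t3 j : U [::] (p + (0, r *: scol j p)) + U [::] (p + (0, - r *: scol j p)) - 2 * U [::] p
   >= r ^+ 2 * (\sum_i scol j p ord0 i * \sum_l scol j p ord0 l * U [:: Some l; Some i] p)
      - 2 * (r ^+ 2 * (r * ((k%:R * M) ^+ 3 * B3))).
  have := sder_taylor_row2 delta0 Fu Fc (r *: scol j p) p.
  have -> : p - (0, r *: scol j p) = p + (0, - r *: scol j p).
    by congr (_ + _); congr pair; rewrite /= ?oppr0 // scaleNr.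
  rewrite -/U -/B3.
  have -> : \sum_i (r *: scol j p) ord0 i * \sum_l (r *: scol j p) ord0 l * U [:: Some l; Some i] p =
     r ^+ 2 * (\sum_i scol j p ord0 i * \sum_l scol j p ord0 l * U [:: Some l; Some i] p).
    rewrite mulr_sumr; apply: eq_bigr => i _; rewrite !mulr_sumr; apply: eq_bigr => l _.
    by rewrite !mxE; ring.
  have : 2 * ((k%:R * `|r *: scol j p|) ^+ 3 * B3) <= 2 * (r ^+ 2 * (r * ((k%:R * M) ^+ 3 * B3))).
    have -> : r ^+ 2 * (r * ((k%:R * M) ^+ 3 * B3)) = (k%:R * (r * M)) ^+ 3 * B3 by ring.
    have le0 : k%:R * `|r *: scol j p| <= k%:R * (r * M).
      by apply: ler_wpM2l => //; rewrite normrZ gtr0_norm // ler_pM2l.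
    rewrite ler_pM2l //; apply: ler_wpM2r => //; apply: lerXn2r => //.
      by rewrite nnegrE mulr_ge0.
    by rewrite nnegrE (le_trans _ le0) // mulr_ge0.
  set X := _ - _ * _ - r ^+ 2 * _; rewrite ler_norml => h1 /andP[h2 _]; move: h1 h2; rewrite /X.
  lra.
set S := \sum_j \sum_i _.
have t4 : \sum_j (2^-1 * U [::] (p + (0, r *: scol j p)) + 2^-1 * U [::] (p + (0, - r *: scol j p)))
   >= d%:R * U [::] p + r ^+ 2 * (2^-1 * S) - r ^+ 2 * (r * (d%:R * ((k%:R * M) ^+ 3 * B3))).
  have -> : d%:R * U [::] p + r ^+ 2 * (2^-1 * S) - r ^+ 2 * (r * (d%:R * ((k%:R * M) ^+ 3 * B3))) =
    \sum_(j < d) (U [::] p + r ^+ 2 * (2^-1 * (\sum_i scol j p ord0 i *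
       \sum_l scol j p ord0 l * U [:: Some l; Some i] p)) - r ^+ 2 * (r * ((k%:R * M) ^+ 3 * B3))).
    rewrite !big_split /= !sumr_const card_ord /S !mulr_sumr.
    set a := U _ _; set b := r ^+ 2 * (r * ((k%:R * M) ^+ 3 * B3)).
    rewrite -[a *+ d]mulr_natl -[(- b) *+ d]mulr_natl /b; ring.
  by apply: ler_sum => j _; have := t3 j; lra.
move: t1 t2' t4; rewrite !ler_norml => /andP[t1 _] /andP[t2' _] t4 t5.
have r2 : r ^+ 2 <= r by rewrite expr2 ler_piMr // ltW.
have key : r ^+ 2 * (G p - consistency_cst * r) <= r ^+ 2 * (N * U [::] p - D None
    - \sum_i beta p ord0 i * D (Some i) - 2^-1 * S).
  have e1 : r ^+ 2 * (r ^+ 2 * B2) <= r ^+ 2 * (r * B2).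
    by rewrite ler_pM2l // ler_wpM2r.
  have e2 : r ^+ 2 * (r ^+ 2 * ((k%:R * M) ^+ 2 * B2)) <= r ^+ 2 * (r * ((k%:R * M) ^+ 2 * B2)).
    by rewrite ler_pM2l // ler_wpM2r // mulr_ge0 // sqr_ge0.
  rewrite /consistency_cst; move: t1 t2' t4 t5 e1 e2.
  rewrite -/(r ^+ 2) (_ : (r ^+ 2) ^+ 2 * B2 = r ^+ 2 * (r ^+ 2 * B2)); last by ring.
  lra.
by rewrite ler_pM2l in key.
Qed.

Lemma smooth_disc_sol :
  C12 (fun t x => U [::] (t, x)) /\
  forall t x, G (t, x) - consistency_cst * r <= N * U [::] (t, x)
    - dt (fun t x => U [::] (t, x)) t x
    - genA (fun t x => beta (t, x)) (fun t x => sig (t, x)) (fun t x => U [::] (t, x)) t x.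
Proof.
split=> [|t x]; first exact: (C12_sder delta0 Fu).
have [_ ->] := udird_dt (udird_sder delta0 Fu None (os := [::]) isT).
apply: le_trans (sder_disc_sol (t, x)) _.
have dxE i := (udird_dx (udird_sder delta0 Fu (Some i) (os := [::]) isT)).2.
have dxxE i j := (udird_dx (udird_sder delta0 Fu (Some i) (os := [:: Some j]) isT)).2.
rewrite /genA.
have -> : \sum_i beta (t, x) ord0 i * dx i (fun t x => U [::] (t, x)) t x =
   \sum_i beta (t, x) ord0 i * U [:: Some i] (t, x).
  by apply: eq_bigr => i _; rewrite dxE.
(* The second order part of the generator is a sum, over the columns of [sig], of second derivatives
   along these columns. *)
have -> : \sum_i \sum_j (sig (t, x) *m (sig (t, x))^T) i j *
     dxx i j (fun t x => U [::] (t, x)) t x =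
   \sum_j \sum_i scol j (t, x) ord0 i *
       \sum_l scol j (t, x) ord0 l * U [:: Some l; Some i] (t, x).
  rewrite [RHS]exchange_big [LHS]exchange_big /=; apply: eq_bigr => i _.
  transitivity (\sum_l \sum_j scol j (t, x) ord0 i * (scol j (t, x) ord0 l * U [:: Some l; Some i] (t, x))).
    apply: eq_bigr => l _; rewrite /dxx dxE dxxE mxE mulr_suml; apply: eq_bigr => j _.
    by rewrite !mxE -/U; ring.
  by rewrite exchange_big /=; apply: eq_bigr => j _; rewrite mulr_sumr.
rewrite -/U; lra.
Qed.
End Consistency.
End Approximation.

(** * Smooth approximate solutions of the linear equation *)

Section SquareNorm.
Variables (R : realType) (k : nat).
Implicit Types (x y z : 'rV[R]_k) (a : R).

(** Rows carry the maximum norm; couplings, barriers and test functions need a quadratic polynomial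
    instead. *)
Definition sqnorm x : R := \sum_i x ord0 i ^+ 2.
Definition dotv x y : R := \sum_i x ord0 i * y ord0 i.

Lemma sqnorm_ge0 x : 0 <= sqnorm x.
Proof. by apply: sumr_ge0 => i _; exact: sqr_ge0. Qed.

Lemma sqnormD x y a : sqnorm (x + a *: y) = sqnorm x + 2 * a * dotv x y + a ^+ 2 * sqnorm y.
Proof.
rewrite /sqnorm /dotv !mulr_sumr -!big_split /=; apply: eq_bigr => i _.
by rewrite !mxE; ring.
Qed.

Lemma dotv_le x y : 2 * dotv x y <= sqnorm x + sqnorm y.
Proof.
have := sqnorm_ge0 (x + (-1) *: y); rewrite sqnormD; lra.
Qed.

Lemma sqnorm_le x : sqnorm x <= k%:R * `|x| ^+ 2.
Proof.
apply: (@le_trans _ _ (\sum_(i < k) `|x| ^+ 2)).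
  apply: ler_sum => i _; rewrite -(real_normK (num_real (x ord0 i))).
  by apply: lerXn2r; rewrite ?nnegrE //; exact: abs_coord_le.
by rewrite sumr_const card_ord mulr_natl.
Qed.

Lemma coord_sqr_le x i : x ord0 i ^+ 2 <= sqnorm x.
Proof.
by rewrite /sqnorm (bigD1 i) //= lerDl; apply: sumr_ge0 => j _; exact: sqr_ge0.
Qed.

Lemma norm_sqr_le x : `|x| ^+ 2 <= sqnorm x.
Proof.
have [x0|x0] := leP `|x| 0.
  have /eqP -> : x == 0 by rewrite -normr_le0.
  by rewrite normr0 expr0n sqnorm_ge0.
have [[a i] /= xi] : exists i : 'I_1 * 'I_k, `|x| = `|x i.1 i.2|.
  by apply: mx_norm_neq0; rewrite gt_eqF.
by rewrite xi real_normK ?num_real // (ord1 a) coord_sqr_le.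
Qed.

Lemma sqnormD3 x y z : sqnorm (x + y + z) <= 3 * (sqnorm x + sqnorm y + sqnorm z).
Proof.
rewrite /sqnorm -!big_split mulr_sumr /=; apply: ler_sum => i _; rewrite !mxE.
set a := x _ _; set b := y _ _; set c := z _ _.
have := sqr_ge0 (a - b); have := sqr_ge0 (b - c); have := sqr_ge0 (a - c).
nra.
Qed.

Lemma enormE x : enorm x = Num.sqrt (sqnorm x). Proof. by []. Qed.
End SquareNorm.

(** * Oscillation of shaken data *)

Section Shaking.
Variables (R : realType) (k : nat).
Local Notation V := (R * 'rV[R]_k)%type.
Implicit Types (p q : V) (x : 'rV[R]_k) (t : R).

(** [G] has no Lipschitz bound. At short distance its oscillation is below [eta] by uniform
    continuity; at long distance it is at most [2 * g], which a large multiple of the squared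
    distance dominates. *)
Lemma shaken_osc (G : V -> R) (g : R) : ucont G -> (forall p, `|G p| <= g) ->
  forall eta : R, 0 < eta -> exists K : R, 0 <= K /\ exists2 eps : R, 0 < eps &
    forall t x x' q q', `|q - (t, x)| <= eps -> `|q' - (t, x')| <= eps ->
      G q - G q' <= eta + K * sqnorm (x - x').
Proof.
move=> uG Gg eta eta0.
have [|rho rho0 H] := uG eta; first by lra.
have g0 : 0 <= g by apply: le_trans (Gg 0).
have K0 : 0 <= 2 * g / (rho / 2) ^+ 2.
  by rewrite divr_ge0 ?exprn_ge0 //; lra.
exists (2 * g / (rho / 2) ^+ 2); split => //.
(* Two shaking radii and half of [rho] add up to less than [rho]. *)
exists (rho / 5); first by lra.
move=> t x x' q q' qx qx'.
have [xx|xx] := ltP `|x - x'| (rho / 2).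
  have : `|G q - G q'| <= eta.
    apply: H.
    have -> : q - q' = (q - (t, x)) + ((0, x - x') - (q' - (t, x'))).
      have -> : (0, x - x') = (t, x) - (t, x') :> V by congr pair; rewrite /= subrr.
      by rewrite opprB addrA !subrKA.
    have n0 : `|(0, x - x') : V| <= rho / 2.
      by rewrite prod_normE /= normr0 ge_max (ltW xx); lra.
    apply: (le_lt_trans (ler_normD _ _)); have := ler_normB ((0, x - x') : V) (q' - (t, x')).
    lra.
  move/(le_trans (ler_norm _)); have := mulr_ge0 K0 (sqnorm_ge0 (x - x')); lra.
have h1 : G q - G q' <= 2 * g.
  have := Gg q; have := Gg q'; rewrite !ler_norml; lra.
have h2 : 2 * g <= 2 * g / (rho / 2) ^+ 2 * sqnorm (x - x').
  have r2 : 0 < rho / 2 by lra.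
  rewrite mulrAC ler_pdivlMr ?exprn_gt0 //.
  apply: ler_wpM2l; first by lra.
  by apply: le_trans (norm_sqr_le _); apply: lerXn2r; rewrite ?nnegrE //; lra.
by lra.
Qed.

(** The difference is split at the two centres, whence the factor 3; the two outer pieces are made
    small by uniform continuity and go into [gam]. *)
Lemma shaken_sqnorm (n : nat) (b : 'I_n -> V -> 'rV[R]_k) :
  (forall i (eta : R), 0 < eta -> exists2 rho : R, 0 < rho &
     forall p q, `|p - q| < rho -> `|b i p - b i q| <= eta) ->
  forall gam : R, 0 < gam -> exists2 eps : R, 0 < eps &
    forall t x x' q q', `|q - (t, x)| <= eps -> `|q' - (t, x')| <= eps ->
      \sum_i sqnorm (b i q - b i q') <= 3 * \sum_i sqnorm (b i (t, x) - b i (t, x')) + gam.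
Proof.
move=> bu gam gam0.
have k0 : 0 <= k%:R :> R by [].
have n0 : 0 <= n%:R :> R by [].
pose den : R := 6 * (k%:R + 1) * (n%:R + 1).
have den0 : 0 < den by rewrite /den; nra.
pose eta := Num.min 1 (gam / den).
have eta0 : 0 < eta by rewrite lt_min ltr01 divr_gt0.
have [rho rho0 H] : exists2 rho : R, 0 < rho & forall i,
    forall p q, `|p - q| < rho -> `|b i p - b i q| <= eta.
  apply: ex_pos_fin => [i|i r r' rr' h p q pq]; first exact: bu.
  by apply: h; exact: lt_le_trans pq rr'.
exists (rho / 2); first by lra.
move=> t x x' q q' qx qx'.
have key i : sqnorm (b i q - b i q') <= 3 * sqnorm (b i (t, x) - b i (t, x')) + gam / (n%:R + 1).
  have -> : b i q - b i q' = (b i q - b i (t, x)) + (b i (t, x) - b i (t, x')) + (b i (t, x') - b i q').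
    by rewrite !subrKA.
  apply: (le_trans (sqnormD3 _ _ _)).
  have s1 : sqnorm (b i q - b i (t, x)) <= k%:R * eta ^+ 2.
    apply: le_trans (sqnorm_le _) _; apply: ler_wpM2l => //; apply: lerXn2r; rewrite ?nnegrE ?(ltW eta0) //.
    by apply: H; lra.
  have s2 : sqnorm (b i (t, x') - b i q') <= k%:R * eta ^+ 2.
    apply: le_trans (sqnorm_le _) _; apply: ler_wpM2l => //; apply: lerXn2r; rewrite ?nnegrE ?(ltW eta0) //.
    by apply: H; rewrite distrC; lra.
  have s3 : 6 * (k%:R * eta ^+ 2) <= gam / (n%:R + 1).
    have e1 : eta ^+ 2 <= eta by rewrite expr2 ler_piMr ?(ltW eta0) // ge_min lexx.
    have : 6 * (k%:R * eta ^+ 2) <= 6 * (k%:R + 1) * eta by have := sqr_ge0 eta; nra.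
    move/le_trans; apply; rewrite ler_pdivlMr; last by lra.
    rewrite mulrAC -/den -ler_pdivlMl // mulrC ge_min lexx orbT //.
  lra.
apply: (@le_trans _ _ (\sum_i (3 * sqnorm (b i (t, x) - b i (t, x')) + gam / (n%:R + 1)))).
  by apply: ler_sum => i _; exact: key.
rewrite big_split /= -mulr_sumr lerD2l sumr_const card_ord -[leLHS]mulr_natr mulrAC.
by rewrite ler_pdivrMr ?ler_pM2l //; lra.
Qed.
End Shaking.

(** * Coupling, barriers and smooth approximate solutions *)

Section Approximation.
Variables (R : realType) (k d : nat).
Local Notation V := (R * 'rV[R]_k)%type.
Variables (beta : V -> 'rV[R]_k) (sig : V -> 'M[R]_(k, d)) (M L : R).
Implicit Types (F G : V -> R) (p q : V) (x : 'rV[R]_k) (t : R).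
Hypotheses (betaM : forall p, `|beta p| <= M) (sigM : forall j p, `|scol sig j p| <= M).
Hypothesis betau : forall eta : R, 0 < eta -> exists2 rho : R, 0 < rho &
  forall p q, `|p - q| < rho -> `|beta p - beta q| <= eta.
Hypothesis sigu : forall j (eta : R), 0 < eta -> exists2 rho : R, 0 < rho &
  forall p q, `|p - q| < rho -> `|scol sig j p - scol sig j q| <= eta.
Hypothesis L0 : 0 <= L.
Hypothesis lip : forall t x x', sqnorm (beta (t, x) - beta (t, x')) +
  \sum_j sqnorm (scol sig j (t, x) - scol sig j (t, x')) <= L * sqnorm (x - x').

Local Notation sol := (disc_sol (@branch_weight R d)).
Local Notation mv := (branch_move beta sig).

Lemma branch_move_ucont (r : R) : 0 < r -> r <= 1 -> forall i (eta : R), 0 < eta ->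
  exists2 rho : R, 0 < rho & forall p q, `|p - q| < rho -> `|mv r i p - mv r i q| <= eta.
Proof.
move=> r0 r1.
have scal (a : R) (z z' : 'rV[R]_k) (eta : R) : 0 < eta -> `|a| <= 1 -> `|z - z'| <= eta ->
    `|(0, a *: z) - (0, a *: z') : V| <= eta.
  move=> e0 a1 zz; rewrite prod_normE /= subrr normr0 ge_max (ltW e0) /=.
  rewrite -scalerBr normrZ; have := normr_ge0 (z - z'); nra.
case=> [[]|[j s]] eta eta0 /=.
- by exists 1 => // p q _; rewrite subrr normr0 ltW.
- have [rho rho0 H] := betau eta0; exists rho => // p q /H; apply: scal => //.
  by rewrite ger0_norm ?exprn_ge0 // ?(ltW r0) // exprn_ile1 // ltW.
- have [rho rho0 H] := sigu j eta0; exists rho => // p q /H; apply: scal => //.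
  by case: s; rewrite ?normrN gtr0_norm.
Qed.

(** The linear terms of opposite diffusion steps cancel, so column [j] contributes exactly
    [r ^+ 2 * (K * sqnorm (s j))]; the cross term of the drift step is split by
    [2 z.b <= |z|^2 + |b|^2]. It serves both for the difference of two coupled walks and for the
    barrier. *)
Lemma sum_branch_quadratic (r A K : R) (z : 'rV[R]_k) (b : 'rV[R]_k) (s : 'I_d -> 'rV[R]_k) :
  0 < r -> r <= 1 -> 0 <= K ->
  (A + K * sqnorm z) + (A + K * sqnorm (z + r ^+ 2 *: b)) +
   \sum_j (2^-1 * (A + K * sqnorm (z + r *: s j)) + 2^-1 * (A + K * sqnorm (z + (- r) *: s j)))
  <= (2 + d%:R) * (A + K * sqnorm z) +
     r ^+ 2 * (K * (sqnorm z + 2 * sqnorm b + \sum_j sqnorm (s j))).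
Proof.
move=> r0 r1 K0.
have -> : \sum_j (2^-1 * (A + K * sqnorm (z + r *: s j)) + 2^-1 * (A + K * sqnorm (z + (- r) *: s j))) =
   d%:R * (A + K * sqnorm z) + r ^+ 2 * (K * \sum_j sqnorm (s j)).
  set X := A + K * sqnorm z.
  have -> : d%:R * X = \sum_(j < d) X by rewrite sumr_const card_ord mulr_natl.
  have -> : r ^+ 2 * (K * \sum_j sqnorm (s j)) = \sum_j r ^+ 2 * (K * sqnorm (s j)).
    by rewrite mulr_sumr mulr_sumr.
  rewrite -big_split /=.
  by apply: eq_bigr => j _; rewrite /X !sqnormD; field.
have rr0 : 0 <= r ^+ 2 by exact: sqr_ge0.
have rr1 : r ^+ 2 <= 1 by rewrite exprn_ile1 // ltW.
have b0 := sqnorm_ge0 b.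
have : K * sqnorm (z + r ^+ 2 *: b) <= K * (sqnorm z + r ^+ 2 * (sqnorm z + 2 * sqnorm b)).
  apply: ler_wpM2l => //; rewrite sqnormD.
  have e1 : r ^+ 2 * (2 * dotv z b) <= r ^+ 2 * (sqnorm z + sqnorm b).
    by apply: ler_wpM2l => //; exact: dotv_le.
  have e2 : (r ^+ 2) ^+ 2 * sqnorm b <= r ^+ 2 * sqnorm b.
    by apply: ler_wpM2r => //; rewrite expr2 ler_piMr.
  lra.
lra.
Qed.

(** The coupling barrier is [eta / 2] plus [K] times the squared distance. In [2 + 6 * L], the
    factor 6 is 3 from the shaking times 2 from the drift; the 2 covers the cross term of the drift
    and the quadratic part of the oscillation of [G]. On the diagonal only [eta / 2] and the
    geometric tail remain. *)
Lemma coupling_small (N c : R) G : 2 + 6 * L <= N -> ucont G -> (forall p, `|G p| <= N * c) ->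
  forall eta : R, 0 < eta -> exists2 eps0 : R, 0 < eps0 & forall eps r : R,
    0 < eps -> eps <= eps0 -> 0 < r -> r <= 1 -> exists n, forall p,
      sol (mv r) G N (r ^+ 2) eps c n p + sol (mv r) (fun z => - G z) N (r ^+ 2) eps c n p <= eta.
Proof.
move=> NL uG Gc eta eta0; have l0 := L0.
have N0 : 0 < N by lra.
have c0 : 0 <= c by have := le_trans (normr_ge0 _) (Gc 0); rewrite pmulr_rge0.
have e4 : 0 < N * eta / 4 by rewrite divr_gt0 // mulr_gt0.
have [K [K0 [eps1 eps10 H1]]] := shaken_osc uG Gc e4.
have K1 : 0 < K + 1 by lra.
have gam0 : 0 < N * eta / (8 * (K + 1)) by rewrite divr_gt0 // mulr_gt0.
(* Drift and diffusion columns as one family, so that a single radius serves all of them. *)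
pose b := fun (i : 'I_d.+1) p => if unlift ord0 i is Some j then scol sig j p else beta p.
have bE (P : 'rV[R]_k -> R) p p' : \sum_i P (b i p - b i p') =
    P (beta p - beta p') + \sum_j P (scol sig j p - scol sig j p').
  rewrite big_ord_recl /b unlift_none; congr (_ + _); apply: eq_bigr => j _.
  by rewrite liftK.
have [|eps2 eps20 H2] := shaken_sqnorm (b := b) _ gam0.
  by move=> i; rewrite /b; case: unlift => [j|]; [exact: sigu|exact: betau].
exists (Num.min eps1 eps2); first by rewrite lt_min eps10.
move=> eps r eps0; rewrite le_min => /andP[le1 le2] r0 r1.
have rr0 : 0 < r ^+ 2 by exact: exprn_gt0.
pose A := eta / 2.
pose Phi p p' := A + K * sqnorm (p.2 - p'.2).
have dR : 0 <= d%:R :> R by [].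
have W0 : 0 < 2 + d%:R :> R by lra.
have fac1 : `|(2 + d%:R) / (N * r ^+ 2 + (2 + d%:R))| < 1.
  have Nr := mulr_gt0 N0 rr0.
  rewrite ger0_norm; last by rewrite divr_ge0 //; lra.
  by rewrite ltr_pdivrMr; lra.
have [n Hn] : exists n, 2 * c * ((2 + d%:R) / (N * r ^+ 2 + (2 + d%:R))) ^+ n <= eta / 2.
  have c1 : 0 < 4 * (c + 1) by lra.
  have /cvgrPdist_lt/(_ (eta / (4 * (c + 1))) (divr_gt0 eta0 c1))[n _ Hn] := cvg_expr fac1.
  exists n; have := Hn n (leqnn n); rewrite /= sub0r normrN.
  move/ltW/(le_trans (ler_norm _)); rewrite ler_pdivlMr //.
  have : 0 <= ((2 + d%:R) / (N * r ^+ 2 + (2 + d%:R))) ^+ n.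
    by rewrite exprn_ge0 // divr_ge0 //; have := mulr_gt0 N0 rr0; lra.
  nra.
exists n => p.
have := @disc_sol_coupling R V (branch d) (@branch_weight R d) (mv r) G N (r ^+ 2) eps c
  (fun p p' => p.1 = p'.1) Phi (@branch_weight_ge0 R d) N0 rr0 eps0 Gc.
rewrite sum_branch_weight => /(_ _ _ _ n p p erefl) /=.
rewrite /Phi subrr (_ : sqnorm 0 = 0); last first.
  by apply: big1 => i _; rewrite mxE expr0n.
rewrite mulr0 addr0 => H; apply: (le_trans (H _ _ _)).
- move=> {H} p1 p2 i q q' e12.
  by case: i => [[]|[j s]] /=; rewrite e12.
- by move=> p1 p2; rewrite addr_ge0 ?mulr_ge0 ?sqnorm_ge0 // /A; lra.
- move=> {H} [t x] [t' x'] q q' /= <- {t'} qx qx'.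
  rewrite sum_branch /= !addr0 !mul1r.
  have AC (u u' w w' : 'rV[R]_k) : (u + w) - (u' + w') = (u - u') + (w - w') by rewrite opprD addrACA.
  rewrite !AC -scalerBr; set z := x - x'.
  have -> : \sum_j (2^-1 * (A + K * sqnorm (x + r *: scol sig j q - (x' + r *: scol sig j q'))) +
       2^-1 * (A + K * sqnorm (x + - r *: scol sig j q - (x' + - r *: scol sig j q')))) =
     \sum_j (2^-1 * (A + K * sqnorm (z + r *: (scol sig j q - scol sig j q'))) +
       2^-1 * (A + K * sqnorm (z + - r *: (scol sig j q - scol sig j q')))).
    by apply: eq_bigr => j _; rewrite !AC -!scalerBr.
  have S := sum_branch_quadratic A z (beta q - beta q')
     (fun j => scol sig j q - scol sig j q') r0 r1 K0.
  have := H2 t x x' q q' (le_trans qx le2) (le_trans qx' le2).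
  rewrite !(bE (@sqnorm R k)).
  have := H1 t x x' q q' (le_trans qx le1) (le_trans qx' le1).
  have := lip t x x'; rewrite -/z; move: S.
  set gam := N * eta / (8 * (K + 1)).
  set sb := sqnorm (beta q - _); set ss := \sum_j sqnorm (scol sig j q - _).
  set sb' := sqnorm (beta (t, x) - _); set ss' := \sum_j sqnorm (scol sig j (t, x) - _).
  set Q := sqnorm z; set dG := G q - G q'.
  have Q0 : 0 <= Q by exact: sqnorm_ge0.
  have ss0 : 0 <= ss by apply: sumr_ge0 => j _; exact: sqnorm_ge0.
  move=> S l1 l2 l3.
  have g1 : K * gam <= N * eta / 8.
    rewrite /gam mulrA ler_pdivrMr; last by lra.
    have := mulr_gt0 N0 eta0; nra.
  have g2 : K * (Q + 2 * sb + ss) <= K * (Q + 6 * L * Q + 2 * gam).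
    by apply: ler_wpM2l => //; lra.
  have g3 : K * (Q + 6 * L * Q) + K * Q <= N * (K * Q).
    by have := ler_wpM2r (mulr_ge0 K0 Q0) NL; lra.
  have g4 : r ^+ 2 * (K * (Q + 2 * sb + ss) + dG) <= r ^+ 2 * (N * (A + K * Q)).
    by rewrite ler_pM2l // /A; lra.
  lra.
rewrite /A; lra.
Qed.

(** A downward paraboloid centred at [p], just below [f p], is a subsolution of the scheme once [N]
    times its distance to [f] outweighs the action of the walk on it. The bound is wanted at all
    [p'] near [p] because averaging displaces the point; the radius [eps1] depends neither on [r]
    nor on [n]. *)
Lemma barrier (f q0 : V -> R) (cf cq : R) : ucont f -> (forall p, `|f p| <= cf) ->
  (forall p, `|q0 p| <= cq) ->
  forall eta : R, 0 < eta -> exists2 N0 : R, 0 < N0 & forall N : R, N0 <= N ->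
  exists2 eps1 : R, 0 < eps1 &
  forall G (c eps r : R) n p p', (forall p, G p = N * f p + q0 p) ->
    (forall p, `|G p| <= N * c) -> cf <= c -> 0 < eps -> 0 < r -> r <= 1 ->
    `|p' - p| <= eps1 -> f p - eta <= sol (mv r) G N (r ^+ 2) eps c n p'.
Proof.
move=> uf fcf qcq eta eta0.
have [|rho rho0 H] := uf (eta / 4); first by lra.
have cf0 : 0 <= cf by apply: le_trans (fcf 0).
have cq0 : 0 <= cq by apply: le_trans (qcq 0).
have M0 : 0 <= M by apply: le_trans (betaM 0).
have k0 : 0 <= k%:R :> R by [].
have d0 : 0 <= d%:R :> R by [].
pose K := 2 * cf / rho ^+ 2.
have K0 : 0 <= K by rewrite /K divr_ge0 ?exprn_ge0 ?(ltW rho0) //; lra.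
pose D (z p : V) : R := (z.1 - p.1) ^+ 2 + sqnorm (z.2 - p.2).
have D0 z p : 0 <= D z p by rewrite addr_ge0 ?sqr_ge0 ?sqnorm_ge0.
have normD z p : `|z - p| ^+ 2 <= D z p.
  have h1 : `|(z - p).2| ^+ 2 <= D z p.
    by apply: le_trans (norm_sqr_le _) _; rewrite /D /= lerDr sqr_ge0.
  have h2 : `|(z - p).1| ^+ 2 <= D z p.
    by rewrite real_normK ?num_real // /D /= lerDl sqnorm_ge0.
  by rewrite prod_normE; case: (leP `|(z - p).1| `|(z - p).2|).
have osc z p : f p - eta / 4 - K * D z p <= f z.
  have [zp|zp] := ltP `|z - p| rho.
    by have := H z p zp; have := mulr_ge0 K0 (D0 z p); rewrite ler_norml; lra.
  have h1 : rho ^+ 2 <= D z p.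
    by apply: le_trans (normD z p); apply: lerXn2r; rewrite ?nnegrE ?(ltW rho0).
  have h2 : 2 * cf <= K * D z p.
    rewrite /K mulrAC ler_pdivlMr ?exprn_gt0 //; apply: ler_wpM2l => //; lra.
  have := fcf z; have := fcf p; rewrite !ler_norml; lra.
(* Bounds the constant part of the action of the walk on the paraboloid: 2 for the time step, the
   rest for drift and diffusion. *)
pose C : R := 2 + (2 + d%:R) * (k%:R * M ^+ 2).
have C0 : 0 <= C.
  by rewrite /C addr_ge0 // ?mulr_ge0 ?sqr_ge0 //; lra.
have KC0 : 0 <= K * C by rewrite mulr_ge0.
pose N0 := 4 + 4 * (cq + 2 * (K * C)) / eta.
have N00 : 4 <= N0 by rewrite lerDl divr_ge0 ?(ltW eta0) //; lra.
exists N0; first by lra.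
move=> N NN0.
have N4 : 4 <= N by lra.
have Neta : cq + 2 * (K * C) <= N * eta / 4.
  have : 4 * (cq + 2 * (K * C)) <= (N - 4) * eta by rewrite -ler_pdivrMr // lerBrDl.
  lra.
pose eps1 := Num.min 1 (eta / (4 * (K + 1) * (k%:R + 1))).
have den0 : 0 < 4 * (K + 1) * (k%:R + 1) by rewrite !mulr_gt0 //; lra.
have eps10 : 0 < eps1 by rewrite lt_min ltr01 divr_gt0.
exists eps1 => //.
move=> G c eps r n p p' GE Gc cfc eps0 r0 r1 pp'.
have Npos : 0 < N by lra.
have rr0 : 0 < r ^+ 2 by exact: exprn_gt0.
have rr1 : r ^+ 2 <= 1 by rewrite exprn_ile1 // ltW.
(* With twice the [K] of the minorant, [f z - B z] is at least [eta / 4 + K * D z p]. Multiplied by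
   [N], the constant absorbs [cq] and [C], and the quadratic part absorbs the growth of the action
   at infinity. *)
pose B z := f p - eta / 2 - 2 * K * D z p.
have : B p' <= sol (mv r) G N (r ^+ 2) eps c n p'.
  apply: (disc_sol_ge_barrier (@branch_weight_ge0 R d) Npos rr0 eps0 Gc).
    move=> z; have := mulr_ge0 K0 (D0 z p); have := fcf p; rewrite /B ler_norml; lra.
  move=> z; rewrite /disc_step ler_pdivlMl; last first.
    by rewrite sum_branch_weight; have := mulr_gt0 Npos rr0; lra.
  rewrite sum_branch_weight sum_branch /= !mul1r.
  have K20 : 0 <= 2 * K by lra.
  pose tau := z.1 - p.1; pose xi := z.2 - p.2.
  have S := sum_branch_quadratic (2 * K * tau ^+ 2 - (f p - eta / 2)) xi (beta z)
     (fun j => scol sig j z) r0 r1 K20.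
  have BE : B z = - (2 * K * tau ^+ 2 - (f p - eta / 2) + 2 * K * sqnorm xi).
    by rewrite /B /D -/tau -/xi; ring.
  have B1 : B (z + (r ^+ 2, 0)) = B z - 2 * K * (2 * tau * r ^+ 2 + (r ^+ 2) ^+ 2).
    by rewrite /B /D /= addr0 -/xi /tau; ring.
  have Bx (a : R) (y : 'rV[R]_k) :
      B (z + (0, a *: y)) = - (2 * K * tau ^+ 2 - (f p - eta / 2) + 2 * K * sqnorm (xi + a *: y)).
    by rewrite /B /D /= addr0 -/tau (_ : z.2 + a *: y - p.2 = xi + a *: y) 1?addrAC //; ring.
  rewrite B1 Bx.
  have -> : \sum_j (2^-1 * B (z + (0, r *: scol sig j z)) + 2^-1 * B (z + (0, - r *: scol sig j z))) =
    - \sum_j (2^-1 * (2 * K * tau ^+ 2 - (f p - eta / 2) + 2 * K * sqnorm (xi + r *: scol sig j z)) +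
      2^-1 * (2 * K * tau ^+ 2 - (f p - eta / 2) + 2 * K * sqnorm (xi + - r *: scol sig j z))).
    by rewrite -sumrN; apply: eq_bigr => j _; rewrite !Bx; ring.
  have sb : sqnorm (beta z) <= k%:R * M ^+ 2.
    apply: le_trans (sqnorm_le _) _; apply: ler_wpM2l => //; apply: lerXn2r; rewrite ?nnegrE //.
  have ss : \sum_j sqnorm (scol sig j z) <= d%:R * (k%:R * M ^+ 2).
    apply: (@le_trans _ _ (\sum_(j < d) k%:R * M ^+ 2)).
      apply: ler_sum => j _.
      apply: le_trans (sqnorm_le _) _; apply: ler_wpM2l => //; apply: lerXn2r; rewrite ?nnegrE //.
    by rewrite sumr_const card_ord [leRHS]mulr_natl.
  have h1 : r ^+ 2 * (2 * K * (sqnorm xi + 2 * sqnorm (beta z) + \sum_j sqnorm (scol sig j z))) <=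
      r ^+ 2 * (2 * K * (sqnorm xi + (C - 2))).
    rewrite ler_pM2l //; apply: ler_wpM2l => //; rewrite /C; lra.
  have h2 : 2 * K * (2 * tau * r ^+ 2 + (r ^+ 2) ^+ 2) <= r ^+ 2 * (2 * K * (tau ^+ 2 + 2)).
    rewrite [leRHS]mulrCA; apply: ler_wpM2l => //.
    have := sqr_ge0 (tau - 1); nra.
  have h3 : r ^+ 2 * (N * B z) <= r ^+ 2 * (- (2 * K * (D z p + C)) + G z).
    rewrite ler_pM2l // GE /B.
    have := ler_wpM2l (ltW Npos) (osc z p).
    have := qcq z; rewrite ler_norml => /andP[q1 _].
    have := mulr_ge0 K0 (D0 z p).
    have : 4 * (K * D z p) <= N * (K * D z p) by apply: ler_wpM2r => //; rewrite mulr_ge0.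
    lra.
  move: S h1 h2 h3; rewrite /D -/tau -/xi BE; lra.
apply: le_trans; rewrite /B.
suff : 2 * (K * D p' p) <= eta / 2 by lra.
have e1 : eps1 ^+ 2 <= eps1 by rewrite expr2 ler_piMr ?(ltW eps10) // ge_min lexx.
have e2 : eps1 * (4 * (K + 1) * (k%:R + 1)) <= eta by rewrite -ler_pdivlMr // ge_min lexx orbT.
have e3 : D p' p <= (1 + k%:R) * eps1 ^+ 2.
  move: pp'; rewrite prod_normE ge_max => /andP[/= p1 p2].
  have : sqnorm (p'.2 - p.2) <= k%:R * eps1 ^+ 2.
    apply: le_trans (sqnorm_le _) _; apply: ler_wpM2l => //; apply: lerXn2r; rewrite ?nnegrE ?(ltW eps10) //.
  have : (p'.1 - p.1) ^+ 2 <= eps1 ^+ 2.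
    by rewrite -(real_normK (num_real (p'.1 - p.1))); apply: lerXn2r; rewrite ?nnegrE ?(ltW eps10).
  rewrite /D; lra.
have : K * D p' p <= K * ((1 + k%:R) * eps1).
  apply: ler_wpM2l => //; apply: le_trans e3 _; apply: ler_wpM2l => //; lra.
have := mulr_ge0 (ltW eps10) k0; nra.
Qed.

(** [U1] is an approximate supersolution and [- U2] an approximate subsolution of one equation. The
    threshold [N0] depends on [eta0] but not on [eta], so the accuracy can be chosen after [N];
    closeness to [f] is needed only up to the coarse [eta0]. *)
Theorem smooth_approximation (f q0 : V -> R) (cf cq : R) : ucont f -> ucont q0 ->
  (forall p, `|f p| <= cf) -> (forall p, `|q0 p| <= cq) ->
  forall eta0 : R, 0 < eta0 -> exists2 N0 : R, 0 < N0 & forall N : R, N0 <= N ->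
  forall eta : R, 0 < eta -> exists U1 U2 : R -> 'rV[R]_k -> R,
  let A := genA (fun t x => beta (t, x)) (fun t x => sig (t, x)) in
  [/\ C12 U1 /\ C12 U2,
      forall t x, q0 (t, x) - eta <= N * (U1 t x - f (t, x)) - dt U1 t x - A U1 t x,
      forall t x, - q0 (t, x) - eta <= N * (U2 t x + f (t, x)) - dt U2 t x - A U2 t x,
      (forall t x, f (t, x) - eta0 <= U1 t x) /\ (forall t x, - f (t, x) - eta0 <= U2 t x)
      & forall t x, U1 t x + U2 t x <= eta].
Proof.
move=> uf uq fcf qcq eta0 eta00.
have uN (F : V -> R) : ucont F -> ucont (fun p => - F p).
  move=> uF; have := ucont_lin (-1) uF (ucont_cst _ 0).
  by congr ucont; apply/funext => p; rewrite mulN1r addr0.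
have fcf' p : `|- f p| <= cf by rewrite normrN.
have qcq' p : `|- q0 p| <= cq by rewrite normrN.
have [N1 N10 bar1] := barrier uf fcf qcq eta00.
have [N2 N20 bar2] := barrier (uN _ uf) fcf' qcq' eta00.
have cf0 : 0 <= cf by apply: le_trans (fcf 0).
have cq0 : 0 <= cq by apply: le_trans (qcq 0).
have l0 := L0.
exists (Num.max (2 + 6 * L) (Num.max N1 N2)).
  by rewrite lt_max; apply/orP; left; lra.
move=> N; rewrite !ge_max => /and3P[NL /bar1[e1 e10 {}bar1] /bar2[e2 e20 {}bar2]] eta eta_gt0.
have Npos : 0 < N by lra.
pose G p := N * f p + q0 p.
(* Bounds [G / N] because [N] is at least 1. *)
pose c := cf + cq.
have Gc p : `|G p| <= N * c.
  apply: (le_trans (ler_normD _ _)); rewrite normrM gtr0_norm //.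
  have := fcf p; have := qcq p; rewrite /c; set a := `|f p|; set b := `|q0 p| => h1 h2.
  have : N * a <= N * cf by rewrite ler_pM2l.
  have : 1 * cq <= N * cq by apply: ler_wpM2r => //; lra.
  lra.
have Gc' p : `|- G p| <= N * c by rewrite normrN.
have uG : ucont G by exact: ucont_lin.
have [e3 e30 coup] := coupling_small NL uG Gc eta_gt0.
pose eps := Num.min e1 (Num.min e2 e3).
have eps0 : 0 < eps by rewrite !lt_min e10 e20.
have [ee1 ee2 ee3] : [/\ eps <= e1, eps <= e2 & eps <= e3].
  by rewrite /eps; split; rewrite !ge_min lexx ?orbT.
(* All averages together then displace a point by at most [eps]. *)
pose delta := eps / (3 * k.+1%:R).
have k30 : 0 < 3 * k.+1%:R :> R by rewrite mulr_gt0.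
have delta0 : 0 < delta by rewrite divr_gt0.
have deltaeps : 3 * k.+1%:R * delta <= eps by rewrite /delta mulrC divfK ?gt_eqF.
pose CC := consistency_cst k d M delta c.
have CC0 : 0 <= CC.
  have M0 : 0 <= M by apply: le_trans (betaM 0).
  have c0 : 0 <= c by rewrite addr_ge0.
  have dd : 0 <= 2 / delta by rewrite divr_ge0 // ltW.
  by rewrite /CC /consistency_cst; do ?(by [] || apply: addr_ge0 || apply: mulr_ge0 || apply: exprn_ge0).
(* [CC] grows as [delta] shrinks but does not involve [r], so the consistency error can still be
   brought below [eta]. *)
pose r := Num.min 1 (eta / (CC + 1)).
have CC1 : 0 < CC + 1 by lra.
have r0 : 0 < r by rewrite lt_min ltr01 divr_gt0.
have r1 : r <= 1 by rewrite ge_min lexx.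
have rC : CC * r <= eta.
  have : r * (CC + 1) <= eta by rewrite -ler_pdivlMr // ge_min lexx orbT.
  lra.
have [n Hn] := coup eps r eps0 ee3 r0 r1.
have bu := branch_move_ucont r0 r1.
have rr0 : 0 < r ^+ 2 by exact: exprn_gt0.
have [c1 H1] := smooth_disc_sol betaM sigM n delta0 eps0 Npos r0 r1 deltaeps Gc bu uG.
have [c2 H2] := smooth_disc_sol betaM sigM n delta0 eps0 Npos r0 r1 deltaeps Gc' bu (uN _ uG).
set F1 := disc_sol _ _ _ _ _ _ _ _ in c1 H1.
set F2 := disc_sol _ _ _ _ _ _ _ _ in c2 H2.
have uF1 : ucont F1 by exact (disc_sol_ucont (@branch_weight_ge0 R d) Npos rr0 eps0 Gc bu uG n).
have uF2 : ucont F2 by exact (disc_sol_ucont (@branch_weight_ge0 R d) Npos rr0 eps0 Gc' bu (uN _ uG) n).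
have UE F p : sder delta F [::] p = avgs (sdirs k delta) F p by rewrite /sder expr0 mul1r.
exists (fun t x => sder delta F1 [::] (t, x)), (fun t x => sder delta F2 [::] (t, x)); split.
- by split; [exact: c1|exact: c2].
- move=> t x; have := H1 t x; rewrite -/CC /G; lra.
- move=> t x; have := H2 t x; rewrite -/CC /G; lra.
- split=> t x; rewrite UE -[leLHS](avgs_cst (sdirs k delta) _ (t, x)).
    apply: avgs_le => //; first exact: ucont_cst.
    move=> e he; apply: (bar1 G) => //; first by rewrite lerDl.
    rewrite addrC addKr; apply: le_trans he (le_trans _ ee1).
    exact: le_trans (sum_norm_sdirs k delta0) deltaeps.
  apply: avgs_le => //; first exact: ucont_cst.
  move=> e he; apply: (bar2 (fun z => - G z)) => //; last 1 first.
  + rewrite addrC addKr; apply: le_trans he (le_trans _ ee2).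
    exact: le_trans (sum_norm_sdirs k delta0) deltaeps.
  + by move=> z; rewrite /G; ring.
  + by rewrite lerDl.
- move=> t x; rewrite !UE.
  have -> : avgs (sdirs k delta) F1 (t, x) + avgs (sdirs k delta) F2 (t, x) =
      avgs (sdirs k delta) (fun p => 1 * F1 p + F2 p) (t, x).
    by rewrite avgs_lin // mul1r.
  rewrite -[leRHS](avgs_cst (sdirs k delta) _ (t, x)); apply: avgs_le => //.
  + exact: ucont_lin.
  + exact: ucont_cst.
  + by move=> e _; rewrite mul1r; exact: Hn.
Qed.
End Approximation.

(** * Local comparison for the linear equation *)

Section Compactness.
Variables (R : realType) (V W : normedModType R).

Lemma within_continuous_dist (A : set V) (F : V -> W) : {within A, continuous F} ->
  forall p, A p -> forall eta : R, 0 < eta -> exists2 rho : R, 0 < rho &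
    forall q, A q -> `|p - q| < rho -> `|F p - F q| <= eta.
Proof.
move=> /subspace_continuousP cF p Ap eta eta0.
have /cvgrPdist_le/(_ eta eta0) := cF p Ap.
rewrite near_withinE => /nbhs_normP[rho rho0 H].
by exists rho => // q Aq pq; exact: H.
Qed.

Lemma compact_uniform (K : set V) (F : V -> W) : compact K -> {within K, continuous F} ->
  forall eta : R, 0 < eta -> exists2 rho : R, 0 < rho &
    forall p q, K p -> K q -> `|p - q| < rho -> `|F p - F q| <= eta.
Proof.
move=> /compact_near_coveringP cK cF eta eta0.
have := cK _ (0 : R)^'+ (fun rho p => K p -> forall q, K q -> `|p - q| < rho -> `|F p - F q| <= eta).
case=> [p Kp|rho /= rho0 H].
  have [|r r0 H] := within_continuous_dist cF Kp (eta := eta / 2); first by lra.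
  have r2 : 0 < r / 2 by lra.
  exists ([set q | `|p - q| < r / 2], [set s | s < r / 2]) => /=.
    split; first by apply/nbhs_normP; exists (r / 2).
    exact: nbhs_right_lt.
  move=> [p' s] /= [pp' sr] Kp' q Kq pq.
  have h1 : `|F p - F p'| <= eta / 2 by apply: H => //; lra.
  have h2 : `|F p - F q| <= eta / 2.
    apply: H => //; apply: (le_lt_trans (ler_distD p' _ _)).
    have {}sr : s < r / 2 := sr; lra.
  apply: (le_trans (ler_distD (F p) _ _)).
  by rewrite (distrC (F p')); lra.
exists (rho / 2); first by lra.
move=> p q Kp Kq pq; apply: (H (rho / 2)) => //=; last by lra.
by rewrite sub0r normrN gtr0_norm; lra.
Qed.

Lemma compact_norm_bounded (K : set V) (F : V -> W) : compact K -> {within K, continuous F} ->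
  exists M : R, forall p, K p -> `|F p| <= M.
Proof.
move=> cK cF; have [M [_ H]] := compact_bounded (continuous_compact cF cK).
by exists (M + 1) => p Kp; apply: (H (M + 1)); [rewrite ltrDl|exists p].
Qed.

End Compactness.

(** * Boxes and extension by projection *)

Section Box.
Variables (R : realType) (k : nat).
Local Notation V := (R * 'rV[R]_k)%type.
Implicit Types (p q : V) (x : 'rV[R]_k) (t : R).

Definition clamp (a b s : R) : R := Num.max a (Num.min b s).

Lemma clamp_in (a b s : R) : a <= b -> a <= clamp a b s <= b.
Proof.
move=> ab; rewrite /clamp; case: (leP b s) => h1; case: (leP a b) => h2; case: (leP a s) => h3; lra.
Qed.

Lemma clamp_id (a b s : R) : a <= s <= b -> clamp a b s = s.
Proof.
move=> /andP[h h']; rewrite /clamp; case: (leP b s) => h1; case: (leP a b) => h2; case: (leP a s) => h3; lra.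
Qed.

Lemma clamp_dist (a b s s' : R) : a <= b -> `|clamp a b s - clamp a b s'| <= `|s - s'|.
Proof.
move=> ab; rewrite /clamp.
have n1 := ler_norm (s - s'); have n2 := ler_norm (s' - s); rewrite (distrC s' s) in n2.
by case: (leP b s) => h1; case: (leP b s') => h2; case: (leP a b) => h3; case: (leP a s) => h4; case: (leP a s') => h5; rewrite ler_norml; lra.
Qed.

Definition box (lo hi rho : R) (x0 : 'rV[R]_k) : set V :=
  [set p | lo <= p.1 <= hi /\ `|p.2 - x0| <= rho].

(** Nonexpansive in every coordinate, hence for the maximum norm and for the Euclidean norm of the
    space part: composing with it preserves moduli of continuity, bounds and the Lipschitz constant
    in space. *)
Definition box_proj (lo hi rho : R) (x0 : 'rV[R]_k) p : V :=
  (clamp lo hi p.1, \row_i clamp (x0 ord0 i - rho) (x0 ord0 i + rho) (p.2 ord0 i)).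

Lemma row_norm_le x (r : R) : 0 <= r -> (`|x| <= r <-> forall i, `|x ord0 i| <= r).
Proof.
move=> r0; split=> [xr i|H]; first exact: le_trans (abs_coord_le x i) xr.
rewrite [`|_|]mx_normrE; apply: bigmax_le => // -[a i] _ /=.
by rewrite (ord1 a).
Qed.

Lemma compact_box (lo hi rho : R) x0 : 0 <= rho -> compact (box lo hi rho x0).
Proof.
move=> rho0.
have -> : box lo hi rho x0 = `[lo, hi]%classic `*`
    [set x : 'rV[R]_k | forall i, `[x0 ord0 i - rho, x0 ord0 i + rho]%classic (x ord0 i)].
  apply/seteqP; split=> -[t x] /= [h1 h2].
    split; first by rewrite /= in_itv.
    move=> i; rewrite /= in_itv /=; have := (row_norm_le (x - x0) rho0).1 h2 i.
    rewrite !mxE ler_norml; lra.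
  split; first by move: h1; rewrite in_itv.
  apply/(row_norm_le _ rho0) => i; have := h2 i; rewrite in_itv /= !mxE ler_norml; lra.
apply: compact_setX; first exact: segment_compact.
by apply: (@rV_compact R k (fun i => `[x0 ord0 i - rho, x0 ord0 i + rho]%classic)) => i; exact: segment_compact.
Qed.

Variables (lo hi rho : R) (x0 : 'rV[R]_k).
Hypotheses (lohi : lo <= hi) (rho0 : 0 <= rho).
Local Notation B := (box lo hi rho x0).
Local Notation proj := (box_proj lo hi rho x0).

Lemma box_proj_in p : B (proj p).
Proof.
split=> /=; first exact: clamp_in.
apply/(row_norm_le _ rho0) => i; rewrite !mxE.
have := @clamp_in (x0 ord0 i - rho) (x0 ord0 i + rho) (p.2 ord0 i).
by have r0 := rho0; move=> /(_ ltac:(lra)); rewrite ler_norml; lra.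
Qed.

Lemma box_proj_id p : B p -> proj p = p.
Proof.
case: p => t x [/= h1 h2]; congr pair; first exact: clamp_id.
apply/rowP => i; rewrite mxE clamp_id //.
by have := (row_norm_le (x - x0) rho0).1 h2 i; rewrite !mxE ler_norml; lra.
Qed.

Lemma box_proj_coord_dist p q i :
  `|(proj p).2 ord0 i - (proj q).2 ord0 i| <= `|p.2 ord0 i - q.2 ord0 i|.
Proof. by rewrite !mxE; apply: clamp_dist; have r0 := rho0; lra. Qed.

Lemma box_proj_dist p q : `|proj p - proj q| <= `|p - q|.
Proof.
rewrite prod_normE ge_max; apply/andP; split.
  apply: (le_trans (clamp_dist _ _ lohi)).
  by rewrite [leRHS]prod_normE le_max lexx.
apply/row_norm_le => // i; rewrite [X in `|X|]mxE [X in _ + X]mxE.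
apply: (le_trans (box_proj_coord_dist p q i)).
have := abs_coord_le (p.2 - q.2) i; rewrite !mxE => h; apply: le_trans h _.
by rewrite [leRHS]prod_normE le_max lexx orbT.
Qed.

Lemma box_extension_uniform (W : normedModType R) (F : V -> W) :
  {within box lo hi rho x0, continuous F} -> forall eta : R, 0 < eta ->
  exists2 r : R, 0 < r &
     forall p q, `|p - q| < r -> `|F (box_proj lo hi rho x0 p) - F (box_proj lo hi rho x0 q)| <= eta.
Proof.
move=> cF eta eta0; have cB : compact (box lo hi rho x0) by exact: compact_box.
have [r r0 H] := compact_uniform cB cF eta0; exists r => // p q pq.
by apply: H; try exact: box_proj_in; apply: le_lt_trans pq; exact: box_proj_dist.
Qed.

Lemma box_extension_bounded (W : normedModType R) (F : V -> W) :
  {within box lo hi rho x0, continuous F} ->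
  exists M : R, forall p, `|F (box_proj lo hi rho x0 p)| <= M.
Proof.
move=> cF; have cB : compact (box lo hi rho x0) by exact: compact_box.
by have [M H] := compact_norm_bounded cB cF; exists M => p; apply: H; exact: box_proj_in.
Qed.
End Box.

(** * Linear calculus of test functions *)

Section TestFunctions.
Variables (R : realType) (k : nat).
Implicit Types (f g : R -> 'rV[R]_k -> R).

Definition flin (a : R) f g : R -> 'rV[R]_k -> R := fun t x => a * f t x + g t x.

Lemma derive1_lin (a : R) (f g : R -> R) t : derivable f t 1 -> derivable g t 1 ->
  derivable (fun s => a * f s + g s) t 1 /\ derive1 (fun s => a * f s + g s) t = a * derive1 f t + derive1 g t.
Proof.
move=> df dg.
have d1 := derivableP df; have d2 := derivableP dg.
have d3 : is_derive t 1 (a \*: f + g) (a *: 'D_1 f t + 'D_1 g t).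
  by apply: is_deriveD; apply: is_deriveZ.
split; first exact: (@ex_derive _ _ _ _ _ _ _ d3).
by rewrite !derive1E (@derive_val _ _ _ _ _ _ _ d3).
Qed.

Lemma C12_lin (a : R) f g : C12 f -> C12 g ->
  [/\ C12 (flin a f g), dt (flin a f g) = flin a (dt f) (dt g),
      forall i, dx i (flin a f g) = flin a (dx i f) (dx i g) &
      forall i j, dxx i j (flin a f g) = flin a (dxx i j f) (dxx i j g)].
Proof.
move=> [f1 f2 f3 [f4 f5] [f6 f7]] [g1 g2 g3 [g4 g5] [g6 g7]].
have jl (u v : R -> 'rV[R]_k -> R) : jcont u -> jcont v -> jcont (flin a u v).
  move=> cu cv p; apply: cvgD; last exact: cv.
  by apply: cvgM; [exact: cvg_cst|exact: cu].
have Et : dt (flin a f g) = flin a (dt f) (dt g).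
  apply/funext => t; apply/funext => x.
  exact: (derive1_lin a (f1 t x) (g1 t x)).2.
have Ex i : dx i (flin a f g) = flin a (dx i f) (dx i g).
  apply/funext => t; apply/funext => x.
  exact: (derive1_lin a (f2 i t x) (g2 i t x)).2.
have Exx i j : dxx i j (flin a f g) = flin a (dxx i j f) (dxx i j g).
  rewrite /dxx Ex; apply/funext => t; apply/funext => x.
  exact: (derive1_lin a (f3 i j t x) (g3 i j t x)).2.
split; [split|exact: Et|exact: Ex|exact: Exx].
- by move=> t x; exact: (derive1_lin a (f1 t x) (g1 t x)).1.
- by move=> i t x; exact: (derive1_lin a (f2 i t x) (g2 i t x)).1.
- by move=> i j t x; rewrite Ex; exact: (derive1_lin a (f3 i j t x) (g3 i j t x)).1.
- by rewrite Et; split; exact: jl.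
- by split=> [i|i j]; [rewrite Ex; exact: (jl _ _ (f6 i) (g6 i))|
    rewrite Exx; exact: (jl _ _ (f7 i j) (g7 i j))].
Qed.

Lemma genA_lin (d : nat) (b : R -> 'rV[R]_k -> 'rV[R]_k) (sigma : R -> 'rV[R]_k -> 'M[R]_(k, d))
  (a : R) f g t x : C12 f -> C12 g ->
  genA b sigma (flin a f g) t x = a * genA b sigma f t x + genA b sigma g t x.
Proof.
move=> cf cg; have [_ _ Ex Exx] := C12_lin a cf cg.
have h1 : \sum_i b t x ord0 i * dx i (flin a f g) t x =
    a * (\sum_i b t x ord0 i * dx i f t x) + \sum_i b t x ord0 i * dx i g t x.
  rewrite mulr_sumr -big_split /=; apply: eq_bigr => i _; rewrite Ex /flin.
  move: (dx i f t x) (dx i g t x) => u v; ring.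
have h2 : \sum_i \sum_j (sigma t x *m (sigma t x)^T) i j * dxx i j (flin a f g) t x =
    a * (\sum_i \sum_j (sigma t x *m (sigma t x)^T) i j * dxx i j f t x) +
    \sum_i \sum_j (sigma t x *m (sigma t x)^T) i j * dxx i j g t x.
  rewrite mulr_sumr -big_split /=; apply: eq_bigr => i _.
  rewrite mulr_sumr -big_split /=; apply: eq_bigr => j _; rewrite Exx /flin.
  move: (dxx i j f t x) (dxx i j g t x) => u v; ring.
transitivity (2^-1 * (\sum_i \sum_j (sigma t x *m (sigma t x)^T) i j * dxx i j (flin a f g) t x) +
  \sum_i b t x ord0 i * dx i (flin a f g) t x); first by [].
have aux (u1 u2 u3 u4 : R) : 2^-1 * (a * u1 + u2) + (a * u3 + u4) =
    a * (2^-1 * u1 + u3) + (2^-1 * u2 + u4) by ring.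
rewrite h1 h2; exact: aux.
Qed.

Lemma genA_abs_le (d : nat) (b : R -> 'rV[R]_k -> 'rV[R]_k) (sigma : R -> 'rV[R]_k -> 'M[R]_(k, d))
  f t x (M D1 D2 : R) : (forall i, `|b t x ord0 i| <= M) -> (forall i j, `|sigma t x i j| <= M) ->
  (forall i, `|dx i f t x| <= D1) -> (forall i j, `|dxx i j f t x| <= D2) ->
  `|genA b sigma f t x| <= k%:R ^+ 2 * d%:R * (M ^+ 2 * D2) + k%:R * (M * D1).
Proof.
move=> bM sM fD1 fD2; rewrite /genA; apply: (le_trans (ler_normD _ _)).
apply: lerD; last first.
  apply: (le_trans (ler_norm_sum _ _ _)).
  apply: (@le_trans _ _ (\sum_(i < k) M * D1)).
    by apply: ler_sum => i _; rewrite normrM; apply: ler_pM.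
  by rewrite sumr_const card_ord [leRHS]mulr_natl.
rewrite normrM; apply: (@le_trans _ _ (1 * `|\sum_i \sum_j (sigma t x *m (sigma t x)^T) i j * dxx i j f t x|)).
  by apply: ler_wpM2r => //; rewrite ger0_norm; lra.
rewrite mul1r; apply: (le_trans (ler_norm_sum _ _ _)).
apply: (@le_trans _ _ (\sum_(i < k) \sum_(j < k) (M ^+ 2 * D2) *+ d)).
  apply: ler_sum => i _; apply: (le_trans (ler_norm_sum _ _ _)); apply: ler_sum => j _.
  rewrite normrM -[leRHS]mulrnAl; apply: ler_pM => //.
  rewrite mxE; apply: (le_trans (ler_norm_sum _ _ _)).
  apply: (@le_trans _ _ (\sum_(l < d) M ^+ 2)).
    by apply: ler_sum => l _; rewrite mxE normrM expr2; apply: ler_pM.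
  by rewrite sumr_const card_ord.
rewrite !sumr_const !card_ord -!mulrnA -[leLHS]mulr_natl.
by rewrite le_eqVlt; apply/orP; left; apply/eqP; rewrite !natrM; ring.
Qed.

End TestFunctions.

(** * Explicit radial test functions *)

Section RadialTest.
Variables (R : realType) (k : nat).
Implicit Types (f g : R -> 'rV[R]_k -> R) (x c : 'rV[R]_k) (t : R).

Lemma jcont_cst (a : R) : jcont (fun _ (_ : 'rV[R]_k) => a).
Proof. by move=> p; exact: cvg_cst. Qed.

Lemma jcontD f g : jcont f -> jcont g -> jcont (fun t x => f t x + g t x).
Proof. by move=> cf cg p; apply: cvgD; [exact: cf|exact: cg]. Qed.

Lemma jcontM f g : jcont f -> jcont g -> jcont (fun t x => f t x * g t x).
Proof. by move=> cf cg p; apply: cvgM; [exact: cf|exact: cg]. Qed.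

Lemma jcontX f n : jcont f -> jcont (fun t x => f t x ^+ n).
Proof.
move=> cf; elim: n => [|n IH]; first exact: jcont_cst.
have -> : (fun t x => f t x ^+ n.+1) = (fun t x => f t x * f t x ^+ n).
  by apply/funext => t; apply/funext => x; rewrite exprS.
exact: jcontM.
Qed.

Lemma jcont_sum (I : Type) (r : seq I) (F : I -> R -> 'rV[R]_k -> R) :
  (forall i, jcont (F i)) -> jcont (fun t x => \sum_(i <- r) F i t x).
Proof.
move=> cF; elim: r => [|i r IH].
  have -> : (fun t x => \sum_(i <- [::]) F i t x) = (fun _ _ => 0).
    by apply/funext => t; apply/funext => x; rewrite big_nil.
  exact: jcont_cst.
have -> : (fun t x => \sum_(i <- i :: r) F i t x) = (fun t x => F i t x + \sum_(i <- r) F i t x).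
  by apply/funext => t; apply/funext => x; rewrite big_cons.
exact: jcontD.
Qed.

Lemma jcont_time (E : R -> R) : continuous E -> jcont (fun t (_ : 'rV[R]_k) => E t).
Proof.
move=> cE p; apply: continuous_comp; last exact: cE.
exact: cvg_fst.
Qed.

Lemma jcont_coord c i : jcont (fun _ x => x ord0 i - c ord0 i).
Proof.
move=> p; apply: cvgB; last exact: cvg_cst.
apply: (@continuous_comp _ _ _ snd (fun x : 'rV[R]_k => x ord0 i)); first exact: cvg_snd.
exact: coord_continuous.
Qed.

Lemma jcont_radial c : jcont (fun _ x => 1 + sqnorm (x - c)).
Proof.
apply: jcontD; first exact: jcont_cst.
apply: (@jcont_sum _ _ (fun i _ x => (x - c) ord0 i ^+ 2)) => i.
have -> : (fun (_ : R) x => (x - c) ord0 i ^+ 2) = (fun _ x => (x ord0 i - c ord0 i) ^+ 2).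
  by apply/funext => t; apply/funext => x; rewrite !mxE.
exact (@jcontX (fun _ x => x ord0 i - c ord0 i) 2 (@jcont_coord c i)).
Qed.

(** One family provides the growth penalty (exponential [E]), the localizing paraboloid (exponents 0
    and 1) and the constants (exponent 0). *)
Definition radial (E : R -> R) c (n : nat) : R -> 'rV[R]_k -> R :=
  fun t x => E t * (1 + sqnorm (x - c)) ^+ n.

Lemma is_derive_radial (a b e : R) (n : nat) :
  is_derive (0 : R) 1 (fun s => e * (a + 2 * s * b + s * s) ^+ n) (e * (n%:R * a ^+ n.-1 * (2 * b))).
Proof.
have d1 : is_derive (0 : R) 1 (fun s => a + 2 * s * b + s * s) (2 * b).
  apply: is_derive_eq; rewrite /GRing.scale /=; ring.
have d2 := @is_deriveX _ _ _ n _ _ _ d1.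
have d3 := @is_deriveZ _ _ _ _ e _ _ _ d2.
have -> : (fun s : R => e * (a + 2 * s * b + s * s) ^+ n) =
    e \*: ((fun s : R => a + 2 * s * b + s * s) ^+ n).
  by apply/funext => s; rewrite !fctE.
apply: (is_derive_eq d3).
by rewrite /GRing.scale /= !(mulr0, mul0r, addr0).
Qed.

Lemma sqnorm_evec x c i (s : R) :
  1 + sqnorm (x + s *: evec R i - c) = 1 + sqnorm (x - c) + 2 * s * (x - c) ord0 i + s * s.
Proof.
rewrite addrAC sqnormD.
have -> : sqnorm (evec R i) = 1.
  rewrite /sqnorm (bigD1 i) //= mxE !eqxx /= expr1n big1 ?addr0 // => j ji.
  by rewrite mxE (negbTE ji) andbF expr0n.
have -> : dotv (x - c) (evec R i) = (x - c) ord0 i.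
  rewrite /dotv (bigD1 i) //= [X in _ * X]mxE !eqxx /= mulr1 big1 ?addr0 // => j ji.
  by rewrite [X in _ * X]mxE (negbTE ji) andbF mulr0.
ring.
Qed.

Definition dradial (E : R -> R) c (n : nat) i : R -> 'rV[R]_k -> R :=
  fun t x => E t * (n%:R * (1 + sqnorm (x - c)) ^+ n.-1 * (2 * (x ord0 i - c ord0 i))).

(** The truncated [n.-1] and [n.-2] are harmless for small [n], since the factors [n%:R] and
    [n.-1%:R] vanish there. *)
Definition ddradial (E : R -> R) c (n : nat) i j : R -> 'rV[R]_k -> R :=
  fun t x => E t * (n%:R * n.-1%:R * (1 + sqnorm (x - c)) ^+ n.-2 *
    (2 * (x ord0 i - c ord0 i)) * (2 * (x ord0 j - c ord0 j)) +
    n%:R * (1 + sqnorm (x - c)) ^+ n.-1 * (2 * (i == j)%:R)).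

Lemma C12_radial (E E' : R -> R) c n : (forall t, is_derive t 1 E (E' t)) -> continuous E' ->
  [/\ C12 (radial E c n), dt (radial E c n) = radial E' c n,
      forall i, dx i (radial E c n) = dradial E c n i &
      forall i j, dxx i j (radial E c n) = ddradial E c n i j].
Proof.
move=> dE cE'.
have cE : continuous E.
  by move=> t; apply: differentiable_continuous; apply/derivable1_diffP; exact: (@ex_derive _ _ _ _ _ _ _ (dE t)).
have ht t x : is_derive t 1 (fun s => radial E c n s x) (radial E' c n t x).
  rewrite /radial; set a := _ ^+ n.
  have d := dE t.
  have -> : (fun s => E s * a) = (fun s => a * E s) by apply/funext => s; rewrite mulrC.
  apply: is_derive_eq; rewrite /GRing.scale /=; ring.
have hx i t x : is_derive (0 : R) 1 (fun s : R => radial E c n t (x + s *: evec R i)) (dradial E c n i t x).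
  have := is_derive_radial (1 + sqnorm (x - c)) ((x - c) ord0 i) (E t) n.
  have -> : (fun s : R => radial E c n t (x + s *: evec R i)) =
    (fun s => E t * (1 + sqnorm (x - c) + 2 * s * (x - c) ord0 i + s * s) ^+ n).
    by apply/funext => s; rewrite /radial sqnorm_evec.
  by rewrite /dradial !mxE.
have hxx i j t x : is_derive (0 : R) 1 (fun s : R => dradial E c n j t (x + s *: evec R i)) (ddradial E c n i j t x).
  set a := 1 + sqnorm (x - c); set bi := x ord0 i - c ord0 i; set bj := x ord0 j - c ord0 j.
  have -> : (fun s : R => dradial E c n j t (x + s *: evec R i)) =
    (fun s : R => (E t * n%:R * (a + 2 * s * bi + s * s) ^+ n.-1) * (2 * (bj + s * (i == j)%:R))).
    apply/funext => s; rewrite /dradial sqnorm_evec -/a !mxE -/bi /= (eq_sym j) /bj.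
    by ring.
  have d1 := is_derive_radial a bi (E t * n%:R) n.-1.
  have d2 : is_derive (0 : R) 1 (fun s : R => 2 * (bj + s * (i == j)%:R)) (2 * (i == j)%:R).
    apply: is_derive_eq; rewrite /GRing.scale /=; ring.
  apply: (is_derive_eq (is_deriveM d1 d2)).
  rewrite /ddradial -/a -/bi -/bj /GRing.scale /= !mulr0 !mul0r !addr0.
  by ring.
have Edt : dt (radial E c n) = radial E' c n.
  apply/funext => t; apply/funext => x; rewrite /dt derive1E; exact: (@derive_val _ _ _ _ _ _ _ (ht t x)).
have Edx i : dx i (radial E c n) = dradial E c n i.
  apply/funext => t; apply/funext => x; rewrite /dx derive1E; exact: (@derive_val _ _ _ _ _ _ _ (hx i t x)).
have Edxx i j : dxx i j (radial E c n) = ddradial E c n i j.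
  rewrite /dxx Edx; apply/funext => t; apply/funext => x.
  rewrite /dx derive1E; exact: (@derive_val _ _ _ _ _ _ _ (hxx i j t x)).
have jr m : jcont (fun _ x => (1 + sqnorm (x - c)) ^+ m).
  exact (@jcontX (fun _ x => 1 + sqnorm (x - c)) m (@jcont_radial c)).
have jE (H : R -> R) g : continuous H -> jcont g -> jcont (fun t x => H t * g t x).
  by move=> cH cg; exact (@jcontM (fun t _ => H t) g (jcont_time cH) cg).
have jM g h : jcont g -> jcont h -> jcont (fun t x => g t x * h t x) by exact: jcontM.
have jc (a : R) : jcont (fun _ (_ : 'rV[R]_k) => a) by exact: jcont_cst.
have jx i : jcont (fun _ x => x ord0 i - c ord0 i) by exact: jcont_coord.
have jlin (a : R) i : jcont (fun _ x => a * (x ord0 i - c ord0 i)) by exact: jM.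
have jn m (a : R) : jcont (fun _ x => a * (1 + sqnorm (x - c)) ^+ m) by exact: jM.
split; [split|exact: Edt|exact: Edx|exact: Edxx].
- move=> t x; exact: (@ex_derive _ _ _ _ _ _ _ (ht t x)).
- move=> i t x; exact: (@ex_derive _ _ _ _ _ _ _ (hx i t x)).
- move=> i j t x; rewrite Edx; exact: (@ex_derive _ _ _ _ _ _ _ (hxx i j t x)).
- by rewrite Edt; split; exact: jE.
- split=> [i|i j].
    rewrite Edx; apply: jE => //.
    by apply: (jM (fun _ x => n%:R * (1 + sqnorm (x - c)) ^+ n.-1)).
  rewrite Edxx; apply: jE => //; apply: jcontD.
    apply: (jM (fun _ x => n%:R * n.-1%:R * (1 + sqnorm (x - c)) ^+ n.-2 *
      (2 * (x ord0 i - c ord0 i)))) => //.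
    by apply: (jM (fun _ x => n%:R * n.-1%:R * (1 + sqnorm (x - c)) ^+ n.-2)).
  by apply: (jM (fun _ x => n%:R * (1 + sqnorm (x - c)) ^+ n.-1)).
Qed.
End RadialTest.

(** * Comparison on a small box *)

Section LocalComparison.
Variables (R : realType) (k d : nat) (T : R).
Local Notation V := (R * 'rV[R]_k)%type.
Variables (b : R -> 'rV[R]_k -> 'rV[R]_k) (sigma : R -> 'rV[R]_k -> 'M[R]_(k, d)).
Implicit Types (h f U phi psi : R -> 'rV[R]_k -> R) (t : R) (x : 'rV[R]_k).

Lemma C12_affine (r a : R) f : C12 f ->
  [/\ C12 (fun t x => r * f t x + a),
      forall t x, dt (fun t x => r * f t x + a) t x = r * dt f t x &
      forall t x, genA b sigma (fun t x => r * f t x + a) t x = r * genA b sigma f t x].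
Proof.
move=> cf.
have d0 (t : R) : is_derive t 1 (fun _ : R => a) 0 by apply: is_derive_cst.
have [] := @C12_radial R k (fun _ => a) (fun _ => 0) 0 0 d0 (fun=> cvg_cst _).
have -> : radial (fun _ => a) 0 0 = fun _ (_ : 'rV[R]_k) => a.
  by apply/funext => t; apply/funext => x; rewrite /radial expr0 mulr1.
move=> ca dta dxa dxxa.
have [cl dl _ _] := C12_lin r cf ca.
split; first exact: cl.
  by move=> t x; rewrite -/(flin r f (fun _ _ => a)) dl /flin dta /radial mul0r addr0.
move=> t x; apply: etrans (genA_lin b sigma r t x cf ca) _.
suff -> : genA b sigma (fun _ _ => a) t x = 0 by rewrite addr0.
rewrite /genA [X in _ * X]big1 ?mulr0 ?add0r.
  by apply: big1 => i _; rewrite dxa /dradial mulr0n !mul0r !mulr0.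
by move=> i _; apply: big1 => j _; rewrite dxxa /ddradial mulr0n !mul0r addr0 !mulr0.
Qed.

Lemma norm_le_enorm x : `|x| <= enorm x.
Proof.
have -> : `|x| = Num.sqrt (`|x| ^+ 2) by rewrite sqrtr_sqr normr_id.
by rewrite enormE; apply: ler_wsqrtr; exact: norm_sqr_le.
Qed.

Lemma enorm_sqr x : enorm x ^+ 2 = sqnorm x.
Proof. by rewrite enormE sqr_sqrtr // sqnorm_ge0. Qed.

Lemma fnorm_sqr (A : 'M[R]_(k, d)) : fnorm A ^+ 2 = \sum_j sqnorm (\row_i A i j).
Proof.
rewrite /fnorm sqr_sqrtr; last by do 2 (apply: sumr_ge0 => ? _); exact: sqr_ge0.
rewrite exchange_big; apply: eq_bigr => j _; apply: eq_bigr => i _ /=.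
by rewrite mxE.
Qed.

Variables (t0 rho : R) (x0 : 'rV[R]_k).
Hypotheses (rho0 : 0 < rho) (t00 : 0 <= t0) (t0T : t0 + rho < T).
(** When the box is cut at time 0, the face [t = 0] counts as interior: the viscosity inequalities
    hold there, with local extrema relative to nonnegative times. *)
Let lo := Num.max 0 (t0 - rho).
Let hi := t0 + rho.
Local Notation B := (box lo hi rho x0).

Let lohi : lo <= hi.
Proof. by have r0 := rho0; have h0 := t00; rewrite /lo /hi ge_max; apply/andP; lra. Qed.

Lemma boxP t x : B (t, x) <-> [/\ 0 <= t, `|t - t0| <= rho & `|x - x0| <= rho].
Proof.
rewrite /box /lo /hi /= ge_max ler_norml; split=> [[h1 h2]|[h1 h2 h3]].
  by split => //; lra.
by split => //; rewrite h1 /=; lra.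
Qed.

Lemma box_dom t x : B (t, x) -> 0 <= t < T.
Proof. by have h0 := t0T; move/boxP => [h1]; rewrite ler_norml h1; lra. Qed.

Lemma box_sub_dom : B `<=` @dom R k T.
Proof. by move=> [t x] /box_dom /andP[h1 /ltW h2]; rewrite /dom /= h1. Qed.

Lemma interior_locmax h t1 x1 : B (t1, x1) -> `|t1 - t0| < rho -> `|x1 - x0| < rho ->
  (forall t x, B (t, x) -> h t x <= h t1 x1) -> locmax T h t1 x1.
Proof.
move=> _ tr xr H; exists (Num.min (rho - `|t1 - t0|) (rho - `|x1 - x0|)).
  by rewrite lt_min !subr_gt0 tr.
move=> t x /andP[t0' _]; rewrite !lt_min => /andP[h1 _] /andP[_ h2].
apply: H; apply/boxP; split => //.
  apply: (le_trans (ler_distD t1 _ _)); lra.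
apply: (le_trans (ler_distD x1 _ _)); have := norm_le_enorm (x - x1); lra.
Qed.

(** At an interior maximum of [h - U] the smooth [U] is itself a test function; the two inequalities
    combine to [N * (U - f) >= kap - eta], and [h <= f]. At a boundary maximum the bound is assumed,
    and the maximum carries it to the whole box. *)
Lemma touching_bound h f q0 U (N eta kap : R) : 0 < N -> C12 U ->
  {within B, continuous (fun p : V => h p.1 p.2)} ->
  (forall t x, B (t, x) ->
     q0 t x - eta <= N * (U t x - f t x) - dt U t x - genA b sigma U t x) ->
  (forall t x phi, B (t, x) -> `|t - t0| < rho -> `|x - x0| < rho -> C12 phi ->
     locmax T (fun t x => h t x - phi t x) t x ->
     - dt phi t x - genA b sigma phi t x - q0 t x <= - kap) ->
  (forall t x, B (t, x) -> h t x <= f t x) ->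
  (forall t x, B (t, x) -> `|t - t0| = rho \/ `|x - x0| = rho ->
     h t x + (kap - eta) / N <= U t x) ->
  forall t x, B (t, x) -> h t x + (kap - eta) / N <= U t x.
Proof.
move=> N0 cU ch HU Hh hf bd.
have cB : compact B by apply: compact_box; exact: ltW.
have Bne : B !=set0.
  by exists (t0, x0); apply/boxP; split => //; rewrite subrr normr0 ltW.
have cUc : {within B, continuous (fun p : V => U p.1 p.2)}.
  by apply: continuous_subspaceT; case: cU => _ _ _ [].
have cw : {within B, continuous (fun p : V => h p.1 p.2 - U p.1 p.2)}.
  by move=> p; apply: cvgB; [exact: ch|exact: cUc].
have [[t1 x1] /set_mem B1 Hmax] := compact_EVT_max Bne cB cw.
have key : h t1 x1 + (kap - eta) / N <= U t1 x1.
  have /boxP[_ h2 h3] := B1.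
  have [e1|n1] := eqVneq `|t1 - t0| rho; first by apply: bd => //; left.
  have [e2|n2] := eqVneq `|x1 - x0| rho; first by apply: bd => //; right.
  have l1 : `|t1 - t0| < rho by rewrite lt_neqAle n1.
  have l2 : `|x1 - x0| < rho by rewrite lt_neqAle n2.
  have lm : locmax T (fun t x => h t x - U t x) t1 x1.
    apply: interior_locmax => // t x Btx.
    by apply: (Hmax (t, x)); rewrite inE.
  have := Hh t1 x1 U B1 l1 l2 cU lm; have := HU t1 x1 B1; have := hf t1 x1 B1.
  move: (dt U t1 x1) (genA b sigma U t1 x1) => u1 u2 g1 g2 g3.
  have : (kap - eta) / N <= U t1 x1 - f t1 x1.
    by rewrite ler_pdivrMr // mulrC; lra.
  lra.
move=> t x Btx; have := Hmax (t, x); rewrite inE => /(_ Btx) /=; lra.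
Qed.

Hypothesis hb : {within @dom R k T, continuous (fun p : V => b p.1 p.2)}.
Hypothesis hsig : {within @dom R k T, continuous (fun p : V => sigma p.1 p.2)}.
Variable C : R.
Hypothesis lip : forall t x x', 0 <= t <= T ->
  fnorm (sigma t x - sigma t x') + enorm (b t x - b t x') <= C * enorm (x - x').

Lemma genA_eq (b' : R -> 'rV[R]_k -> 'rV[R]_k) (sigma' : R -> 'rV[R]_k -> 'M[R]_(k, d)) phi t x :
  b' t x = b t x -> sigma' t x = sigma t x -> genA b' sigma' phi t x = genA b sigma phi t x.
Proof. by rewrite /genA => -> ->. Qed.

(** If [w] and [z] met at the centre, the bounds [w - eta / N <= U1] and
    [- z + (kap - eta) / N <= U2] would contradict [U1 + U2 <= eta]. On the boundary [w] and [z] lie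
    at least [gap / 2] from their mean: a quarter of [gap] goes to the approximation error and a
    quarter to [kap / N]. *)
Lemma local_comparison (w z psi : R -> 'rV[R]_k -> R) (kap gap : R) : 0 < kap -> 0 < gap ->
  contOn T w -> contOn T z -> contOn T psi ->
  (forall t x phi, B (t, x) -> `|t - t0| < rho -> `|x - x0| < rho -> C12 phi ->
     locmax T (fun t x => w t x - phi t x) t x ->
     - dt phi t x - genA b sigma phi t x - psi t x <= 0) ->
  (forall t x phi, B (t, x) -> `|t - t0| < rho -> `|x - x0| < rho -> C12 phi ->
     locmax T (fun t x => phi t x - z t x) t x ->
     kap <= - dt phi t x - genA b sigma phi t x - psi t x) ->
  (forall t x, B (t, x) -> w t x <= z t x) ->
  (forall t x, B (t, x) -> `|t - t0| = rho \/ `|x - x0| = rho -> w t x <= z t x - gap) ->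
  w t0 x0 < z t0 x0.
Proof.
move=> kap0 gap0 cw cz cpsi subw supz wz bd.
rewrite lt_neqAle; have B0 : B (t0, x0).
  by have r0 := rho0; apply/boxP; split; rewrite ?subrr ?normr0 ?(ltW r0).
rewrite wz // andbT; apply/eqP => wz0.
have rho00 : 0 <= rho by exact: ltW.
have sub (W : topologicalType) (F : V -> W) : {within @dom R k T, continuous F} ->
    {within B, continuous F} by exact: (continuous_subspaceW box_sub_dom).
pose proj := box_proj lo hi rho x0.
have projB p : B (proj p) by exact: box_proj_in.
have projid t x : B (t, x) -> proj (t, x) = (t, x) by exact: box_proj_id.
pose beta p := b (proj p).1 (proj p).2.
pose sig p := sigma (proj p).1 (proj p).2.
pose F p : R := (w p.1 p.2 + z p.1 p.2) / 2.
have cF : {within B, continuous F}.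
  move=> p; apply: cvgM; last exact: cvg_cst.
  by apply: cvgD; [exact: (sub _ _ cw)|exact: (sub _ _ cz)].
pose Q (p : V) : R := psi p.1 p.2.
have cQ : {within B, continuous Q} by exact: sub.
have betau := @box_extension_uniform R k lo hi rho x0 lohi rho00 _ _ (sub _ _ hb).
have [Mb betaM] := @box_extension_bounded R k lo hi rho x0 lohi rho00 _ _ (sub _ _ hb).
have sigu := @box_extension_uniform R k lo hi rho x0 lohi rho00 _ _ (sub _ _ hsig).
have [Ms sigM] := @box_extension_bounded R k lo hi rho x0 lohi rho00 _ _ (sub _ _ hsig).
have uf : ucont (fun p => F (proj p)) by exact: (@box_extension_uniform R k lo hi rho x0 lohi rho00 _ _ cF).
have [cf fcf] := @box_extension_bounded R k lo hi rho x0 lohi rho00 _ _ cF.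
have uq : ucont (fun p => Q (proj p)) by exact: (@box_extension_uniform R k lo hi rho x0 lohi rho00 _ _ cQ).
have [cq qcq] := @box_extension_bounded R k lo hi rho x0 lohi rho00 _ _ cQ.
pose M := Num.max Mb Ms.
have entry (A : 'M[R]_(k, d)) (i : 'I_k) (j : 'I_d) : `|A i j| <= `|A|.
  by rewrite [leRHS]mx_normrE; exact: (le_bigmax _ (fun ij => `|A ij.1 ij.2|) (i, j)).
have scolE j p q : `|scol sig j p - scol sig j q| <= `|sig p - sig q|.
  apply/row_norm_le => // i; have := entry (sig p - sig q) i j.
  by rewrite !mxE.
have betaM' p : `|beta p| <= M by apply: (le_trans (betaM p)); rewrite le_max lexx.
have sigM' j p : `|scol sig j p| <= M.
  have s0 := sigM p; apply: (@le_trans _ _ Ms); last by rewrite le_max lexx orbT.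
  apply/row_norm_le; first exact: le_trans (normr_ge0 _) s0.
  by move=> i; rewrite mxE; apply: le_trans s0; exact: entry.
have sigu' j (eta : R) : 0 < eta -> exists2 r : R, 0 < r &
    forall p q : V, `|p - q| < r -> `|scol sig j p - scol sig j q| <= eta.
  move=> /sigu[r r0 H]; exists r => // p q pq.
  by apply: le_trans (scolE j p q) _; exact: H.
have L0 : 0 <= 2 * C ^+ 2 by rewrite mulr_ge0 // sqr_ge0.
have lip' t x x' : sqnorm (beta (t, x) - beta (t, x')) +
    \sum_j sqnorm (scol sig j (t, x) - scol sig j (t, x')) <= 2 * C ^+ 2 * sqnorm (x - x').
  pose s := (proj (t, x)).1; pose y := (proj (t, x)).2; pose y' := (proj (t, x')).2.
  have sT : 0 <= s <= T by have := box_sub_dom (projB (t, x)).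
  have e1 : sqnorm (y - y') <= sqnorm (x - x').
    apply: ler_sum => i _.
    rewrite -(real_normK (num_real ((y - y') _ _))) -(real_normK (num_real ((x - x') _ _))).
    apply: lerXn2r; rewrite ?nnegrE // [in leLHS]mxE [X in _ + X]mxE [in leRHS]mxE [X in _ <= `|_ + X|]mxE.
    exact: (box_proj_coord_dist lo hi x0 rho00 (t, x) (t, x') i).
  have l := lip y y' sT.
  have f0 : 0 <= fnorm (sigma s y - sigma s y') by exact: sqrtr_ge0.
  have g0 : 0 <= enorm (b s y - b s y') by exact: sqrtr_ge0.
  have -> : sqnorm (beta (t, x) - beta (t, x')) = enorm (b s y - b s y') ^+ 2 by rewrite enorm_sqr.
  have -> : \sum_j sqnorm (scol sig j (t, x) - scol sig j (t, x')) = fnorm (sigma s y - sigma s y') ^+ 2.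
    by rewrite fnorm_sqr; apply: eq_bigr => j _; congr sqnorm; apply/rowP => i; rewrite !mxE.
  have : (fnorm (sigma s y - sigma s y') + enorm (b s y - b s y')) ^+ 2 <= (C * enorm (y - y')) ^+ 2.
    by apply: lerXn2r; rewrite ?nnegrE ?addr_ge0 //; apply: le_trans l; exact: addr_ge0.
  rewrite exprMn (enorm_sqr (y - y')).
  have : C ^+ 2 * sqnorm (y - y') <= C ^+ 2 * sqnorm (x - x') by apply: ler_wpM2l => //; exact: sqr_ge0.
  have := sqnorm_ge0 (x - x'); have := mulr_ge0 f0 g0; have := sqr_ge0 C.
  move: (fnorm _) (enorm _) => u1 u2.
  move=> c2 fg xx; have := mulr_ge0 c2 xx; lra.
have gap4 : 0 < gap / 4 by lra.
have [N0 N00 H] := smooth_approximation betaM' sigM' betau sigu' L0 lip' uf uq fcf qcq gap4.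
(* The second summand makes [kap / N <= gap / 4], so that [z - kap / N] still lies above [- U2] on
   the boundary. *)
pose N := N0 + 4 * kap / gap.
have kg : 0 < 4 * kap / gap by rewrite divr_gt0 // mulr_gt0.
have Npos : 0 < N by rewrite /N; lra.
have kapN : kap / N <= gap / 4.
  rewrite ler_pdivrMr //.
  have : gap * (4 * kap / gap) = 4 * kap by rewrite mulrC divfK // gt_eqF.
  have := mulr_gt0 gap0 N00; rewrite /N; nra.
have N3 : 0 < N + 3 by lra.
(* Adding the two touching bounds at the centre would give [kap <= (N + 2) * eta], which this value
   excludes. *)
pose eta := kap / (N + 3).
have eta0 : 0 < eta by rewrite divr_gt0.
have etaE : eta * (N + 3) = kap by rewrite /eta divfK // gt_eqF.
have etak : eta <= kap by nra.
have NN0 : N0 <= N by rewrite /N; lra.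
have [U1 [U2 [[c1 c2] h1 h2 [f1 f2] u12]]] := H N NN0 eta eta0.
have gE phi t x : B (t, x) -> genA (fun t x => beta (t, x)) (fun t x => sig (t, x)) phi t x =
    genA b sigma phi t x.
  by move=> Btx; apply: genA_eq; rewrite /beta /sig projid.
have FE t x : B (t, x) -> F (proj (t, x)) = (w t x + z t x) / 2 by move=> Btx; rewrite projid.
have QE t x : B (t, x) -> Q (proj (t, x)) = psi t x by move=> Btx; rewrite projid.
have k1 : w t0 x0 + (0 - eta) / N <= U1 t0 x0.
  apply: (@touching_bound w (fun t x => F (proj (t, x))) psi U1 N eta 0) => //.
  - exact: sub.
  - by move=> t x Btx; have := h1 t x; rewrite gE // QE.
  - by move=> t x phi; rewrite oppr0; exact: subw.
  - by move=> t x Btx; rewrite FE //; have := wz t x Btx; lra.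
  - move=> t x Btx tx; have := f1 t x; rewrite FE //; have := bd t x Btx tx.
    have : (0 - eta) / N <= 0 by rewrite ler_pdivrMr // mul0r; lra.
    lra.
have k2 : - z t0 x0 + (kap - eta) / N <= U2 t0 x0.
  apply: (@touching_bound (fun t x => - z t x) (fun t x => - F (proj (t, x))) (fun t x => - psi t x) U2 N eta kap) => //.
  - by move=> p; apply: cvgN; exact: (sub _ _ cz).
  - by move=> t x Btx; have := h2 t x; rewrite gE // QE // opprK.
  - move=> t x phi Btx tr xr cphi lm.
    have [cN dN gN] := C12_affine (-1) 0 cphi.
    have lm' : locmax T (fun t x => (-1 * phi t x + 0) - z t x) t x.
      case: lm => e e0 lm; exists e => // s y sT ts yx.
      by have := lm s y sT ts yx; rewrite !mulN1r !addr0; lra.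
    have := supz t x _ Btx tr xr cN lm'; rewrite dN gN.
    move: (dt phi t x) (genA b sigma phi t x) => u1 u2; lra.
  - by move=> t x Btx; rewrite FE //; have := wz t x Btx; lra.
  - move=> t x Btx tx; have := f2 t x; rewrite FE //; have := bd t x Btx tx.
    have : (kap - eta) / N <= kap / N by rewrite ler_pdivrMr // divfK ?gt_eqF //; lra.
    lra.
have := u12 t0 x0; move: k1 k2; rewrite wz0.
have : (kap - eta) / N + (0 - eta) / N > eta.
  by rewrite -mulrDl ltr_pdivlMr //; lra.
lra.
Qed.
End LocalComparison.

(** * Comparison for the switching system *)

Section Growth.
Variables (R : realType) (k : nat) (T : R).
Local Notation V := (R * 'rV[R]_k)%type.
Implicit Types (f : R -> 'rV[R]_k -> R) (t : R) (x : 'rV[R]_k).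

(** The real exponent [p] may be negative, and the bound is then weak near the origin; so
    compactness is used on the unit ball and the growth bound outside it. Natural powers of
    [1 + sqnorm x] are smooth and at least 1. *)
Lemma polyGrowth_sqnorm f : polyGrowth T f -> exists (C : R) (P : nat), 0 <= C /\
  forall t x, 0 <= t <= T -> `|f t x| <= C * (1 + sqnorm x) ^+ P.
Proof.
move=> [cf [C [p H]]].
have [M HM] : exists M : R, forall q, box 0 T 1 0 q -> `|f q.1 q.2| <= M.
  apply: (@compact_norm_bounded R _ _ (box 0 T 1 0) (fun q : V => f q.1 q.2)).
    by apply: compact_box.
  by apply: continuous_subspaceW cf => -[t x] [].
pose P := Num.bound `|p|.
exists (2 * `|C| + `|M|), P; split; first by rewrite addr_ge0 ?mulr_ge0.
move=> t x tT; set Y := (1 + sqnorm x) ^+ P.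
have Y1 : 1 <= Y by rewrite exprn_ege1 // lerDl sqnorm_ge0.
have C0 := normr_ge0 C; have M0 := normr_ge0 M.
have [x1|x1] := leP 1 (enorm x).
  have xP : enorm x `^ p <= Y.
    apply: (@le_trans _ _ (enorm x `^ (2 * P)%:R)).
      apply: ler_powR => //; apply: le_trans (ler_norm p) _.
      apply: le_trans (ltW (archi_boundP (normr_ge0 p))) _.
      by rewrite ler_nat leq_pmull.
    rewrite powR_mulrn ?sqrtr_ge0 // exprM enorm_sqr.
    by apply: lerXn2r; rewrite ?nnegrE ?addr_ge0 ?sqnorm_ge0 // lerDr.
  apply: (le_trans (H t x tT)).
  have p0 : 0 <= enorm x `^ p by exact: powR_ge0.
  have : C * (1 + enorm x `^ p) <= `|C| * (Y + Y).
    apply: le_trans (ler_wpM2r _ (ler_norm C)) _; first lra.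
    by apply: ler_wpM2l => //; lra.
  nra.
have : `|f t x| <= M.
  apply: (HM (t, x)); split => //=; rewrite subr0.
  exact: le_trans (norm_le_enorm x) (ltW x1).
have := ler_norm M; nra.
Qed.

Lemma polyGrowth_family (m : nat) (v : 'I_m -> R -> 'rV[R]_k -> R) :
  (forall i, polyGrowth T (v i)) -> exists (C : R) (P : nat), 0 <= C /\
  forall i t x, 0 <= t <= T -> `|v i t x| <= C * (1 + sqnorm x) ^+ P.
Proof.
move=> hv.
have /choice[f fP] : forall i, exists CP : R * nat, 0 <= CP.1 /\
    forall t x, 0 <= t <= T -> `|v i t x| <= CP.1 * (1 + sqnorm x) ^+ CP.2.
  by move=> i; have [C [P ?]] := polyGrowth_sqnorm (hv i); exists (C, P).
exists (\sum_i (f i).1), (\sum_i (f i).2)%N; split.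
  by apply: sumr_ge0 => i _; have [] := fP i.
move=> i t x tT; have [f0 /(_ t x tT) H] := fP i; apply: (le_trans H).
apply: ler_pM => //; first by rewrite exprn_ge0 // addr_ge0 // sqnorm_ge0.
  rewrite (bigD1 i) //= lerDl; apply: sumr_ge0 => j _; by have [] := fP j.
apply: ler_weXn2l; first by rewrite lerDl sqnorm_ge0.
by rewrite (bigD1 i) //= leq_addr.
Qed.

Variables (d : nat) (b : R -> 'rV[R]_k -> 'rV[R]_k) (sigma : R -> 'rV[R]_k -> 'M[R]_(k, d)).
Variable C : R.
Hypothesis lin_growth : forall t x, 0 <= t <= T ->
  fnorm (sigma t x) + enorm (b t x) <= C * (1 + enorm x).

Lemma fnorm_entry (A : 'M[R]_(k, d)) i j : `|A i j| <= fnorm A.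
Proof.
have -> : `|A i j| = Num.sqrt (A i j ^+ 2) by rewrite sqrtr_sqr.
apply: ler_wsqrtr; rewrite (bigD1 i) //= (bigD1 j) //= -addrA lerDl addr_ge0 //.
  by apply: sumr_ge0 => l _; exact: sqr_ge0.
by do 2 (apply: sumr_ge0 => ? _); exact: sqr_ge0.
Qed.

Definition penalty (lam : R) (Q : nat) := radial (fun t => expR (lam * (T - t))) (0 : 'rV[R]_k) Q.

Lemma penalty_ge lam Q t x : 0 <= lam -> t <= T -> (1 + sqnorm x) ^+ Q <= penalty lam Q t x.
Proof.
move=> l0 tT; rewrite /penalty /radial subr0 ler_peMl //.
  by rewrite exprn_ge0 // addr_ge0 // sqnorm_ge0.
by rewrite -expR0 ler_expR mulr_ge0 // subr_ge0.
Qed.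

(** Linear growth of the coefficients bounds the generator on [(1 + sqnorm x) ^+ Q] by [Lam] times
    that same power, and the time derivative of the exponential of rate [Lam + 1] exceeds this with
    1 to spare. The exponent [P.+2] is above the growth [P] of the solutions and keeps [Q.-2] a true
    subtraction. *)
Lemma penalty_supersolution P : exists2 lam : R, 0 <= lam &
  C12 (penalty lam P.+2) /\ forall t x, 0 <= t <= T ->
    1 <= - dt (penalty lam P.+2) t x - genA b sigma (penalty lam P.+2) t x.
Proof.
pose Q := P.+2; pose q : R := Q%:R; pose q' : R := Q.-1%:R.
pose D := 4 * (q * q') + 2 * q.
pose c := `|C|.
pose Lam := k%:R ^+ 2 * d%:R * (2 * c ^+ 2 * D) + k%:R * (4 * c * q).
have [q0 q'0 c0] : [/\ 0 <= q, 0 <= q' & 0 <= c] by split => //; exact: normr_ge0.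
have D0 : 0 <= D by rewrite /D addr_ge0 ?mulr_ge0.
have k0 : 0 <= k%:R :> R by [].
have d0 : 0 <= d%:R :> R by [].
have Lam0 : 0 <= Lam by rewrite /Lam addr_ge0 ?mulr_ge0 ?sqr_ge0.
exists (Lam + 1); first by lra.
pose E t := expR ((Lam + 1) * (T - t)).
have dE t : is_derive t 1 E (- (Lam + 1) * E t).
  have d1 : is_derive t 1 (fun t : R => (Lam + 1) * (T - t)) (- (Lam + 1)).
    apply: is_derive_eq; rewrite /GRing.scale /=; ring.
  have := @is_derive1_comp _ expR (fun t : R => (Lam + 1) * (T - t)) t _ _ (is_derive_expR _) d1.
  move=> h; apply: (is_derive_eq h); by rewrite mulrC.
have cE : continuous E.
  by move=> t; apply: differentiable_continuous; apply/derivable1_diffP; exact: (@ex_derive _ _ _ _ _ _ _ (dE t)).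
have cE' : continuous (fun t => - (Lam + 1) * E t).
  by move=> t; apply: cvgM; [exact: cvg_cst|exact: cE].
have [c12 Edt Edx Edxx] := @C12_radial R k E (fun t => - (Lam + 1) * E t) 0 Q dE cE'.
split=> // t x tT; rewrite /penalty -/E -/Q.
have Et : 1 <= E t.
  rewrite /E -expR0 ler_expR; apply: mulr_ge0; first by rewrite addr_ge0.
  by rewrite subr_ge0; case/andP: tT.
set Y := 1 + sqnorm x.
have X0 := sqnorm_ge0 x.
have Y1 : 1 <= Y by rewrite lerDl.
have Y0 : 0 <= Y by lra.
have e0 : 0 <= enorm x by exact: sqrtr_ge0.
have eX : enorm x ^+ 2 = sqnorm x by exact: enorm_sqr.
have eY : (1 + enorm x) ^+ 2 <= 2 * Y.
  by rewrite /Y -eX; have := sqr_ge0 (1 - enorm x); lra.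
have xe i : `|x ord0 i| <= enorm x := le_trans (abs_coord_le x i) (norm_le_enorm x).
have lg := lin_growth x tT.
have Cm : C * (1 + enorm x) <= c * (1 + enorm x).
  by apply: ler_wpM2r; [rewrite addr_ge0|exact: ler_norm].
have fs0 : 0 <= fnorm (sigma t x) by exact: sqrtr_ge0.
have eb0 : 0 <= enorm (b t x) by exact: sqrtr_ge0.
have bM i : `|b t x ord0 i| <= c * (1 + enorm x).
  apply: le_trans (abs_coord_le _ _) _; apply: le_trans (norm_le_enorm _) _.
  by apply: le_trans Cm; apply: le_trans lg; rewrite lerDr.
have sM i j : `|sigma t x i j| <= c * (1 + enorm x).
  apply: le_trans (fnorm_entry _ _ _) _.
  by apply: le_trans Cm; apply: le_trans lg; rewrite lerDl.
pose EY := E t * Y ^+ Q.-1.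
have EY0 : 0 <= EY by rewrite mulr_ge0 ?exprn_ge0 //; lra.
have hdx i : `|dx i (radial E 0 Q) t x| <= EY * (q * (2 * enorm x)).
  rewrite Edx /dradial mxE !subr0 -/Y -/q.
  have -> : E t * (q * Y ^+ Q.-1 * (2 * x ord0 i)) = EY * (q * (2 * x ord0 i)) by rewrite /EY; ring.
  rewrite normrM (ger0_norm EY0); apply: ler_wpM2l => //.
  rewrite normrM (ger0_norm q0); apply: ler_wpM2l => //.
  by rewrite normrM (@ger0_norm _ 2) //; apply: ler_wpM2l.
have hdxx i j : `|dxx i j (radial E 0 Q) t x| <= EY * D.
  rewrite Edxx /ddradial !mxE !subr0 -/Y -/q -/q'.
  have -> : E t * (q * q' * Y ^+ Q.-2 * (2 * x ord0 i) * (2 * x ord0 j) + q * Y ^+ Q.-1 * (2 * (i == j)%:R))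
    = E t * Y ^+ Q.-2 * (4 * (q * q') * (x ord0 i * x ord0 j)) + EY * (2 * q * (i == j)%:R).
    by rewrite /EY; ring.
  apply: (le_trans (ler_normD _ _)); rewrite /D [leRHS]mulrDr; apply: lerD.
    have -> : EY * (4 * (q * q')) = E t * Y ^+ Q.-2 * (4 * (q * q') * Y).
      by rewrite /EY /Q /= exprS; ring.
    have a0 : 0 <= E t * Y ^+ Q.-2 by rewrite mulr_ge0 ?exprn_ge0 //; lra.
    have b0 : 0 <= 4 * (q * q') by rewrite !mulr_ge0.
    rewrite normrM (ger0_norm a0); apply: ler_wpM2l => //.
    rewrite normrM (ger0_norm b0); apply: ler_wpM2l => //.
    rewrite normrM; apply: (@le_trans _ _ (enorm x * enorm x)); first exact: ler_pM.
    by rewrite -expr2 eX /Y lerDr.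
  rewrite normrM (ger0_norm EY0); apply: ler_wpM2l => //.
  rewrite normrM (@ger0_norm _ (2 * q)) ?mulr_ge0 // ler_piMr ?mulr_ge0 //.
  by case: (i == j); rewrite ?normr1 ?normr0.
have gA := genA_abs_le bM sM hdx hdxx.
have gB : genA b sigma (radial E 0 Q) t x <= Lam * (E t * Y ^+ Q).
  apply: le_trans (ler_norm _) _; apply: le_trans gA _.
  have -> : E t * Y ^+ Q = EY * Y by rewrite /EY /Q /= exprSr; ring.
  have l1 : (c * (1 + enorm x)) ^+ 2 * (EY * D) <= 2 * c ^+ 2 * D * (EY * Y).
    rewrite exprMn.
    have -> : c ^+ 2 * (1 + enorm x) ^+ 2 * (EY * D) = c ^+ 2 * EY * D * (1 + enorm x) ^+ 2 by ring.
    have -> : 2 * c ^+ 2 * D * (EY * Y) = c ^+ 2 * EY * D * (2 * Y) by ring.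
    apply: ler_wpM2l => //; do 2 (apply: mulr_ge0 => //); exact: sqr_ge0.
  have l2 : c * (1 + enorm x) * (EY * (q * (2 * enorm x))) <= 4 * c * q * (EY * Y).
    have -> : c * (1 + enorm x) * (EY * (q * (2 * enorm x))) = 2 * c * q * EY * ((1 + enorm x) * enorm x) by ring.
    have -> : 4 * c * q * (EY * Y) = 2 * c * q * EY * (2 * Y) by ring.
    apply: ler_wpM2l; first by do 3 (apply: mulr_ge0 => //).
    apply: le_trans eY; rewrite expr2; apply: ler_wpM2l; first by rewrite addr_ge0.
    by rewrite lerDr.
  rewrite /Lam [leRHS]mulrDl; apply: lerD.
    by rewrite -[leRHS]mulrA; apply: ler_wpM2l => //; rewrite mulr_ge0 ?sqr_ge0.
  by rewrite -[leRHS]mulrA; apply: ler_wpM2l.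
rewrite Edt [radial _ _ _ _ _]/radial subr0 -/Y.
have EYQ : 1 <= E t * Y ^+ Q.
  by rewrite -[1]mulr1 ler_pM // exprn_ege1.
move: gB; move: (genA _ _ _ _ _) => u gB; lra.
Qed.
End Growth.

(** * Obstacles and switching loops *)

Section Switching.
Variables (R : realType) (k d m : nat) (T : R).
Local Notation V := (R * 'rV[R]_k)%type.
Variables (b : R -> 'rV[R]_k -> 'rV[R]_k) (sigma : R -> 'rV[R]_k -> 'M[R]_(k, d)).
Variables (psi : 'I_m -> R -> 'rV[R]_k -> R) (g : 'I_m -> 'I_m -> R -> 'rV[R]_k -> R).
Implicit Types (v w : 'I_m -> R -> 'rV[R]_k -> R) (phi : R -> 'rV[R]_k -> R) (t : R) (x : 'rV[R]_k).

Lemma hjb_ge0 v i phi t x : (0 <= hjb b sigma psi g v i phi t x)%E ->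
  (forall j, j != i -> v j t x - g i j t x <= v i t x) /\
  0 <= - dt phi t x - genA b sigma phi t x - psi i t x.
Proof.
rewrite /hjb le_min lee_fin => /andP[ob pde]; split=> // j ji.
move: ob; rewrite /obst sube_ge0; last by apply/orP; right.
move=> /bigmax_leP[_ /(_ j ji)].
by rewrite lee_fin addrC.
Qed.

Lemma hjb_le0 v i phi t x : (hjb b sigma psi g v i phi t x <= 0)%E ->
  (forall j, j != i -> v j t x - g i j t x < v i t x) ->
  - dt phi t x - genA b sigma phi t x - psi i t x <= 0.
Proof.
move=> H ob; move: H; rewrite /hjb ge_min lee_fin => /orP[|//].
rewrite leNgt /obst sube_gt0 => /negP[]; apply/bigmax_ltP; split; first exact: ltNyr.
by move=> j ji; rewrite lte_fin addrC ob.
Qed.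

Hypothesis gc : forall i j, contOn T (g i j).

Lemma within_box_cont (f : R -> 'rV[R]_k -> R) t0 x0 (eta : R) : contOn T f -> 0 <= t0 <= T -> 0 < eta ->
  exists2 rho : R, 0 < rho & forall t x, 0 <= t <= T -> `|t - t0| < rho -> `|x - x0| < rho ->
    `|f t x - f t0 x0| <= eta.
Proof.
move=> cf t0T eta0.
have [rho rho0 H] := @within_continuous_dist R _ _ _ _ cf (t0, x0) t0T eta eta0.
exists rho => // t x tT tr xr; rewrite distrC; apply: (H (t, x)) => //.
by rewrite prod_normE gt_max /= (distrC t0) tr (distrC x0).
Qed.

(** The squared space-time distance plus 1, assembled from [radial] so that its derivatives are
    known; later uses subtract the 1. *)
Definition qdist t0 x0 : R -> 'rV[R]_k -> R :=
  flin 1 (radial (fun t => (t - t0) ^+ 2) x0 0) (radial (fun _ => 1) x0 1).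

Lemma qdistE t0 x0 t x : qdist t0 x0 t x = (t - t0) ^+ 2 + sqnorm (x - x0) + 1.
Proof. by rewrite /qdist /flin /radial expr0 expr1; ring. Qed.

Lemma C12_qdist t0 x0 : C12 (qdist t0 x0) /\ forall t x (M : R), `|t - t0| <= 1 -> `|x - x0| <= 1 ->
  (forall i, `|b t x ord0 i| <= M) -> (forall i j, `|sigma t x i j| <= M) ->
  `|dt (qdist t0 x0) t x + genA b sigma (qdist t0 x0) t x| <=
    2 + (k%:R ^+ 2 * d%:R * (M ^+ 2 * 2) + k%:R * (M * 2)).
Proof.
have d1 t : is_derive t 1 (fun t : R => (t - t0) ^+ 2) (2 * (t - t0)).
  have -> : (fun t : R => (t - t0) ^+ 2) = fun t => (t - t0) * (t - t0).
    by apply/funext => s; rewrite expr2.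
  apply: is_derive_eq; rewrite /GRing.scale /=; ring.
have c1 : continuous (fun t : R => 2 * (t - t0)).
  by move=> t; apply: cvgM; [exact: cvg_cst|apply: cvgB; [exact: cvg_id|exact: cvg_cst]].
have d2 (t : R) : is_derive t 1 (fun _ : R => 1 : R) 0 by apply: is_derive_cst.
have [A1 A2 A3 A4] := @C12_radial R k _ _ x0 0 d1 c1.
have [B1 B2 B3 B4] := @C12_radial R k _ _ x0 1 d2 (fun=> cvg_cst _).
have [C1 C2 C3 C4] := C12_lin 1 A1 B1.
split; first exact: C1.
move=> t x M tt xx bM sM; apply: (le_trans (ler_normD _ _)); apply: lerD.
  rewrite /qdist C2 A2 B2 /flin /radial expr0 mul0r addr0 mul1r mulr1 normrM ger0_norm //.
  by lra.
have xi i : `|x ord0 i - x0 ord0 i| <= 1.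
  by have := abs_coord_le (x - x0) i; rewrite !mxE => h; exact: le_trans h xx.
apply: genA_abs_le => // [i|i j].
  have -> : dx i (qdist t0 x0) t x = 2 * (x ord0 i - x0 ord0 i).
    by rewrite /qdist C3 A3 B3 /flin /dradial /=; ring.
  by rewrite normrM ger0_norm //; have := xi i; lra.
have -> : dxx i j (qdist t0 x0) t x = 2 * (i == j)%:R.
  by rewrite /qdist C4 A4 B4 /flin /ddradial /=; ring.
by case: (i == j); rewrite ?mulr1 ?mulr0 ?normr0 ?ger0_norm.
Qed.

(* The points at which [v i] is touched from below by a paraboloid are dense. *)
Lemma supersolution_obstacle v : visc_super T b sigma psi g v ->
  forall i j t0 x0, 0 <= t0 < T -> j != i -> v j t0 x0 - g i j t0 x0 <= v i t0 x0.
Proof.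
move=> [cv [vT sv]] i j t0 x0 /andP[t00 t0T] ji; rewrite leNgt; apply/negP => lt0.
pose f t x := v j t x - g i j t x - v i t x.
have cf : contOn T f.
  by move=> p; apply: cvgB; [apply: cvgB; [exact: cv|exact: gc]|exact: cv].
have f0 : 0 < f t0 x0 / 2 by rewrite /f; lra.
have t0T' : 0 <= t0 <= T by rewrite t00 ltW.
have [r r0 H] := within_box_cont x0 cf t0T' f0.
pose rho := Num.min (r / 2) ((T - t0) / 2).
have rho0 : 0 < rho by rewrite lt_min; apply/andP; lra.
have [rr rT] : rho <= r / 2 /\ rho <= (T - t0) / 2 by rewrite /rho !ge_min !lexx orbT.
have hi : t0 + rho < T by lra.
set B := box (Num.max 0 (t0 - rho)) (t0 + rho) rho x0.
have BP t x : B (t, x) <-> [/\ 0 <= t, `|t - t0| <= rho & `|x - x0| <= rho].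
  exact: boxP.
have Bd : B `<=` @dom R k T by exact: (box_sub_dom hi).
have cB : compact B by apply: compact_box; exact: ltW.
have B0 : B (t0, x0) by apply/BP; rewrite !subrr !normr0 (ltW rho0).
have cvB : {within B, continuous (fun p : V => v i p.1 p.2)}.
  exact: (continuous_subspaceW Bd (cv i)).
have [M HM] := compact_norm_bounded cB cvB.
have M0 : 0 <= M := le_trans (normr_ge0 _) (HM _ B0).
(* Then [K * rho ^+ 2] exceeds the oscillation [2 * M] of [v i] on the box, which forces the minimum
   of [v i + K * qdist] into the interior. *)
pose K := 2 * (M + 1) / rho ^+ 2.
have rho2 : 0 < rho ^+ 2 by rewrite exprn_gt0.
have K0 : 0 < K by rewrite divr_gt0 //; lra.
have Krho : K * rho ^+ 2 = 2 * (M + 1) by rewrite /K divfK // gt_eqF.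
have [cq _] := C12_qdist t0 x0.
have cqB : {within B, continuous (fun p : V => v i p.1 p.2 + K * qdist t0 x0 p.1 p.2)}.
  move=> p; apply: cvgD; first exact: cvB.
  apply: cvgM; first exact: cvg_cst.
  apply: (continuous_subspaceT (f := fun p : V => qdist t0 x0 p.1 p.2)).
  by case: cq => _ _ _ [].
have Bne : B !=set0 by exists (t0, x0).
have [[t1 x1] /set_mem B1 Hmin] := compact_EVT_min Bne cB cqB.
have Hmin' t x : B (t, x) -> v i t1 x1 + K * qdist t0 x0 t1 x1 <= v i t x + K * qdist t0 x0 t x.
  by move=> Btx; apply: (Hmin (t, x)); rewrite inE.
have [a1 a2 a3] := (BP t1 x1).1 B1.
have q1 : K * ((t1 - t0) ^+ 2 + sqnorm (x1 - x0)) < K * rho ^+ 2.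
  have := Hmin' t0 x0 B0; rewrite !qdistE !subrr expr0n /=.
  have -> : sqnorm (0 : 'rV[R]_k) = 0 by apply: big1 => l _; rewrite mxE expr0n.
  have := HM _ B0; have := HM _ B1; rewrite !ler_norml Krho /=; lra.
rewrite ltr_pM2l // in q1.
have l1 : `|t1 - t0| < rho.
  rewrite -(@ltr_pXn2r _ 2) ?nnegrE ?(ltW rho0) // real_normK ?num_real //.
  by apply: le_lt_trans q1; rewrite lerDl sqnorm_ge0.
have l2 : `|x1 - x0| < rho.
  rewrite -(@ltr_pXn2r _ 2) ?nnegrE ?(ltW rho0) //.
  by apply: le_lt_trans (norm_sqr_le _) _; apply: le_lt_trans q1; rewrite lerDr sqr_ge0.
have [c12 _ _] := C12_affine b sigma (- K) (v i t1 x1 + K * qdist t0 x0 t1 x1) cq.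
have t1T : 0 <= t1 < T by rewrite a1 /=; move: a2; rewrite ler_norml; lra.
have := sv i t1 x1 _ t1T c12; move=> /(_ ltac:(ring)).
case/(_ _)/hjb_ge0.
  apply: (interior_locmax T B1 l1 l2) => t x Btx.
  by have := Hmin' t x Btx; lra.
move=> /(_ j ji) ob _.
have t1T' : 0 <= t1 <= T by case/andP: t1T => -> /ltW ->.
have rr' : rho < r by lra.
have := H t1 x1 t1T' (lt_trans l1 rr') (lt_trans l2 rr'); rewrite ler_norml /f.
by lra.
Qed.

Hypothesis gloop : forall (n : nat) (s : 'I_n -> 'I_m) t x, 0 <= t <= T ->
  (2 <= n)%N -> injective s -> 0 < \sum_(l < n) g (s l) (s (ordS l)) t x.

(* Following the indices at which the obstacle is attained eventually closes a
   loop, along which the costs telescope to zero. *)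
Lemma no_obstacle_loop (c : 'I_m -> R) (P : pred 'I_m) i0 t x : 0 <= t <= T -> P i0 ->
  (forall i, P i -> exists2 j, P j & j != i /\ g i j t x = c j - c i) -> False.
Proof.
move=> tT Pi0 H.
have /choice[nxt nxtP] : forall i, exists j, P i -> [/\ P j, j != i & g i j t x = c j - c i].
  move=> i; case: (boolP (P i)) => Pi; last by exists i.
  by have [j Pj [ji gj]] := H i Pi; exists j.
have Pit a y : P y -> P (iter a nxt y).
  by move=> Py; elim: a => //= a IH; have [] := nxtP _ IH.
have [y Py [n0 n00 yn0]] : exists2 y, P y & exists2 n, (0 < n)%N & iter n nxt y = y.
  have : ~~ injectiveb (fun a : 'I_m.+1 => iter a nxt i0).
    apply/negP => /injectiveP /leq_card; rewrite !card_ord; lia.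
  move/injectivePn => [a [a' aa' E]].
  wlog lt_aa' : a a' aa' E / (a < a')%N.
    move=> W; have [l|l|l] := ltngtP a a'; first exact: (W a a').
      by apply: (W a' a) => //; rewrite eq_sym.
    by move/eqP: aa' => []; exact: val_inj.
  exists (iter a nxt i0); first exact: Pit.
  exists (a' - a)%N; first by rewrite subn_gt0.
  by rewrite -iterD subnK ?(ltnW lt_aa') // -E.
(* The least period makes the visited indices distinct, as [gloop] demands. *)
have ex : exists n, (0 < n)%N && (iter n nxt y == y).
  by exists n0; rewrite n00 yn0 eqxx.
case: (ex_minnP ex) => n /andP[n1 /eqP yn] nmin.
pose s (l : 'I_n) := iter l nxt y.
have sinj : injective s.
  move=> l l' E; apply/eqP; apply: contraT => ll'; exfalso.
  wlog lt_ll' : l l' E ll' / (l < l')%N.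
    move=> W; have [h|h|h] := ltngtP l l'; first exact: (W l l').
      by apply: (W l' l) => //; rewrite eq_sym.
    by move/eqP: ll' => []; exact: val_inj.
  have := nmin (n - l' + l)%N.
  have -> : iter (n - l' + l) nxt y == y.
    rewrite iterD; have -> : iter l nxt y = iter l' nxt y by exact: E.
    by rewrite -iterD subnK ?yn // ltnW.
  by have := ltn_ord l'; lia.
have n2 : (2 <= n)%N.
  case: (ltngtP n 1) => [||e] //; first by case: (n) n1.
  have [_ /negP[]] := nxtP y Py; rewrite -[X in _ == X]yn e //=.
have := gloop x tT n2 sinj.
have sS l : s (ordS l) = nxt (s l).
  rewrite /s /=; have [e|e] := eqVneq l.+1 n.
    have yl : iter l.+1 nxt y = y by rewrite e yn.
    have -> : (l.+1 %% n = 0)%N by rewrite e modnn.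
    by rewrite -[LHS]/y -[LHS]yl.
  by rewrite modn_small // ltn_neqAle e ltn_ord.
rewrite (eq_bigr (fun l => c (s (ordS l)) - c (s l))); last first.
  by move=> l _; rewrite sS; have [] := nxtP (s l) (Pit _ _ Py).
rewrite sumrB -(reindex (@ordS n) (P := predT) (F := fun l => c (s l))) ?subrr ?ltxx //.
exact: onW_bij (ordS_bij n).
Qed.
End Switching.

(** * Penalized maximum and comparison principle *)

Section Comparison.
Variables (R : realType) (k d m : nat) (T : R).
Local Notation V := (R * 'rV[R]_k)%type.
Variables (b : R -> 'rV[R]_k -> 'rV[R]_k) (sigma : R -> 'rV[R]_k -> 'M[R]_(k, d)).
Variables (psi : 'I_m -> R -> 'rV[R]_k -> R) (g : 'I_m -> 'I_m -> R -> 'rV[R]_k -> R).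
Hypothesis hT : 0 < T.
Hypothesis hb : {within @dom R k T, continuous (fun p : V => b p.1 p.2)}.
Hypothesis hsig : {within @dom R k T, continuous (fun p : V => sigma p.1 p.2)}.
Variable C : R.
Hypothesis lin_growth : forall t x, 0 <= t <= T ->
  fnorm (sigma t x) + enorm (b t x) <= C * (1 + enorm x).
Hypothesis lip : forall t x x', 0 <= t <= T ->
  fnorm (sigma t x - sigma t x') + enorm (b t x - b t x') <= C * enorm (x - x').
Hypothesis psic : forall i, contOn T (psi i).
Hypothesis gc : forall i j, contOn T (g i j).
Hypothesis gloop : forall (n : nat) (s : 'I_n -> 'I_m) t x, 0 <= t <= T ->
  (2 <= n)%N -> injective s -> 0 < \sum_(l < n) g (s l) (s (ordS l)) t x.
Variables (v w : 'I_m -> R -> 'rV[R]_k -> R).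
Hypotheses (vC : forall i, polyGrowth T (v i)) (wC : forall i, polyGrowth T (w i)).

(** The penalty grows faster than the solutions, so the penalized difference is nonpositive outside
    a large ball. The maximum is taken over the points of a compact box and over the finitely many
    indices at once. *)
Lemma penalized_max (Psi : R -> 'rV[R]_k -> R) (P : nat) (th Cg : R) i0 ts xs :
  0 < th -> 0 <= Cg -> jcont Psi ->
  (forall i t x, 0 <= t <= T -> `|w i t x| + `|v i t x| <= Cg * (1 + sqnorm x) ^+ P) ->
  (forall t x, 0 <= t <= T -> (1 + sqnorm x) ^+ P.+2 <= Psi t x) ->
  0 <= ts <= T -> 0 < w i0 ts xs - v i0 ts xs - th * Psi ts xs ->
  exists i t0 x0, [/\ 0 <= t0 <= T, 0 < w i t0 x0 - v i t0 x0 - th * Psi t0 x0 &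
    forall j t x, 0 <= t <= T ->
      w j t x - v j t x - th * Psi t x <= w i t0 x0 - v i t0 x0 - th * Psi t0 x0].
Proof.
move=> th0 Cg0 cPsi wv HPsi tsT pos.
pose D i t x := w i t x - v i t x - th * Psi t x.
(* The ball contains [xs], and outside it [th * (1 + sqnorm x)] is at least [Cg]. *)
pose r := 1 + `|xs| + Cg / th.
have Cth : 0 <= Cg / th by rewrite divr_ge0 // ltW.
have r1 : 1 <= r by rewrite /r -addrA lerDl addr_ge0.
have cB : compact (box 0 T r (0 : 'rV[R]_k)) by apply: compact_box; lra.
have Bs : box 0 T r 0 (ts, xs).
  by split => //=; rewrite subr0 /r; lra.
have cD i : {within box 0 T r 0, continuous (fun p : V => D i p.1 p.2)}.
  have Bd : box 0 T r 0 `<=` @dom R k T by move=> p [].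
  have [cw _] := wC i; have [cv _] := vC i.
  move=> p; apply: cvgB; first apply: cvgB.
  - exact: (continuous_subspaceW Bd cw).
  - exact: (continuous_subspaceW Bd cv).
  - apply: cvgM; first exact: cvg_cst.
    by apply: (continuous_subspaceT (f := fun p : V => Psi p.1 p.2)).
have /choice[c cP] : forall i, exists p : V, box 0 T r 0 p /\
    forall q, box 0 T r 0 q -> D i q.1 q.2 <= D i p.1 p.2.
  move=> i; have Bne : box 0 T r (0 : 'rV[R]_k) !=set0 by exists (ts, xs).
  have [p /set_mem pB H] := compact_EVT_max Bne cB (cD i).
  by exists p; split => // q qB; apply: H; rewrite inE.
have [i _ imax] := @Order.TotalTheory.arg_maxP _ R _ i0 predT (fun i => D i (c i).1 (c i).2) isT.
have Dpos : 0 < D i (c i).1 (c i).2.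
  apply: lt_le_trans (imax i0 isT); apply: lt_le_trans pos _.
  exact: ((cP i0).2 (ts, xs) Bs).
have [ciB ciM] := cP i.
exists i, (c i).1, (c i).2; split=> [||j t x tT]; [by case: ciB|exact: Dpos|].
rewrite -!/(D _ _ _).
have [xr|xr] := leP `|x| r.
  apply: le_trans (imax j isT); apply: ((cP j).2 (t, x)).
  by split => //=; rewrite subr0.
apply: le_trans (ltW Dpos); rewrite /D.
set Y := 1 + sqnorm x in wv HPsi *.
have Y1 : 1 <= Y by rewrite lerDl sqnorm_ge0.
have Yr : r <= Y.
  have := norm_sqr_le x; rewrite /Y; set a := `|x| in xr *; nra.
have YP0 : 0 <= Y ^+ P by rewrite exprn_ge0 //; lra.
have h1 := wv j t x tT; have h2 := HPsi t x tT.
have CY : Cg <= th * Y.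
  have : Cg / th <= Y by have := normr_ge0 xs; rewrite /r in Yr; lra.
  by rewrite ler_pdivrMr // mulrC.
have h3 : Cg * Y ^+ P <= th * Y ^+ P.+2.
  have -> : th * Y ^+ P.+2 = th * Y * Y * Y ^+ P by rewrite !exprS; ring.
  apply: ler_wpM2r => //; apply: le_trans CY _.
  by rewrite ler_peMr // mulr_ge0 ?(ltW th0) //; lra.
have h4 : th * Y ^+ P.+2 <= th * Psi t x by rewrite ler_pM2l.
have := ler_norm (w j t x); have := ler_norm (- v j t x); rewrite normrN -/Y in h1 *; lra.
Qed.

Lemma comparison : visc_sub T b sigma psi g w -> visc_super T b sigma psi g v ->
  forall i t x, 0 <= t <= T -> w i t x <= v i t x.
Proof.
move=> [cw [wT sw]] hv; have [cv [vT sv]] := hv.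
move=> i2 ts xs tsT; rewrite leNgt; apply/negP => wv.
have T0 := hT.
have [C1 [P1 [C10 gv]]] := polyGrowth_family vC.
have [C2 [P2 [C20 gw]]] := polyGrowth_family wC.
pose P := (P1 + P2)%N.
have [lam lam0 [cPsi LPsi]] := penalty_supersolution lin_growth P.
set Psi := penalty T lam P.+2 in cPsi LPsi.
have gwv i t x : 0 <= t <= T -> `|w i t x| + `|v i t x| <= (C1 + C2) * (1 + sqnorm x) ^+ P.
  move=> tT; have := gv i t x tT; have := gw i t x tT.
  have Y1 : 1 <= 1 + sqnorm x by rewrite lerDl sqnorm_ge0.
  have : C1 * (1 + sqnorm x) ^+ P1 <= C1 * (1 + sqnorm x) ^+ P.
    by apply: ler_wpM2l => //; apply: ler_weXn2l => //; exact: leq_addr.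
  have : C2 * (1 + sqnorm x) ^+ P2 <= C2 * (1 + sqnorm x) ^+ P.
    by apply: ler_wpM2l => //; apply: ler_weXn2l => //; exact: leq_addl.
  lra.
have Psige t x : 0 <= t <= T -> (1 + sqnorm x) ^+ P.+2 <= Psi t x.
  by move=> /andP[_ tT]; exact: penalty_ge.
have Psi1 t x : 0 <= t <= T -> 1 <= Psi t x.
  by move=> tT; apply: le_trans (Psige t x tT); rewrite exprn_ege1 // lerDl sqnorm_ge0.
(* Half of the assumed excess of [w] over [v] survives the penalization. *)
pose th := (w i2 ts xs - v i2 ts xs) / (2 * Psi ts xs).
have Ps := Psi1 ts xs tsT.
have th0 : 0 < th by rewrite divr_gt0 //; lra.
have pos : 0 < w i2 ts xs - v i2 ts xs - th * Psi ts xs.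
  suff -> : th * Psi ts xs = (w i2 ts xs - v i2 ts xs) / 2 by lra.
  by rewrite /th; field; apply/eqP; lra.
have jPsi : jcont Psi by case: cPsi => _ _ _ [].
have [i1 [t0 [x0 [t0T M0 Hmax]]]] := penalized_max th0 (addr_ge0 C10 C20) jPsi gwv Psige tsT pos.
set M := _ - _ in M0 Hmax.
(* At the final time both solutions vanish and the penalty is positive, so a positive maximum cannot
   sit there. *)
have t0lt : 0 <= t0 < T.
  move: t0T => /andP[-> /=]; rewrite le_eqVlt => /orP[/eqP e|//].
  move: M0; rewrite /M e wT vT; have := Psi1 T x0; rewrite lexx (ltW hT) => /(_ isT).
  move=> p1; have := mulr_gt0 th0 (lt_le_trans ltr01 p1); lra.
have obv i j : j != i -> v j t0 x0 - g i j t0 x0 <= v i t0 x0.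
  exact: (supersolution_obstacle gc hv).
(* If the obstacle of [w] is attained at a maximal index [i] through [j], then, as [v] lies above
   its own obstacle, [w j - v j] is at least [w i - v i]; maximality makes all of these equalities,
   so [j] is maximal too and the cost is exactly [w j - w i]. *)
have [i iM iob] : exists2 i, w i t0 x0 - v i t0 x0 - th * Psi t0 x0 = M &
    forall j, j != i -> w j t0 x0 - g i j t0 x0 < w i t0 x0.
  apply: contrapT => no.
  apply: (@no_obstacle_loop R k m T g gloop (fun i => w i t0 x0)
    (fun i => w i t0 x0 - v i t0 x0 - th * Psi t0 x0 == M) i1 t0 x0 t0T (eqxx M)).
  move=> i /eqP iM.
  have [j ji] : exists2 j, j != i & w i t0 x0 <= w j t0 x0 - g i j t0 x0.
    apply: contrapT => noj; apply: no; exists i => // j ji.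
    by rewrite ltNge; apply/negP => l; apply: noj; exists j.
  move=> wij; have vij := obv i j ji; have jM := Hmax j t0 x0 t0T.
  exists j; last by split=> //; lra.
  by apply/eqP; lra.
have /andP[t00 t0T'] := t0lt.
have [r r0 Hr] : exists2 r : R, 0 < r & forall j, j != i -> forall t x, 0 <= t <= T ->
    `|t - t0| < r -> `|x - x0| < r -> w j t x - g i j t x < w i t x.
  apply: ex_pos_fin => [j|j r r' rr' H ji t x tT tr xr]; last first.
    by apply: H => //; [exact: lt_le_trans tr rr'|exact: lt_le_trans xr rr'].
  have [->|ji] := eqVneq j i; first by exists 1.
  pose f t x := w i t x - (w j t x - g i j t x).
  have cf : contOn T f.
    by move=> p; apply: cvgB; [exact: cw|apply: cvgB; [exact: cw|exact: gc]].
  have f0 : 0 < f t0 x0 / 2 by have := iob j ji; rewrite /f; lra.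
  have [r r0 H] := within_box_cont x0 cf t0T f0; exists r => // _ t x tT tr xr.
  by move: f0; have := H t x tT tr xr; rewrite ler_norml /f; lra.
pose rho := Num.min (Num.min 1 (r / 2)) ((T - t0) / 2).
have rho0 : 0 < rho by rewrite !lt_min ltr01 /=; apply/andP; lra.
have [rho1 rhor rhoT] : [/\ rho <= 1, rho <= r / 2 & rho <= (T - t0) / 2].
  by rewrite /rho; split; rewrite !ge_min lexx ?orbT.
have t0rT : t0 + rho < T by lra.
set B := box (Num.max 0 (t0 - rho)) (t0 + rho) rho x0.
have BP t x : B (t, x) <-> [/\ 0 <= t, `|t - t0| <= rho & `|x - x0| <= rho] by exact: boxP.
have Bd : B `<=` @dom R k T by exact: (box_sub_dom t0rT).
have BT t x : B (t, x) -> 0 <= t < T by exact: (box_dom t0rT).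
have BT' t x : B (t, x) -> 0 <= t <= T by exact: (Bd (t, x)).
have cB : compact B by apply: compact_box; exact: ltW.
have [Mb HMb] := compact_norm_bounded cB (continuous_subspaceW Bd hb).
have [Ms HMs] := compact_norm_bounded cB (continuous_subspaceW Bd hsig).
pose Mc := Num.max Mb Ms.
have bM t x l : B (t, x) -> `|b t x ord0 l| <= Mc.
  move=> Btx; apply: le_trans (abs_coord_le _ _) _.
  by apply: le_trans (HMb _ Btx) _; rewrite le_max lexx.
have sM t x l j : B (t, x) -> `|sigma t x l j| <= Mc.
  move=> Btx; apply: (@le_trans _ _ `|sigma t x|).
    by rewrite [leRHS]mx_normrE; exact: (le_bigmax _ (fun ij => `|sigma t x ij.1 ij.2|) (l, j)).
  by apply: le_trans (HMs _ Btx) _; rewrite le_max lexx orbT.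
have [cq qB] := C12_qdist b sigma t0 x0.
set q := qdist t0 x0 in cq qB.
pose Cq := 2 + (k%:R ^+ 2 * d%:R * (Mc ^+ 2 * 2) + k%:R * (Mc * 2)).
have qB' t x : B (t, x) -> `|dt q t x + genA b sigma q t x| <= Cq.
  move=> Btx; have [_ a2 a3] := (BP t x).1 Btx.
  apply: qB => [||l|l j]; [exact: le_trans a2 rho1|exact: le_trans a3 rho1| |].
    exact: bM.
  exact: sM.
have B0 : B (t0, x0) by apply/BP; rewrite !subrr !normr0 (ltW rho0).
have Cq0 : 0 <= Cq := le_trans (normr_ge0 _) (qB' _ _ B0).
(* The paraboloid may use up at most half of the strictness [th] gained from the penalty; the other
   half is the [kap] of the local comparison. *)
pose c := th / (2 * (Cq + 1)).
have Cq1 : 0 < 2 * (Cq + 1) by lra.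
have c0 : 0 < c by rewrite divr_gt0.
have cCq : c * Cq <= th / 2.
  have : c * (2 * (Cq + 1)) = th by rewrite /c divfK // gt_eqF.
  lra.
(* The constant [M - c] makes [z] equal to [w i] at the centre, [- c] cancelling the 1 inside
   [qdist]. Maximality then gives [w i <= z] minus the paraboloid, hence a gap [c * rho ^+ 2] on the
   boundary. *)
pose z t x := v i t x + (th * Psi t x + (c * q t x + (M - c))).
have rho2 : 0 < c * rho ^+ 2 by rewrite mulr_gt0 // exprn_gt0.
have th2 : 0 < th / 2 by lra.
have cz : contOn T z.
  have jq : jcont q by case: cq => _ _ _ [].
  have cPsiT : contOn T Psi by apply: continuous_subspaceT.
  have cqT : contOn T q by apply: continuous_subspaceT.
  have cst a : contOn T (fun _ (_ : 'rV[R]_k) => a) by move=> p; exact: cvg_cst.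
  move=> p; apply: cvgD; first exact: cv.
  apply: cvgD; first by apply: cvgM; [exact: cst|exact: cPsiT].
  by apply: cvgD; [apply: cvgM; [exact: cst|exact: cqT]|exact: cst].
have qE t x : q t x = (t - t0) ^+ 2 + sqnorm (x - x0) + 1 by exact: qdistE.
have wz t x : B (t, x) -> w i t x <= z t x - c * ((t - t0) ^+ 2 + sqnorm (x - x0)).
  by move=> Btx; have := Hmax i t x (BT' _ _ Btx); rewrite /z qE; lra.
suff : w i t0 x0 < z t0 x0.
  rewrite /z qE !subrr expr0n /= (_ : sqnorm 0 = 0); first by lra.
  by apply: big1 => l _; rewrite mxE expr0n.
apply: (local_comparison rho0 t00 t0rT hb hsig lip th2 rho2 (cw i) cz (@psic i)).
- move=> t x phi Btx tr xr cphi lm.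
  (* The definition of viscosity solution asks the test function to agree with the solution at the
     point, so [phi] is shifted by a constant. *)
  have [c12 dE gE] := C12_affine b sigma 1 (w i t x - phi t x) cphi.
  have lm' : locmax T (fun s y => w i s y - (1 * phi s y + (w i t x - phi t x))) t x.
    case: lm => e e0 lm; exists e => // s y sT st yx.
    by have := lm s y sT st yx; lra.
  have e0 : 1 * phi t x + (w i t x - phi t x) = w i t x by ring.
  have := hjb_le0 (sw i t x _ (BT _ _ Btx) c12 e0 lm'); rewrite dE gE !mul1r; apply.
  have rr : rho <= r by lra.
  by move=> j ji; apply: (Hr j ji t x (BT' _ _ Btx)); exact: lt_le_trans rr.
- move=> t x phi Btx tr xr cphi lm.
  have [A1 A2 _ _] := C12_lin (- th) cPsi cphi.
  have A3 := genA_lin b sigma (- th) t x cPsi cphi.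
  have [D1 D2 _ _] := C12_lin (- c) cq A1.
  have D3 := genA_lin b sigma (- c) t x cq A1.
  (* Subtracting the smooth perturbation from [phi] turns a test function for [z] into one for
     [v i]. *)
  set phi' := flin (- c) q (flin (- th) Psi phi) in D1 D2 D3.
  have [c12 dE gE] := C12_affine b sigma 1 (v i t x - phi' t x) D1.
  have lm' : locmax T (fun s y => (1 * phi' s y + (v i t x - phi' t x)) - v i s y) t x.
    case: lm => e e0 lm; exists e => // s y sT st yx.
    by have := lm s y sT st yx; rewrite /phi' /flin /z; lra.
  have e0 : 1 * phi' t x + (v i t x - phi' t x) = v i t x by ring.
  have [_] := hjb_ge0 (sv i t x _ (BT _ _ Btx) c12 e0 lm').
  rewrite dE gE D2 D3 A2 A3 /flin.
  have := qB' t x Btx; have := LPsi t x (BT' _ _ Btx).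
  move: (dt Psi t x) (dt q t x) (dt phi t x) => u1 u2 u3.
  move: (genA b sigma Psi t x) (genA b sigma q t x) (genA b sigma phi t x) => y1 y2 y3 l1 l2 l3.
  have l4 : th * 1 <= th * (- u1 - y1) by rewrite ler_pM2l.
  have l5 : c * (u2 + y2) <= c * Cq.
    by rewrite ler_pM2l //; apply: le_trans (ler_norm _) l2.
  lra.
- move=> t x Btx; apply: le_trans (wz t x Btx) _.
  by rewrite gerBl mulr_ge0 ?(ltW c0) // addr_ge0 ?sqr_ge0 ?sqnorm_ge0.
- move=> t x Btx bdr; apply: le_trans (wz t x Btx) _.
  rewrite lerD2l lerN2 ler_pM2l //.
  case: bdr => <-.
    by rewrite real_normK ?num_real // lerDl sqnorm_ge0.
  by apply: le_trans (norm_sqr_le _) _; rewrite lerDr sqr_ge0.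
Qed.
End Comparison.

Unset Implicit Arguments.

Theorem theorem5p1 (R : realType) (k d m : nat) (T : R) (hT : 0 < T)
  (b : R -> 'rV[R]_k -> 'rV[R]_k) (sigma : R -> 'rV[R]_k -> 'M[R]_(k, d))
  (psi : 'I_m -> R -> 'rV[R]_k -> R) (g : 'I_m -> 'I_m -> R -> 'rV[R]_k -> R)
  (hb : {within @dom R k T, continuous (fun p : R * 'rV[R]_k => b p.1 p.2)})
  (hsig : {within @dom R k T, continuous (fun p : R * 'rV[R]_k => sigma p.1 p.2)})
  (hbsig : exists C : R, forall t x x', 0 <= t <= T ->
      fnorm (sigma t x) + enorm (b t x) <= C * (1 + enorm x) /\
      fnorm (sigma t x - sigma t x') + enorm (b t x - b t x') <= C * enorm (x - x'))
  (hpsic : forall i, contOn T (psi i))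
  (hgc : forall i j, contOn T (g i j))
  (hgrow : exists C gam : R, forall i j t x, 0 <= t <= T ->
      `|psi i t x| + `|g i j t x| <= C * (1 + enorm x `^ gam))
  (hgii : forall i t x, 0 <= t <= T -> g i i t x = 0)
  (hgij : forall i j t x, 0 <= t <= T -> i != j -> 0 < g i j t x + g j i t x)
  (hloop : forall (n : nat) (s : 'I_n -> 'I_m) t x, 0 <= t <= T ->
      (2 <= n)%N -> injective s ->
      0 < \sum_(l < n) g (s l) (s (ordS l)) t x)
  (v w : 'I_m -> R -> 'rV[R]_k -> R)
  (hv : visc_sol T b sigma psi g v) (hw : visc_sol T b sigma psi g w)
  (hvC : forall i, polyGrowth T (v i)) (hwC : forall i, polyGrowth T (w i)) :
  forall i t x, 0 <= t <= T -> v i t x = w i t x.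
Proof.
have [C hC] := hbsig.
have lin t x : 0 <= t <= T -> fnorm (sigma t x) + enorm (b t x) <= C * (1 + enorm x).
  by move=> tT; exact: (hC t x x tT).1.
have lip t x x' : 0 <= t <= T ->
    fnorm (sigma t x - sigma t x') + enorm (b t x - b t x') <= C * enorm (x - x').
  by move=> tT; exact: (hC t x x' tT).2.
move=> i t x tT; apply/eqP; rewrite eq_le; apply/andP; split.
  exact: (comparison hT hb hsig lin lip hpsic hgc hloop hwC hvC hv.2 hw.1 i x tT).
exact: (comparison hT hb hsig lin lip hpsic hgc hloop hvC hwC hw.2 hv.1 i x tT).
Qed.
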